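(* Let $\Phi\in C_0^\infty(B(0,1))$, with $B(0,1)\subset\mathbb{R}^n$ the unit ball, and $\eta\in C_0^\infty([-1,1])$ satisfy $\Phi,\eta\ge0$ and $\int_{B(0,1)}\Phi(x)\,dx=\int_{[-1,1]}\eta(t)\,dt=1$. For $\epsilon>0$ let $\Phi_\epsilon(x)=\epsilon^{-n}\Phi(x/\epsilon)$ and $\eta_\epsilon(t)=\epsilon^{-1}\eta(t/\epsilon)$. Suppose $b\in L^\infty([0,\infty),\mathrm{BMO}(\mathbb{R}^n))$ satisfies $$\frac{1}{|B(0,1)|}\int_{B(0,1)}b(t,x)\,dx=0\qquad\text{for all }t\in[0,\infty).$$ Define $$b_\epsilon(t,x)=\int_{-\epsilon}^{+\epsilon}\int_{B(0,\epsilon)}\Phi_\epsilon(y)\eta_\epsilon(s)\,b(t-s,x-y)\,dy\,ds.$$ Then $b_\epsilon\to b$ locally in $L^p$ (as $\epsilon\to0$) for any $1\le p<\infty$, and $$\|b_\epsilon\|_{L^\infty(\mathrm{BMO}(\mathbb{R}^n))}\le\|b\|_{L^\infty(\mathrm{BMO}(\mathbb{R}^n))}.$$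
   Context: For $g$ locally integrable on $\mathbb{R}^n$, $\|g\|_{\mathrm{BMO}}=\sup_B\frac1{|B|}\int_B|g-g_B|\,dx$, where $B$ ranges over all open balls and $g_B=\frac1{|B|}\int_B g\,dx$. $b\in L^\infty([0,\infty),\mathrm{BMO}(\mathbb{R}^n))$ means that $b$ is a measurable function of $(t,x)\in[0,\infty)\times\mathbb{R}^n$ with $\|b\|_{L^\infty(\mathrm{BMO}(\mathbb{R}^n))}=\sup_{t\ge0}\|b(t,\cdot)\|_{\mathrm{BMO}}<\infty$. $B(0,\epsilon)$ is the ball of radius $\epsilon$ centered at the origin of $\mathbb{R}^n$. *)

(* Defs.v *)
From HB Require Import structures.
From mathcomp Require Import all_boot all_order all_algebra.
From mathcomp Require Import all_classical all_reals all_analysis.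

Set Implicit Arguments.
Unset Strict Implicit.
Unset Printing Implicit Defensive.

Import Order.TTheory GRing.Theory Num.Theory.
Import numFieldNormedType.Exports.

Local Open Scope classical_set_scope.
Local Open Scope ring_scope.

(* 'rV[R]_n carries the product sigma-algebra, as n.-tuple R does in the
   library. *)
Section measurable_rV.
Context {R : realType} (n : nat).

Let coords : 'I_n -> 'rV[R]_n -> R := fun i x => x ord0 i.

Let rV_set0 : g_sigma_preimage coords set0.
Proof. exact: sigma_algebra0. Qed.

Let rV_setC A : g_sigma_preimage coords A -> g_sigma_preimage coords (~` A).
Proof. exact: sigma_algebraC. Qed.

Let rV_bigcup (F : (set 'rV[R]_n)^nat) : (forall i, g_sigma_preimage coords (F i)) ->
  g_sigma_preimage coords (\bigcup_i (F i)).
Proof. exact: sigma_algebra_bigcup. Qed.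

HB.instance Definition _ := @isMeasurable.Build default_measure_display
  'rV[R]_n (g_sigma_preimage coords) rV_set0 rV_setC rV_bigcup.

Lemma measurable_coord (i : 'I_n) :
  measurable_fun [set: 'rV[R]_n] (fun x : 'rV[R]_n => x ord0 i : R).
Proof.
move=> _ Y mY; rewrite setTI; apply: sub_sigma_algebra => /=.
rewrite -bigcup_seq/=; exists i => /=; first by rewrite mem_index_enum.
by exists Y => //; rewrite setTI.
Qed.

Lemma measurable_fun_coordP d (T : measurableType d) (f : T -> 'rV[R]_n) :
  (forall i, measurable_fun [set: T] (fun t => f t ord0 i : R)) ->
  measurable_fun [set: T] f.
Proof.
move=> mf _ A mA; rewrite setTI.
suff : g_sigma_preimage coords `<=` [set B | measurable (f @^-1` B)] by apply.
apply: smallest_sub.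
  split => /=; first by rewrite preimage_set0.
    by move=> B mB; rewrite setTD preimage_setC; exact: measurableC.
  by move=> F mF; rewrite preimage_bigcup; exact: bigcupT_measurable.
rewrite -bigcup_seq/= => B [i _ [Y mY <-]] /=.
rewrite setTI -comp_preimage -[X in measurable X]setTI.
exact: mf.
Qed.

End measurable_rV.

Section rV_cons.
Context {R : realType} (n : nat).

Definition rV_cons (p : R * 'rV[R]_n) : 'rV[R]_n.+1 :=
  row_mx (p.1%:M : 'rV[R]_1) p.2.

Definition rV_uncons (x : 'rV[R]_n.+1) : R * 'rV[R]_n :=
  (x ord0 ord0, \row_i x ord0 (lift ord0 i)).

Lemma rV_cons0 p : rV_cons p ord0 ord0 = p.1.
Proof.
rewrite /rV_cons mxE; case: splitP => [j _|j //].
by rewrite (ord1 j) mxE.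
Qed.

Lemma rV_consS p i : rV_cons p ord0 (lift ord0 i) = p.2 ord0 i.
Proof.
rewrite /rV_cons mxE; case: splitP => [j|j]; first by rewrite (ord1 j).
by move=> /= [/val_inj ->].
Qed.

Lemma rV_consK : cancel rV_cons rV_uncons.
Proof.
move=> p; rewrite /rV_uncons rV_cons0 [RHS]surjective_pairing; congr (_, _).
by apply/rowP => i; rewrite mxE rV_consS.
Qed.

Lemma measurable_rV_cons : measurable_fun setT rV_cons.
Proof.
apply: measurable_fun_coordP => i; have [j ->|->] := unliftP ord0 i.
- under eq_fun do rewrite rV_consS.
  apply: (measurableT_comp (measurable_coord j)); exact: measurable_snd.
- under eq_fun do rewrite rV_cons0.
  exact: measurable_fst.
Qed.

Lemma measurable_rV_uncons : measurable_fun setT rV_uncons.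
Proof.
apply/measurable_fun_pair => /=; first exact: measurable_coord.
apply: measurable_fun_coordP => i.
under eq_fun do rewrite mxE.
exact: measurable_coord.
Qed.

Variable mu : {sigma_finite_measure set 'rV[R]_n -> \bar R}.

Definition cons_measure : set 'rV[R]_n.+1 -> \bar R :=
  pushforward (lebesgue_measure \x mu)%E rV_cons.

Let cons_measure0 : cons_measure set0 = 0%E.
Proof. by rewrite /cons_measure /pushforward preimage_set0 measure0. Qed.

Let cons_measure_ge0 A : (0 <= cons_measure A)%E.
Proof. exact: (measure_ge0 (lebesgue_measure \x mu)%E). Qed.

Let cons_measure_sigma_additive : semi_sigma_additive cons_measure.
Proof.
have mK A : measurable A -> measurable (rV_cons @^-1` A).
  by move=> mA; rewrite -[X in measurable X]setTI; exact: measurable_rV_cons.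
move=> F mF tF mUF; rewrite /cons_measure /pushforward preimage_bigcup.
apply: (@measure_semi_sigma_additive _ _ _ (lebesgue_measure \x mu)%E).
- by move=> k; exact: mK.
- apply/trivIsetP => /= i j _ _ ij; rewrite -preimage_setI.
  by move/trivIsetP : tF => /(_ _ _ _ _ ij) ->//; rewrite preimage_set0.
- by rewrite -preimage_bigcup; exact: mK.
Qed.

HB.instance Definition _ := isMeasure.Build _ _ _ cons_measure
  cons_measure0 cons_measure_ge0 cons_measure_sigma_additive.

Let cons_measure_sigma_finite : sigma_finite setT cons_measure.
Proof.
have /sigma_finiteP[F [TF ndF Foo]] := sigma_finiteT (@lebesgue_measure R).
have /sigma_finiteP[G [TG ndG Goo]] := sigma_finiteT mu.
exists (fun k => rV_uncons @^-1` (F k `*` G k)).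
  apply/esym/seteqP; split=> // x _; rewrite -preimage_bigcup /=.
  have [i _ Fi] : (\bigcup_i F i) (rV_uncons x).1 by rewrite -TF.
  have [j _ Gj] : (\bigcup_j G j) (rV_uncons x).2 by rewrite -TG.
  exists (maxn i j) => //; split => /=.
    by move: Fi; exact/subsetPset/ndF/leq_maxl.
  by move: Gj; exact/subsetPset/ndG/leq_maxr.
move=> k; have [mF Fk] := Foo k; have [mG Gk] := Goo k; split.
  rewrite -[X in measurable X]setTI; apply: measurable_rV_uncons => //.
  exact: measurableX.
rewrite /cons_measure /pushforward -comp_preimage.
rewrite (_ : rV_uncons \o rV_cons = id); last first.
  by apply/funext => p /=; rewrite rV_consK.
rewrite [ltLHS](_ : _ = (lebesgue_measure \x mu)%E (F k `*` G k))//.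
by rewrite product_measure1E// lte_mul_pinfty// ge0_fin_numE.
Qed.

HB.instance Definition _ := Measure_isSigmaFinite.Build _ _ _ cons_measure
  cons_measure_sigma_finite.

End rV_cons.

(* n-fold product of the Lebesgue measure of R, on the product sigma-algebra *)
Fixpoint borel_rV {R : realType} (n : nat) :
    {sigma_finite_measure set 'rV[R]_n -> \bar R} :=
  match n return {sigma_finite_measure set 'rV[R]_n -> \bar R} with
  | 0 => \d_(0 : 'rV[R]_0)
  | m.+1 => cons_measure (borel_rV m)
  end.

(* The Lebesgue measures of R^n and of R x R^n are the completions of the
   product measures; measurability with respect to them is Lebesgue
   measurability. *)
Section lebesgue_rV.
Context (R : realType) (n : nat).

Definition leb_rV := @completed_measure_extension _ _ R (borel_rV n).
HB.instance Definition _ := Measure.on leb_rV.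

Definition leb_time_rV :=
  @completed_measure_extension _ _ R (lebesgue_measure \x borel_rV n)%E.
HB.instance Definition _ := Measure.on leb_time_rV.

End lebesgue_rV.
Arguments leb_rV {R n}.
Arguments leb_time_rV {R n}.

Definition lmeasurable_fun {R : realType} {n : nat} (D : set 'rV[R]_n)
    (f : 'rV[R]_n -> R) : Prop :=
  measurable_fun (D : set (caratheodory_type (borel_rV n)^*%mu)) f.

Definition lmeasurable_fun_time {R : realType} {n : nat}
    (D : set (R * 'rV[R]_n)) (f : R * 'rV[R]_n -> R) : Prop :=
  measurable_fun
    (D : set (caratheodory_type (lebesgue_measure \x borel_rV n)%E^*%mu)) f.

Section smooth.
Context {R : realType} {V : normedModType R}.

Fixpoint Ck (k : nat) (f : V -> R) : Prop :=
  if k is j.+1 then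
    continuous f /\ forall v, (forall x, derivable f x v) /\ Ck j (fun x => 'D_v f x)
  else continuous f.

Definition smooth (f : V -> R) := forall k, Ck k f.

Definition supp (f : V -> R) : set V := closure [set x | f x != 0].

(* C_0^oo(D) *)
Definition Cinfty0 (D : set V) (f : V -> R) :=
  [/\ smooth f, compact (supp f) & supp f `<=` D].

End smooth.

Section BMO.
Context {R : realType} {n : nat}.
Implicit Types (g : 'rV[R]_n -> R) (b : R -> 'rV[R]_n -> R).

(* The library's norm and ball on 'rV[R]_n are those of the sup norm. *)
Definition enorm (x : 'rV[R]_n) : R := Num.sqrt (\sum_i x ord0 i ^+ 2).

Definition eball (c : 'rV[R]_n) (r : R) : set 'rV[R]_n :=
  [set x | enorm (x - c) < r].

Definition mean (B : set 'rV[R]_n) g : R :=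
  (fine (leb_rV B))^-1 * \int[leb_rV]_(x in B) g x.

Definition locally_integrable_rV g :=
  lmeasurable_fun setT g /\
  forall K : set 'rV[R]_n, compact K ->
    (\int[leb_rV]_(x in K) `|g x|%:E < +oo)%E.

Definition oscillation (B : set 'rV[R]_n) g : \bar R :=
  ((fine (leb_rV B))^-1%:E * \int[leb_rV]_(x in B) `|g x - mean B g|%:E)%E.

Definition BMO_norm g : \bar R :=
  ereal_sup [set oscillation (eball p.1 p.2) g | p in [set p : 'rV[R]_n * R | 0 < p.2]].

Definition Linfty_BMO_norm b : \bar R :=
  ereal_sup [set BMO_norm (b t) | t in `[0, +oo[%classic].

Definition half_space : set (R * 'rV[R]_n) := [set z | 0 <= z.1].

(* Values of b at negative times are irrelevant here and below. *)
Definition Linfty_BMO b :=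
  [/\ lmeasurable_fun_time half_space (fun z => b z.1 z.2),
      forall t, 0 <= t -> locally_integrable_rV (b t) &
      (Linfty_BMO_norm b < +oo)%E].

(* b(t,.) is extended by 0 to t < 0, so that the integral makes sense when
   t < eps. *)
Definition mollify (Phi : 'rV[R]_n -> R) (eta : R -> R) b (eps t : R)
    (x : 'rV[R]_n) : R :=
  let Phi_eps y := (eps ^+ n)^-1 * Phi (eps^-1 *: y) in
  let eta_eps s := eps^-1 * eta (s / eps) in
  let b0 t x := if 0 <= t then b t x else 0 in
  \int[completed_lebesgue_measure]_(s in `[- eps, eps]%classic)
    \int[leb_rV]_(y in eball 0 eps)
      (Phi_eps y * eta_eps s * b0 (t - s) (x - y)).

Definition Lp_on (p : R) (K : set (R * 'rV[R]_n)) (f : R * 'rV[R]_n -> R) :=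
  lmeasurable_fun_time K f /\
  ('N[leb_time_rV]_p%:E[EFin \o (f \_ K)] < +oo)%E.

(* f_eps --> f in L^p(K) for every compact subset K of [0,oo) x R^n *)
Definition cvg_Lploc (p : R) (f_ : R -> R -> 'rV[R]_n -> R) b :=
  forall K : set (R * 'rV[R]_n), compact K -> K `<=` half_space ->
  [/\ Lp_on p K (fun z => b z.1 z.2),
      forall eps, 0 < eps -> Lp_on p K (fun z => f_ eps z.1 z.2) &
      'N[leb_time_rV]_p%:E[EFin \o
         ((fun z => (f_ eps z.1 z.2 - b z.1 z.2)%R) \_ K)]%E @[eps --> 0^'+] --> 0%E].

End BMO.

(* Main.v *)
(* Let [f] be a Borel representative of [b], extended by 0 to negative times,
   each of whose time sections either vanishes or agrees a.e. with that of [b];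
   the mollification of [b] is then everywhere the convolution of [f] with the
   kernel. Since the kernel is a probability density, Fubini's theorem bounds the
   oscillation of [b_eps(t,.)] on a ball by an average of oscillations of
   [f(t-s,.)] on translated balls, whence the BMO estimate.
   The BMO bound and the vanishing means on the unit ball bound [f(t,.)] in L^1 of
   every ball, uniformly in [t], so continuity of translations in L^1 gives
   [b_eps -> b] in L^1 of every box. By the John-Nirenberg inequality,
   [exp (c |b_eps - b|)] is integrable on boxes, uniformly in [eps], and the
   elementary bound [u^p <= N u + delta exp (c u)] turns L^1 convergence into L^p
   convergence.
   The John-Nirenberg inequality is proved by following the averages of [g] down
   the dyadic tree of a cube, stopping when they are farther than [4 M] from the
   top average: this happens on at most half of the cube, so that an exponential
   bound by 6 propagates by induction on the depth. *)
Require Import Defs.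
From HB Require Import structures.
From mathcomp Require Import all_boot all_order all_algebra.
From mathcomp Require Import all_classical all_reals all_analysis measurable_realfun.
From mathcomp Require Import ring lra.
Import Order.TTheory GRing.Theory Num.Theory.
Import numFieldNormedType.Exports.
Local Open Scope classical_set_scope.
Local Open Scope ring_scope.

Set Implicit Arguments.
Unset Strict Implicit.
Unset Printing Implicit Defensive.


(** The supremum over every time is the obstacle: Fubini's theorem controls the sections of a
    jointly measurable function only for almost every time, whereas the norm and the mean condition
    see all of them. The zero function satisfies every bound in play, so it can replace bad sections
    at no cost. L^p convergence requires uniform integrability of the p-th power of the error, which
    L^1 bounds alone cannot give; the exponential estimate supplies it. Only its uniformity matters,
    so its constants are crude. The dyadic argument invokes no pointwise convergence of averages.
    Everything is proved at finite depth, where the averages form a finite tree; the passage to [g]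
    is made in L^1, by density of continuous functions, with a truncated and hence Lipschitz
    exponential. Cubes are used there because they subdivide exactly, and are compared with the
    balls of the definition at the cost of a dimensional factor. The BMO estimate itself stays on
    balls throughout, which is why it loses no constant. *)

Section cvg_to_0_ereal.
Context {R : realType} {T : Type} {F : set_system T} {FF : Filter F}.
Implicit Type f : T -> \bar R.

Lemma cvge0_lt f (e : R) : 0 < e -> f x @[x --> F] --> 0%E ->
  \forall x \near F, (f x < e%:E)%E.
Proof.
move=> e0 f0; apply: (f0 [set y | (y < e%:E)%E]); exists e => //= x /=.
by rewrite sub0r normrN lte_fin; exact: le_lt_trans (ler_norm _).
Qed.

Lemma ge0_cvge0 f : (\forall x \near F, 0 <= f x)%E ->
  (forall e, 0 < e -> \forall x \near F, (f x <= e%:E)%E) ->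
  f x @[x --> F] --> 0%E.
Proof.
move=> f0 fe A [e /= e0 eA].
have e20 : 0 < e / 2 by rewrite divr_gt0.
suff : \forall x \near F, A (f x) by [].
near=> x.
have f0x : (0 <= f x)%E by near: x.
have fex : (f x <= (e / 2)%:E)%E by near: x; exact: fe.
have ffin : f x \is a fin_num by rewrite ge0_fin_numE// (le_lt_trans fex)// ltry.
have {}eA : forall r : R, `|0 - r| < e -> A r%:E by move=> r /eA.
rewrite -(fineK ffin); apply: eA; rewrite sub0r normrN ger0_norm ?fine_ge0//.
by rewrite -lte_fin fineK// (le_lt_trans fex)// lte_fin; lra.
Unshelve. all: by end_near. Qed.

End cvg_to_0_ereal.

(** * Completed measures *)

Section measure_preserving.
Context d1 d2 (T1 : measurableType d1) (T2 : measurableType d2) (R : realType).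
Variables (m1 : {measure set T1 -> \bar R}) (m2 : {measure set T2 -> \bar R}).
Variable phi : T1 -> T2.
Hypothesis mphi : measurable_fun [set: T1] phi.
Hypothesis phiE : forall A, measurable A -> m1 (phi @^-1` A) = m2 A.

Lemma ge0_integral_measure_preserving (D : set T2) (f : T2 -> \bar R) :
  measurable D -> measurable_fun D f -> (forall x, D x -> (0 <= f x)%E) ->
  (\int[m1]_(x in phi @^-1` D) f (phi x) = \int[m2]_(y in D) f y)%E.
Proof.
move=> mD mf f0.
rewrite -(ge0_integral_pushforward mphi m1 mD mf); last first.
  by move=> y; rewrite inE => /f0.
by apply: eq_measure_integral => A mA AD; rewrite -phiE.
Qed.

Lemma integral_measure_preserving (D : set T2) (f : T2 -> \bar R) :
  measurable D -> measurable_fun D f ->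
  (\int[m1]_(x in phi @^-1` D) f (phi x) = \int[m2]_(y in D) f y)%E.
Proof.
move=> mD mf; rewrite integralE [RHS]integralE; congr (_ - _)%E.
- rewrite -ge0_integral_measure_preserving//; last exact/measurable_funepos.
  by apply: eq_integral => x _; rewrite !funeposE.
- rewrite -ge0_integral_measure_preserving//; last exact/measurable_funeneg.
  by apply: eq_integral => x _; rewrite !funenegE.
Qed.

End measure_preserving.

Section completion.
Context d (T : measurableType d) (R : realType).
Variable mu : {sigma_finite_measure set T -> \bar R}.
Local Notation cmu := (@completed_measure_extension _ _ R mu).
Local Notation cT := (caratheodory_type (mu^*)%mu).

Lemma completed_measurable (A : set T) : measurable A -> measurable (A : set cT).
Proof. exact: caratheodory_measurable_mu_ext. Qed.

Lemma completed_measurable_fun d' (U : measurableType d') (D : set T)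
    (f : T -> U) : measurable_fun D f -> measurable D ->
  measurable_fun (D : set cT) f.
Proof.
by move=> mf mD _ Y mY; apply: completed_measurable; exact: mf.
Qed.

Lemma completedE (A : set T) : measurable A -> cmu A = mu A.
Proof. exact: measurable_mu_extE. Qed.

Lemma completed_complete : measure_is_complete cmu.
Proof. exact: measure_is_complete_caratheodory. Qed.

Lemma completed_integral (D : set T) (f : T -> \bar R) :
  measurable D -> measurable_fun D f ->
  (\int[cmu]_(x in D) f x = \int[mu]_(x in D) f x)%E.
Proof.
move=> mD mf.
have mid : measurable_fun [set: cT] (idfun : cT -> T).
  by move=> _ Y mY; rewrite setTI; exact: completed_measurable.
exact: (@integral_measure_preserving _ _ cT T R cmu mu idfun mid completedE).
Qed.

(** [cmu E] is an infimum over countable measurable covers of [E]. Intersecting covers whose excess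
    is at most [1/(k+1)] leaves a single measurable superset that attains the infimum. *)
Lemma completed_hull (E : set T) :
  exists B, [/\ measurable B, E `<=` B & (mu B <= cmu E)%E].
Proof.
have [Efin|] := boolP (cmu E \is a fin_num); last first.
  rewrite ge0_fin_numE// -leNgt leye_eq => /eqP ->.
  by exists setT; split => //; rewrite leey.
have inv0 k : (0 < k.+1%:R^-1 :> R)%R by rewrite invr_gt0.
have cover k : exists C, [/\ measurable C, E `<=` C &
    (mu C <= cmu E + (k.+1%:R^-1)%:E)%E].
  have /= [_ [A [mA EA] <-] /ltW Ale] := lb_ereal_inf_adherent (inv0 k) Efin.
  exists (\bigcup_i A i); split => //; first exact: bigcupT_measurable.
  apply: le_trans Ale.
  by apply: measure_sigma_subadditive => //; exact: bigcupT_measurable.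
pose C k := projT1 (cid (cover k)).
have CP k : [/\ measurable (C k), E `<=` C k &
    (mu (C k) <= cmu E + (k.+1%:R^-1)%:E)%E] by rewrite /C; case: cid.
exists (\bigcap_k C k); split.
- by apply: bigcapT_measurable => k; case: (CP k).
- by apply: sub_bigcap => k _; case: (CP k).
- apply/lee_addgt0Pr => e e0.
  near \oo => k.
  apply: (@le_trans _ _ (mu (C k))).
    apply: le_measure; rewrite ?inE.
    + by apply: bigcapT_measurable => i; case: (CP i).
    + by case: (CP k).
    + exact: bigcap_inf.
  case: (CP k) => _ _ /le_trans; apply.
  rewrite leeD2l// lee_fin ltW//.
  by near: k; exact: near_infty_natSinv_lt (PosNum e0).
Unshelve. all: by end_near. Qed.

Lemma completed_negligible (N : set T) : cmu.-negligible N -> mu.-negligible N.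
Proof.
move=> [A [mA A0 NA]]; have [B [mB AB BA]] := completed_hull A.
exists B; split => //; last exact: subset_trans AB.
by apply/eqP; rewrite -measure_le0 -A0.
Qed.

(** A measurable hull minus the set is null only where measures can be subtracted, hence the
    exhaustion by the sets [F k] of finite measure; the exceptional null sets are then united. *)
Lemma completed_set_representative (A : set T) : measurable (A : set cT) ->
  exists B N, [/\ measurable B, measurable N, mu N = 0%E & A `\` N = B `\` N].
Proof.
move=> mA; have /sigma_finiteP[F [TF ndF Foo]] := sigma_finiteT mu.
have rep k : exists BN : set T * set T, [/\ measurable BN.1, measurable BN.2, mu BN.2 = 0%E &
    (A `&` F k) `\` BN.2 = BN.1 `\` BN.2].
  have [mF Fk] := Foo k.
  have mAF : measurable (A `&` F k : set cT).
    by apply: measurableI => //; exact: completed_measurable.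
  have [B [mB AB BA]] := completed_hull (A `&` F k).
  have mcB : measurable (B : set cT) by exact: completed_measurable.
  have Aoo : (cmu (A `&` F k) < +oo)%E.
    apply: le_lt_trans Fk; apply: (@le_trans _ _ (cmu (F k))); last by rewrite completedE.
    by apply: le_measure => //; rewrite inE//; exact: completed_measurable.
  have : cmu (B `\` (A `&` F k)) = 0%E.
    have BAE : (cmu B <= cmu (A `&` F k))%E by apply: le_trans BA; rewrite completedE.
    have Boo : (cmu B < +oo)%E by exact: le_lt_trans Aoo.
    apply/eqP; rewrite eq_le measure_ge0 andbT measureD// setIidr//.
    by rewrite leeBlDr ?add0e// ge0_fin_numE.
  move=> D0; have : cmu.-negligible (B `\` (A `&` F k)).
    by exists (B `\` (A `&` F k)); split => //; exact: measurableD.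
  move=> /completed_negligible[N [mN N0 DN]].
  exists (B, N); split => //=; apply/seteqP; split => x [H Nx]; split => //.
    exact: AB.
  by apply: contrapT => nAF; apply: Nx; apply: DN.
pose BN k := projT1 (cid (rep k)).
have BNP k : [/\ measurable (BN k).1, measurable (BN k).2, mu (BN k).2 = 0%E &
    (A `&` F k) `\` (BN k).2 = (BN k).1 `\` (BN k).2] by rewrite /BN; case: cid.
exists (\bigcup_k (BN k).1), (\bigcup_k (BN k).2); split.
- by apply: bigcupT_measurable => k; case: (BNP k).
- by apply: bigcupT_measurable => k; case: (BNP k).
- apply/negligibleP; first by apply: bigcupT_measurable => k; case: (BNP k).
  apply: negligible_bigcup => k; apply/negligibleP; first by case: (BNP k).
  by case: (BNP k).
- apply/seteqP; split => x [H Nx]; split => //.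
    have [k _ Fkx] : (\bigcup_i F i) x by rewrite -TF.
    exists k => //; have [_ _ _ E] := BNP k.
    have : ((A `&` F k) `\` (BN k).2) x by split => // Nkx; apply: Nx; exists k.
    by rewrite E => -[].
  case: H => k _ Bkx; have [_ _ _ E] := BNP k.
  have : ((BN k).1 `\` (BN k).2) x by split => // Nkx; apply: Nx; exists k.
  by rewrite -E => -[[]].
Qed.

(** Superlevel sets at rational heights are countably many, so their exceptional null sets have a
    null union [NN]; the function is changed to 0 there. *)
Lemma completed_representative (f : T -> R) :
  measurable_fun [set: cT] f ->
  exists g : T -> R, measurable_fun [set: T] g /\ mu.-negligible [set x | f x != g x].
Proof.
move=> mf.
have mq (q : rat) : measurable ([set x | ratr q < f x] : set cT).
  by rewrite -preimage_itvoy -[X in measurable X]setTI; apply: mf => //; exact: measurable_itv.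
have mq1 q := completed_set_representative (mq q).
pose B q := projT1 (cid (mq1 q)).
have mq2 q : exists N, [/\ measurable (B q), measurable N, mu N = 0%E &
  [set x | ratr q < f x] `\` N = B q `\` N] by rewrite /B; case: cid.
pose N q := projT1 (cid (mq2 q)).
have {}mq q : [/\ measurable (B q), measurable (N q), mu (N q) = 0%E &
  [set x | ratr q < f x] `\` N q = B q `\` N q] by rewrite /N; case: cid.
pose NN := \bigcup_q N q.
have mNN : measurable NN by apply: bigcupT_measurable_rat => q; case: (mq q).
have NN0 : mu.-negligible NN.
  have -> : NN = \bigcup_k (if unpickle k is Some q then N q else set0).
    apply/seteqP; split => x [k _].
      move=> Nk; exists (pickle k); first exact: I.
      rewrite pickleK; exact: Nk.
    by case: unpickle => // q Nq; exists q.
  apply: negligible_bigcup => k; case: unpickle => [q|]; last exact: negligible_set0.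
  by apply/negligibleP; case: (mq q).
exists (fun x => if x \in NN then 0 else f x); split; last first.
  apply: negligibleS NN0 => x /=; case: ifPn => [|_ /eqP//].
  by rewrite inE.
move=> _; apply: (measurability _ (RGenOInfty.measurableE R)) => //.
move=> /= _ [_ [a ->] <-]; rewrite preimage_itvoy setTI.
(* Off [NN], [a < f x] holds exactly if some rational [q] satisfies [a < q < f x]. On [NN] the new
   value is 0, so [NN] belongs to the superlevel set entirely or not at all. *)
rewrite [X in measurable X](_ : _ = (\bigcup_(q : rat) (if a < ratr q then B q `\` NN else set0))
    `|` (if a < 0 then NN else set0)).
  apply: measurableU; last by case: ifP.
  by apply: bigcupT_measurable_rat => q; case: ifP => // _; apply: measurableD => //; case: (mq q).
apply/seteqP; split => x /=.
  case: ifPn => [|/negP]; rewrite inE => xN ax; first by right; rewrite ax.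
  left; have [q] := rat_in_itvoo ax; rewrite inE/= => /itvP h.
  exists q; rewrite ?h//; split => //.
  have [_ _ _ E] := mq q.
  have : ([set x | ratr q < f x] `\` N q) x.
    by split; [rewrite /= h|move=> Nx; apply: xN; exists q].
  by rewrite E => -[].
move=> [[q _]|]; first case: ifP => // aq [Bx xN].
  rewrite ifF; last by apply/negP; rewrite inE.
  have [_ _ _ E] := mq q.
  have : (B q `\` N q) x by split => // Nx; apply: xN; exists q.
  by rewrite -E => -[/= + _]; exact: lt_trans.
case: ifP => // a0 xN; rewrite ifT//; exact/mem_set.
Qed.

End completion.

(** * Borel sets and Lebesgue measure on R^n *)

(** Balls with centres in a countable dense family and radii [1/(m+1)] form a countable base,
    enumerated by [pickle]. This links the topology to the product sigma-algebras, both on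
    ['rV[R]_n] and on space-time. *)
Lemma countable_ball_generates_open (R : realType) (T : pseudoMetricType R)
    (U : countType) (D : U -> T) (G : set (set T)) :
  G set0 ->
  (forall F : (set T)^nat, (forall k, G (F k)) -> G (\bigcup_k F k)) ->
  (forall x e, 0 < e -> exists u, ball x e (D u)) ->
  (forall u r, G (ball (D u) r)) ->
  forall A, open A -> G A.
Proof.
move=> G0 GU Dd Gball A; rewrite openE => oA.
pose F k := if unpickle k is Some (u, m) then
  if `[< ball (D u) m.+1%:R^-1 `<=` A >] then ball (D u) m.+1%:R^-1 else set0
  else set0.
have -> : A = \bigcup_k F k.
  apply/seteqP; split => [x Ax|x [k _]]; last first.
    by rewrite /F; case: unpickle => // -[u m]; case: asboolP => // + ?; apply.
  have /nbhs_ballP[e /= e0 eA] := oA _ Ax.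
  have [m me] : exists m, (m.+1%:R^-1 : R) < e / 2.
    have : \forall m \near \oo, (m.+1%:R^-1 : R) < e / 2.
      exact: (near_infty_natSinv_lt (PosNum (divr_gt0 e0 (ltr0n R 2)))).
    by move=> [m _ /(_ m (leqnn m))]; exists m.
  have [u xu] := Dd x m.+1%:R^-1 ltac:(by rewrite invr_gt0).
  exists (pickle (u, m)); first exact: I.
  rewrite /F pickleK.
  have -> : `[< ball (D u) m.+1%:R^-1 `<=` A >] by apply/asboolP => y uy; apply: eA;
    apply: (@le_ball _ _ _ (m.+1%:R^-1 + m.+1%:R^-1));
    [rewrite [leRHS]splitr lerD// ltW|exact: ball_triangle uy].
  exact: ball_sym.
apply: GU => k; rewrite /F; case: unpickle => [[u m]|//].
by case: ifP => // _; exact: Gball.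
Qed.

Lemma rat_dense (R : realType) (x e : R) : 0 < e -> exists q : rat, ball x e (ratr q).
Proof.
move=> e0; have xe : x - e < x + e by rewrite ltrBlDr -addrA ltrDl addr_gt0.
have [q] := rat_in_itvoo xe.
by rewrite inE => xqe; exists q; rewrite ball_itv.
Qed.

Section borel.
Context {R : realType} {n : nat}.
Local Notation V := 'rV[R]_n.

Let measurable_ball_rV (x : V) (r : R) : measurable (ball x r).
Proof.
have [r0|r0] := ltP 0 r; last first.
  by rewrite (_ : ball x r = set0)//; apply/seteqP; split => // y [/=]; rewrite ltNge r0.
rewrite (_ : ball x r = \bigcap_(i : 'I_n) ((fun y : V => y ord0 i) @^-1` ball (x ord0 i) r)).
  apply: fin_bigcap_measurable => // i _.
  by rewrite -[X in measurable X]setTI; apply: measurable_coord => //; exact: measurable_ball.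
apply/seteqP; split => y /=.
  by move=> [_ xy] i _; exact: xy.
by move=> xy; split => // i j; rewrite (ord1 i); exact: xy.
Qed.

Let rV_rat_dense (x : V) (e : R) : 0 < e ->
  exists q : 'rV[rat]_n, ball x e (map_mx ratr q : V).
Proof.
move=> e0; have /choice[q xq] : forall i, exists q : rat, ball (x ord0 i) e (ratr q).
  by move=> i; exact: rat_dense.
by exists (\row_i q i); split => // i j; rewrite (ord1 i) !mxE.
Qed.

Lemma open_measurable_rV (A : set V) : open A -> measurable A.
Proof.
apply: (countable_ball_generates_open (D := fun q : 'rV[rat]_n => map_mx ratr q : V)) => //.
- by move=> F mF; exact: bigcupT_measurable.
Qed.

Lemma open_measurable_time_rV (A : set (R * V)) : open A -> measurable A.
Proof.
apply: (@countable_ball_generates_open R (R * V)%type _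
  (fun q : rat * 'rV[rat]_n => (ratr q.1 : R, map_mx ratr q.2 : V)) measurable) => //.
- by move=> F mF; exact: bigcupT_measurable.
- move=> [t x] e e0; have [p tp] := rat_dense t e0; have [q xq] := rV_rat_dense x e0.
  by exists (p, q).
- move=> u r; apply: measurableX; first exact: measurable_ball.
  exact: measurable_ball_rV.
Qed.

Lemma continuous_measurable_rV (f : V -> R) :
  continuous f -> measurable_fun setT f.
Proof.
move=> /continuousP cf; apply: (measurability _ (RGenOpens.measurableE R)) => //.
move=> _ [_ [a [b ->]] <-]; rewrite setTI; apply: open_measurable_rV.
by apply: cf; exact: interval_open.
Qed.

Lemma continuous_measurable_time_rV (f : R * V -> R) :
  continuous f -> measurable_fun setT f.
Proof.
move=> /continuousP cf; apply: (measurability _ (RGenOpens.measurableE R)) => //.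
move=> _ [_ [a [b ->]] <-]; rewrite setTI; apply: open_measurable_time_rV.
by apply: cf; exact: interval_open.
Qed.

Lemma compact_measurable_time_rV (K : set (R * V)) : compact K -> measurable K.
Proof.
move=> /compact_closed cK; rewrite -[K]setCK; apply: measurableC.
apply: open_measurable_time_rV; apply: closed_openC; apply: cK.
exact: norm_hausdorff.
Qed.

Lemma compact_measurable_rV (K : set V) : compact K -> measurable K.
Proof.
move=> /compact_closed cK; rewrite -[K]setCK; apply: measurableC.
apply: open_measurable_rV; apply: closed_openC; apply: cK.
exact: norm_hausdorff.
Qed.

End borel.

Section affine_invariance.
Context {R : realType}.

Lemma measurable_affine (a c : R) : measurable_fun setT (fun x : R => a * x + c).
Proof. by apply: measurable_funD => //; exact: measurable_funM. Qed.

(* [measurableTypeR R] and [R] carry the same sigma-algebra with different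
   displays, which unification does not identify. *)
Lemma measurable_fun_measurableTypeR d (U : measurableType d) (D : set R) (f : R -> U) :
  measurable_fun (D : set (measurableTypeR R)) f <-> measurable_fun D f.
Proof. by split => mf mD A mA; exact: mf. Qed.

Let affine_ocitv (a c u v : R) : a != 0 ->
  (lebesgue_measure ((fun x : R => (a * x + c)%R) @^-1` `]u, v]) * `|a|%:E =
   lebesgue_measure (`]u, v]%classic : set R))%E.
Proof.
move=> a0; have /orP[an|ap] : (a < 0) || (0 < a) by rewrite -neq_lt.
- have -> : (fun x : R => a * x + c) @^-1` `]u, v] = `[(v - c) / a, (u - c) / a[%classic.
    apply/seteqP; split => x /=; rewrite !in_itv/= ler_ndivrMr// ltr_ndivlMr//.
      by move=> /andP[? ?]; apply/andP; split; lra.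
    by move=> /andP[? ?]; apply/andP; split; lra.
  rewrite !lebesgue_measure_itv/= !lte_fin ltr_ndivrMr// divfK ?lt_eqF// ltrD2r.
  case: ifPn => uv; last by rewrite mul0e.
  rewrite -!EFinB -EFinM (ltr0_norm an); congr EFin; field.
  by rewrite lt_eqF.
- have -> : (fun x : R => a * x + c) @^-1` `]u, v] = `](u - c) / a, (v - c) / a]%classic.
    apply/seteqP; split => x /=; rewrite !in_itv/= ltr_pdivrMr// ler_pdivlMr//.
      by move=> /andP[? ?]; apply/andP; split; lra.
    by move=> /andP[? ?]; apply/andP; split; lra.
  rewrite !lebesgue_measure_itv/= !lte_fin ltr_pdivrMr// divfK ?gt_eqF// ltrD2r.
  case: ifPn => uv; last by rewrite mul0e.
  rewrite -!EFinB -EFinM (gtr0_norm ap); congr EFin; field.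
  by rewrite gt_eqF.
Qed.

(** Uniqueness of Lebesgue measure: the pushforward scaled by [|a|] has the right values on
    half-open intervals. *)
Lemma lebesgue_measure_affine (a c : R) (A : set R) : a != 0 -> measurable A ->
  (`|a|%:E * lebesgue_measure ((fun x : R => (a * x + c)%R) @^-1` A) =
   lebesgue_measure A)%E.
Proof.
move=> a0 mA.
have mphi : measurable_fun setT ((fun x => a * x + c) : measurableTypeR R -> measurableTypeR R).
  exact: measurable_affine.
pose m : {measure set (measurableTypeR R) -> \bar R} :=
  measure_function_pushforward__canonical__measure_function_Measure lebesgue_measure mphi.
transitivity (mscale (NngNum (normr_ge0 a)) m A) => //.
apply/esym/lebesgue_measure_unique => // X /ocitvP[->|[[u v] /= uv ->]].
  by rewrite !measure0.
by rewrite /mscale /pushforward/= muleC affine_ocitv.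
Qed.

Lemma ge0_integral_lebesgue_affine (a c : R) (f : R -> \bar R) : a != 0 ->
  measurable_fun setT f -> (forall x, 0 <= f x)%E ->
  (`|a|%:E * \int[lebesgue_measure]_x f (a * x + c)%R = \int[lebesgue_measure]_x f x)%E.
Proof.
move=> a0 mf f0.
have mphi : measurable_fun setT ((fun x => a * x + c) : measurableTypeR R -> measurableTypeR R).
  exact: measurable_affine.
rewrite -(@ge0_integral_mscale _ _ R lebesgue_measure setT measurableT (NngNum (normr_ge0 a))) //=; last first.
  exact: (measurableT_comp mf mphi).
rewrite -(@ge0_integral_measure_preserving _ _ (measurableTypeR R) (measurableTypeR R) R
  (mscale (NngNum (normr_ge0 a)) lebesgue_measure) lebesgue_measure _ mphi)//.
by move=> A mA; rewrite /= /mscale/= lebesgue_measure_affine.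
Qed.

Lemma measurable_rV_affine n (a : R) (c : 'rV[R]_n) :
  measurable_fun setT (fun x : 'rV[R]_n => a *: x + c).
Proof.
apply: measurable_fun_coordP => i; under eq_fun do rewrite !mxE.
exact: (measurableT_comp (measurable_affine a (c ord0 i)) (measurable_coord i)).
Qed.

Let measurable_lebesgue_rV_cons n :
  measurable_fun [set: measurableTypeR R * 'rV[R]_n] (@rV_cons R n).
Proof. by move=> mT A mA; exact: (@measurable_rV_cons R n). Qed.

Lemma ge0_integral_rV_cons n (f : 'rV[R]_n.+1 -> \bar R) :
  measurable_fun setT f -> (forall x, 0 <= f x)%E ->
  (\int[borel_rV n.+1]_x f x =
   \int[lebesgue_measure]_t \int[borel_rV n]_x f (rV_cons (t, x)))%E.
Proof.
move=> mf f0.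
rewrite -(@ge0_integral_measure_preserving _ _ _ _ R (lebesgue_measure \x borel_rV n)%E
  (borel_rV n.+1) _ (@measurable_lebesgue_rV_cons n))//.
rewrite fubini_tonelli1//.
by apply: (measurableT_comp mf); exact: measurable_lebesgue_rV_cons.
Qed.

Lemma rV_cons_affine n (a t : R) (x : 'rV[R]_n) (c : 'rV[R]_n.+1) :
  a *: rV_cons (t, x) + c =
  rV_cons (a * t + (rV_uncons c).1, a *: x + (rV_uncons c).2).
Proof.
apply/rowP => i; have [j ->|->] := unliftP ord0 i.
  by rewrite 2!mxE !rV_consS !mxE.
by rewrite 2!mxE !rV_cons0.
Qed.

(** Induction on the dimension: [rV_cons] splits off one real coordinate, for which the
    one-dimensional change of variables contributes one factor [|a|]. *)
Lemma ge0_integral_rV_affine n (a : R) (c : 'rV[R]_n) (f : 'rV[R]_n -> \bar R) :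
  a != 0 -> measurable_fun setT f -> (forall x, 0 <= f x)%E ->
  ((`|a| ^+ n)%:E * \int[borel_rV n]_x f (a *: x + c)%R = \int[borel_rV n]_x f x)%E.
Proof.
move=> a0; elim: n c f => [|n IH] c f mf f0.
  by rewrite mul1e; apply: eq_integral => x _; congr f; apply/rowP => -[].
have mfc : measurable_fun [set: measurableTypeR R * 'rV[R]_n] (fun p => f (rV_cons p)).
  by apply: (measurableT_comp mf); exact: measurable_lebesgue_rV_cons.
rewrite !ge0_integral_rV_cons//; last first.
  exact: (measurableT_comp mf (measurable_rV_affine a c)).
under eq_integral do under eq_integral do rewrite rV_cons_affine.
pose c' := rV_uncons c.
pose F t := (\int[borel_rV n]_x f (rV_cons (t, x)))%E.
have F0 t : (0 <= F t)%E by exact: integral_ge0.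
have mF : measurable_fun setT F.
  apply/measurable_fun_measurableTypeR.
  exact: (measurable_fun_fubini_tonelli_F _ mfc (fun=> f0 _)).
rewrite -[RHS](ge0_integral_lebesgue_affine c'.1 a0 mF)//.
rewrite exprSr EFinM [X in (X * _)%E]muleC -muleA; congr (_ * _)%E.
have mG t : measurable_fun setT (fun x => f (rV_cons (t, x))).
  exact: (measurableT_comp mfc (measurable_pair1 t)).
rewrite -ge0_integralZl//.
- by apply: eq_integral => t _; rewrite (IH c'.2 (fun x => f (rV_cons (_, x)))).
- apply: (@measurable_fun_fubini_tonelli_F _ _ (measurableTypeR R) _ _ (borel_rV n)
    (fun p => f (rV_cons (a * p.1 + c'.1, a *: p.2 + c'.2)))) => //.
  under eq_fun do rewrite -rV_cons_affine.
  apply: (measurableT_comp mf); apply: (measurableT_comp (measurable_rV_affine a c)).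
  exact: measurable_lebesgue_rV_cons.
- by move=> t _; exact: integral_ge0.
Qed.

Lemma ge0_integral_rV_reflect n (c : 'rV[R]_n) (f : 'rV[R]_n -> \bar R) :
  measurable_fun setT f -> (forall x, 0 <= f x)%E ->
  (\int[borel_rV n]_x f (c - x)%R = \int[borel_rV n]_x f x)%E.
Proof.
move=> mf f0; have N10 : -1 != 0 :> R by rewrite oppr_eq0 oner_eq0.
rewrite -[RHS](ge0_integral_rV_affine c N10)//.
rewrite normrN normr1 expr1n mul1e; apply: eq_integral => x _.
by rewrite scaleN1r addrC.
Qed.

Lemma ge0_integral_rV_translate n (c : 'rV[R]_n) (f : 'rV[R]_n -> \bar R) :
  measurable_fun setT f -> (forall x, 0 <= f x)%E ->
  (\int[borel_rV n]_x f (x - c)%R = \int[borel_rV n]_x f x)%E.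
Proof.
move=> mf f0; rewrite -[RHS](ge0_integral_rV_affine (- c) (oner_neq0 R))//.
rewrite normr1 expr1n mul1e; apply: eq_integral => x _.
by rewrite scale1r.
Qed.

End affine_invariance.

(** * Dyadic cubes, Euclidean balls and their volumes *)

Section cube.
Context {R : realType}.

(** The sides are half-open so that halving them partitions the cube exactly, with no overlaps to
    discard. *)
Definition cube n (q : 'rV[R]_n) (l : R) : set 'rV[R]_n :=
  [set x | forall i, q ord0 i <= x ord0 i < q ord0 i + l].

Lemma measurable_cube n (q : 'rV[R]_n) l : measurable (cube q l).
Proof.
rewrite (_ : cube q l = \bigcap_(i : 'I_n)
    ((fun y : 'rV[R]_n => y ord0 i) @^-1` `[q ord0 i, q ord0 i + l[)).
  apply: fin_bigcap_measurable => // i _.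
  by rewrite -[X in measurable X]setTI; apply: measurable_coord => //; exact: measurable_itv.
apply/seteqP; split => x /= xq i; first by move=> _; rewrite /= in_itv/=; exact: xq.
by have := xq i I; rewrite /= in_itv.
Qed.

Lemma borel_rV_cube n (q : 'rV[R]_n) l : 0 <= l ->
  borel_rV n (cube q l) = (l ^+ n)%:E.
Proof.
move=> l0; elim: n q => [|n IH] q.
  rewrite expr0/= diracE mem_set// => i; by case: i.
have -> : borel_rV n.+1 (cube q l) = (lebesgue_measure \x borel_rV n)%E
    (`[q ord0 ord0, q ord0 ord0 + l[%classic `*` cube (rV_uncons q).2 l).
  rewrite /= /cons_measure /pushforward; congr (_ _).
  apply/seteqP; split => [[t x] /= tx|[t x] [/= tq xq] i].
    split => [|i] /=; first by have := tx ord0; rewrite rV_cons0 in_itv.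
    by have := tx (lift ord0 i); rewrite rV_consS mxE.
  have [j ->|->] := unliftP ord0 i; last by move: tq; rewrite rV_cons0 in_itv.
  by have := xq j; rewrite rV_consS mxE.
rewrite exprS EFinM.
have <- : lebesgue_measure (`[q ord0 ord0, q ord0 ord0 + l[%classic : set R) = l%:E.
  rewrite lebesgue_measure_itv/= lte_fin ltrDl.
  case: ifPn; first by rewrite -EFinB addrAC subrr add0r.
  by rewrite -leNgt => ?; congr EFin; apply/eqP; rewrite eq_le l0.
by rewrite -(IH (rV_uncons q).2) product_measure1E//; exact: measurable_cube.
Qed.

(** The lower corner of a dyadic child: [e i] selects the lower or upper half of the side in
    direction [i]. *)
Definition subcube n (q : 'rV[R]_n) (l : R) (e : {ffun 'I_n -> bool}) : 'rV[R]_n :=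
  \row_i (q ord0 i + (l / 2) * (e i)%:R).

Lemma cube_subcubes n (q : 'rV[R]_n) l :
  cube q l = \big[setU/set0]_(e : {ffun 'I_n -> bool}) cube (subcube q l e) (l / 2).
Proof.
rewrite -bigcup_seq; apply/seteqP; split => x /=.
  move=> xq; exists [ffun i => q ord0 i + l / 2 <= x ord0 i]; first by rewrite /= mem_index_enum.
  move=> i; rewrite mxE ffunE; have := xq i => /andP[h1 h2].
  by case: (leP (q ord0 i + l / 2) (x ord0 i)) => h3; rewrite /= ?mulr1n ?mulr0n ?mulr1 ?mulr0; apply/andP; split; lra.
move=> [e _ xe] i; have := xe i; rewrite mxE => /andP[h1 h2].
have : 0 <= l / 2 * (e i)%:R /\ l / 2 * (e i)%:R <= l / 2.
  have : 0 < l / 2 by lra.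
  by case: (e i); rewrite /= ?mulr1n ?mulr0n ?mulr1 ?mulr0; split; lra.
by move=> [? ?]; apply/andP; split; lra.
Qed.

Lemma trivIset_subcubes n (q : 'rV[R]_n) l (D : set {ffun 'I_n -> bool}) :
  trivIset D (fun e => cube (subcube q l e) (l / 2)).
Proof.
move=> e e' _ _ [x [/= xe xe']]; apply/ffunP => i.
have := xe i; have := xe' i; rewrite !mxE.
case: (e i); case: (e' i) => //; rewrite /= ?mulr1n ?mulr0n ?mulr1 ?mulr0 => /andP[? ?] /andP[? ?]; lra.
Qed.

Lemma integral_subcubes n (q : 'rV[R]_n) l (f : 'rV[R]_n -> R) :
  measurable_fun setT f ->
  (\int[borel_rV n]_(x in cube q l) (f x)%:E =
   \sum_(e : {ffun 'I_n -> bool}) \int[borel_rV n]_(x in cube (subcube q l e) (l / 2)) (f x)%:E)%E.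
Proof.
move=> mf; rewrite {1}cube_subcubes integral_bigsetU_EFin//.
- by move=> e; exact: measurable_cube.
- exact: index_enum_uniq.
- exact: trivIset_subcubes.
- by apply/measurable_EFinP; exact: measurable_funTS.
Qed.

End cube.

Section eball.
Context {R : realType} {n : nat}.
Implicit Types x c : 'rV[R]_n.

Lemma measurable_enorm : measurable_fun setT (@enorm R n).
Proof.
apply: (measurableT_comp (f := @Num.sqrt R)).
  exact: (continuous_measurable_fun (@sqrt_continuous R)).
apply: measurable_sum => i; apply: measurable_funX; exact: measurable_coord.
Qed.

Lemma measurable_eball c r : measurable (eball c r).
Proof.
rewrite (_ : eball c r = (fun x => enorm (1 *: x + (- c))) @^-1` `]-oo, r[).
  rewrite -[X in measurable X]setTI.
  apply: (measurableT_comp measurable_enorm (measurable_rV_affine 1 (- c))) => //.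
by apply/seteqP; split => x; rewrite /eball /= in_itv/= scale1r.
Qed.

Lemma ler_coord_enorm x i : `|x ord0 i| <= enorm x.
Proof.
rewrite -[X in X <= _]sqrtr_sqr /enorm ler_sqrt.
  by rewrite (bigD1 i)//= lerDl sumr_ge0// => j _; exact: sqr_ge0.
by apply: sumr_ge0 => j _; exact: sqr_ge0.
Qed.

(** The factor [n.+1] is a crude substitute for the square root of [n]; it makes the inequality
    strict and stays positive in every dimension, zero included. *)
Lemma enorm_lt x l : 0 < l -> (forall i, `|x ord0 i| <= l) -> enorm x < n.+1%:R * l.
Proof.
move=> l0 xl.
have nl : 0 < n.+1%:R * l by rewrite mulr_gt0.
rewrite -[ltRHS]gtr0_norm// -sqrtr_sqr ltr_sqrt ?exprn_gt0//.
apply: (@le_lt_trans _ _ (n%:R * l ^+ 2)).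
  rewrite -[n in n%:R]card_ord -sum1_card natr_sum mulr_suml ler_sum// => i _.
  rewrite mul1r -real_normK ?num_real//; apply: lerXn2r => //; rewrite ?nnegrE//.
  exact: ltW.
rewrite exprMn ltr_pM2r ?exprn_gt0// expr2 -natrM ltr_nat.
by rewrite (leq_trans (ltnSn n))// leq_pmulr.
Qed.

Lemma cube_eball (q : 'rV[R]_n) l : 0 < l -> cube q l `<=` eball q (n.+1%:R * l).
Proof.
move=> l0 x xq; apply: enorm_lt => // i; rewrite !mxE.
by have /andP[? ?] := xq i; rewrite ger0_norm; lra.
Qed.

Lemma eball_cube c r : eball c r `<=` cube (\row_i (c ord0 i - r)) (2 * r).
Proof.
move=> x cx i; have := le_lt_trans (ler_coord_enorm (x - c) i) cx.
by rewrite !mxE ltr_norml => /andP[? ?]; apply/andP; split; lra.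
Qed.

Lemma eball_lty c r : (borel_rV n (eball c r) < +oo)%E.
Proof.
have [r0|r0] := ltP r 0.
  rewrite (_ : eball c r = set0) ?measure0//; apply/seteqP; split => // x.
  by rewrite /eball /= ltNge (le_trans (ltW r0))// sqrtr_ge0.
apply: (@le_lt_trans _ _ (borel_rV n (cube (\row_i (c ord0 i - r)) (2 * r)))).
  by apply: le_measure; rewrite ?inE;
    [exact: measurable_eball|exact: measurable_cube|exact: eball_cube].
by rewrite borel_rV_cube ?ltry// mulr_ge0.
Qed.

Lemma eball_gt0 c r : 0 < r -> (0 < borel_rV n (eball c r))%E.
Proof.
move=> r0; have l0 : 0 < r / n.+1%:R by rewrite divr_gt0.
apply: (@lt_le_trans _ _ (borel_rV n (cube c (r / n.+1%:R)))).
  by rewrite borel_rV_cube ?lte_fin ?exprn_gt0// ltW.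
apply: le_measure; rewrite ?inE; [exact: measurable_cube|exact: measurable_eball|].
by apply: subset_trans (cube_eball l0) _; rewrite mulrC divfK.
Qed.

End eball.

(** * Density of continuous functions in L^1 *)

Section L1_approximation.
Context d (T : measurableType d) (R : realType).
Variables (mu : {measure set T -> \bar R}) (D : set T) (C : set (T -> R)).
Hypotheses (mD : measurable D) (Doo : (mu D < +oo)%E).
Hypothesis mC : forall g, C g -> measurable_fun setT g.
Hypothesis C_cst : forall a, C (cst a).
Hypothesis C_lin : forall a f g, C f -> C g -> C (fun x => a * f x + g x).
Hypothesis C_max : forall f g, C f -> C g -> C (fun x => Num.max (f x) (g x)).

(** [C] is a vector lattice containing the constants. Keeping it abstract yields density of the
    continuous functions both on ['rV[R]_n] and on space-time, from closure properties instead of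
    regularity of the measures. *)
Definition L1_approximable (f : T -> R) := measurable_fun setT f /\
  forall e, 0 < e -> exists2 g, C g & (\int[mu]_(x in D) `|f x - g x|%:E <= e%:E)%E.

Let mdist (f g : T -> R) : measurable_fun setT f -> measurable_fun setT g ->
  measurable_fun D (fun x => `|f x - g x|%:E).
Proof.
move=> mf mg; apply/measurable_EFinP; apply: measurable_funTS.
by apply: measurableT_comp => //; exact: measurable_funB.
Qed.

Lemma L1_approximable_sub f : C f -> L1_approximable f.
Proof.
move=> Cf; split=> [|e e0]; first exact: mC.
exists f => //; under eq_integral do rewrite subrr normr0.
by rewrite integral0 lee_fin ltW.
Qed.

(** A Lipschitz operation transports L^1 approximations of its arguments. The two instances are
    linear combinations and the maximum. *)
Let L1_approximable2 (op : R -> R -> R) (k : R) f g : 0 <= k ->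
  (forall f g, C f -> C g -> C (fun x => op (f x) (g x))) ->
  (forall f g, measurable_fun setT f -> measurable_fun setT g ->
     measurable_fun [set: T] (fun x => op (f x) (g x))) ->
  (forall a b a' b', `|op a b - op a' b'| <= k * `|a - a'| + `|b - b'|) ->
  L1_approximable f -> L1_approximable g ->
  L1_approximable (fun x => op (f x) (g x)).
Proof.
move=> k0 Cop mop opL [mf af] [mg ag]; split=> [|e e0]; first exact: mop.
have k1 : 0 < k + 1 by lra.
(* The denominator is [k + 1] because [k] may be zero. *)
have [f' Cf' ff'] := af (e / 2 / (k + 1)) ltac:(by rewrite !divr_gt0).
have [g' Cg' gg'] := ag (e / 2) ltac:(by rewrite divr_gt0).
exists (fun x => op (f' x) (g' x)); first exact: Cop.
apply: (@le_trans _ _ (\int[mu]_(x in D) (k%:E * `|f x - f' x|%:E + `|g x - g' x|%:E)))%E.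
  apply: ge0_le_integral => //.
  - by apply: mdist; [exact: mop|apply: mC; exact: Cop].
  - apply: emeasurable_funD; last by apply: mdist => //; exact: mC.
    by apply: measurable_funeM; apply: mdist => //; exact: mC.
  - by move=> x Dx; rewrite -EFinM -EFinD lee_fin.
rewrite ge0_integralD//; first last.
- by apply: mdist => //; exact: mC.
- by apply: measurable_funeM; apply: mdist => //; exact: mC.
- by move=> x _; rewrite -EFinM lee_fin mulr_ge0.
rewrite ge0_integralZl//; last by apply: mdist => //; exact: mC.
apply: (@le_trans _ _ (k%:E * (e / 2 / (k + 1))%:E + (e / 2)%:E)%E).
  by apply: leeD => //; apply: lee_wpmul2l.
rewrite -EFinM -EFinD lee_fin mulrCA [leRHS](splitr e) lerD2r.
by rewrite ler_piMr ?divr_ge0 ?ltW// ltr_pdivrMr// mul1r; lra.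
Qed.

Lemma L1_approximable_lin a f g : L1_approximable f -> L1_approximable g ->
  L1_approximable (fun x => a * f x + g x).
Proof.
apply: (L1_approximable2 (op := fun u v => a * u + v) (k := `|a|)) => //.
- by move=> f' g'; exact: C_lin.
- move=> f' g' mf' mg'; apply: measurable_funD => //; exact: measurable_funM.
- move=> u v u' v'; rewrite opprD addrACA -mulrBr.
  by rewrite (le_trans (ler_normD _ _))// normrM.
Qed.

Lemma L1_approximable_max f g : L1_approximable f -> L1_approximable g ->
  L1_approximable (fun x => Num.max (f x) (g x)).
Proof.
apply: (L1_approximable2 (op := fun u v => Num.max u v) (k := 1)) => //.
- by move=> f' g'; exact: measurable_maxr.
- move=> u v u' v'; rewrite mul1r.
  have := ler_norm (u - u'); have := ler_norm (v - v').
  have := ler_norm (u' - u); have := ler_norm (v' - v).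
  rewrite (distrC u') (distrC v') => ? ? ? ?.
  have := normr_ge0 (u - u'); have := normr_ge0 (v - v') => ? ?.
  by rewrite ler_norml /Num.max; apply/andP; case: ltP => ?; case: ltP => ?; split; lra.
Qed.

Lemma L1_approximable_limit (f_ : nat -> T -> R) (f : T -> R) :
  measurable_fun setT f -> (forall k, L1_approximable (f_ k)) ->
  (\int[mu]_(x in D) `|f x - f_ k x|%:E)%E @[k --> \oo] --> 0%E ->
  L1_approximable f.
Proof.
move=> mf af cvgf; split=> // e e0.
have e20 : 0 < e / 2 by rewrite divr_gt0.
have [k fk] : exists k, (\int[mu]_(x in D) `|f x - f_ k x|%:E < (e / 2)%:E)%E.
  have [k _ /(_ _ (leqnn k)) fk] : \forall k \near \oo,
    (\int[mu]_(x in D) `|f x - f_ k x|%:E < (e / 2)%:E)%E.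
    exact: cvge0_lt.
  by exists k.
have [mfk /(_ _ e20)[g Cg fg]] := af k; exists g => //.
apply: (@le_trans _ _ (\int[mu]_(x in D) (`|f x - f_ k x|%:E + `|f_ k x - g x|%:E))%E).
  apply: ge0_le_integral => //; first by apply: mdist => //; exact: mC.
    by apply: emeasurable_funD; apply: mdist => //; exact: mC.
  by move=> x Dx; rewrite -EFinD lee_fin ler_distD.
rewrite ge0_integralD//; [|exact: mdist|by apply: mdist => //; exact: mC].
by rewrite [in leRHS](splitr e) EFinD leeD// ltW.
Qed.

(** Dominated convergence: the constant [M] is integrable on [D], which has finite measure. *)
Lemma L1_approximable_bounded_limit (f_ : nat -> T -> R) (f : T -> R) (M : R) :
  (forall k, L1_approximable (f_ k)) ->
  (forall k x, `|f_ k x| <= M) ->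
  (forall x, f_ k x @[k --> \oo] --> f x) ->
  L1_approximable f.
Proof.
move=> af fM cvgf.
have mf_ k : measurable_fun setT (f_ k) by case: (af k).
have mf : measurable_fun setT f.
  by apply: (@measurable_fun_cvg _ _ _ setT f_ f) => // x _; exact: cvgf.
apply: (L1_approximable_limit mf af).
have [_ + _] : [/\ mu.-integrable D (EFin \o f),
    [sequence \int[mu]_(x in D) `|(f_ k x)%:E - (f x)%:E|]_k @ \oo --> 0 &
    [sequence \int[mu]_(x in D) (f_ k x)%:E]_k @ \oo --> \int[mu]_(x in D) (f x)%:E]%E.
  apply: (@dominated_convergence _ T R mu D mD (fun k x => (f_ k x)%:E) (EFin \o f) (cst M%:E)).
  - by move=> k; apply/measurable_EFinP; exact: measurable_funTS.
  - by apply/measurable_EFinP; exact: measurable_funTS.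
  - by apply: aeW => x Dx; apply: cvg_comp (cvgf x) _ => //=.
  - apply: (@measurable_bounded_integrable _ _ _ _ (cst M)) => //.
    by exists `|M|; split => // N MN x _; rewrite /= ltW.
  - by apply: aeW => x k Dx; rewrite lee_fin.
rewrite (_ : [sequence _]_k = (fun k => \int[mu]_(x in D) `|f x - f_ k x|%:E)%E)//.
by apply/funext => k; apply: eq_integral => x _; rewrite -EFinB abse_EFin distrC.
Qed.


Definition approximable_set (A : set T) := L1_approximable (\1_A : T -> R).

(** Complements come from [1 - \1_A], finite unions from the maximum, countable unions from a
    bounded pointwise limit. Stability under the maximum gives a sigma-algebra directly and spares a
    monotone class argument. *)
Lemma sigma_algebra_approximable_set : sigma_algebra setT approximable_set.
Proof.
split.
- rewrite /approximable_set indic0; exact: L1_approximable_sub.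
- move=> A aA; rewrite /approximable_set.
  rewrite (_ : \1_(setT `\` A) = (fun x => -1 * \1_A x + cst 1 x)); last first.
    apply/funext => x; rewrite setTD indicC /= indicE.
    by case: (x \in A); rewrite /= ?mulr1 ?mulr0 ?addNr ?add0r.
  apply: (@L1_approximable_lin (-1) (\1_A) (cst 1)) => //.
  exact: L1_approximable_sub.
- move=> F aF.
  have aU k : approximable_set (\big[setU/set0]_(i < k) F i).
    elim: k => [|k IH].
      rewrite big_ord0 /approximable_set indic0; exact: L1_approximable_sub.
    rewrite big_ord_recr/= /approximable_set.
    rewrite (_ : \1_(_ `|` _) = (fun x => Num.max (\1_(\big[setU/set0]_(i < k) F i) x) (\1_(F k) x))).
      by apply: L1_approximable_max; [exact: IH|exact: aF].
    apply/funext => x; rewrite !indicE in_setU.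
    by case: (x \in _); case: (x \in _); rewrite /= /Num.max ?ltxx ?ltr01 // ltNge ler01.
  apply: (L1_approximable_bounded_limit (M := 1) aU).
    by move=> k x; rewrite indicE; case: (x \in _); rewrite ?normr1 ?normr0.
  move=> x; have [[i _ Fix]|nFx] := pselect ((\bigcup_i F i) x).
    apply: cvg_near_cst; exists i.+1 => // k /= ik.
    rewrite !indicE !mem_set//; first by exists i.
    by rewrite -bigcup_mkord; exists i.
  apply: cvg_near_cst; apply: nearW => k.
  rewrite !indicE !memNset// => kF; apply: nFx.
  by move: kF; rewrite -bigcup_mkord => -[i _ ?]; exists i.
Qed.

Let superlevel_approximable g a : C g -> approximable_set [set x | a < g x].
Proof.
move=> Cg.
have Cmin f h : C f -> C h -> C (fun x => Num.min (f x) (h x)).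
  move=> Cf Ch; have Cneg u : C u -> C (fun x => - u x).
    move=> Cu; rewrite (_ : (fun _ => _) = (fun x => -1 * u x + cst 0 x)); first exact: C_lin.
    by apply/funext => x; rewrite mulN1r addr0.
  rewrite (_ : (fun _ => _) = (fun x => - Num.max (- f x) (- h x))).
    by apply: (Cneg (fun x => Num.max (- f x) (- h x))); apply: C_max; exact: Cneg.
  by apply/funext => x; rewrite oppr_max !opprK.
(* Clipped multiples of [g - a], which converge to the indicator of [a < g]: they vanish where
   [g x <= a], and elsewhere equal 1 once [k] is at least [1/(g x - a)]. *)
pose h k x := Num.min 1 (Num.max 0 (k%:R * (g x - a))).
have Ch k : C (h k).
  apply: (Cmin (cst 1)) => //; apply: (C_max (f := cst 0)) => //.
  rewrite (_ : (fun _ => _) = (fun x => k%:R * g x + cst (- (k%:R * a)) x)); first exact: C_lin.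
  by apply/funext => x; rewrite mulrBr.
apply: (@L1_approximable_bounded_limit h _ 1).
- by move=> k; exact: L1_approximable_sub.
- move=> k x; rewrite ger0_norm /h; first by rewrite ge_min lexx.
  by rewrite le_min ler01 le_max lexx.
- move=> x; have [ag|ga] := ltP a (g x); last first.
    rewrite indicE memNset/=; last by rewrite ltNge ga.
    apply: cvg_near_cst; apply: nearW => k; rewrite /h max_l ?min_r//.
    by rewrite mulr_ge0_le0// subr_le0.
  rewrite indicE mem_set//=; apply: cvg_near_cst.
  have ga0 : 0 < g x - a by rewrite subr_gt0.
  have [m gm] : exists m : nat, (g x - a)^-1 <= m%:R.
    by exists (Num.bound (g x - a)^-1); rewrite ltW// archi_boundP// invr_ge0 ltW.
  exists m => // k /= mk; rewrite /h min_l// le_max; apply/orP; right.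
  rewrite -ler_pdivrMr// mul1r (le_trans gm)// ler_nat//.
Qed.

Lemma preimage_approximable_set g (Y : set R) : C g -> measurable Y ->
  approximable_set (g @^-1` Y).
Proof.
move=> Cg mY; have [a0 aC aU] := sigma_algebra_approximable_set.
have {mY} : (@RGenOInfty.G R).-sigma.-measurable Y by rewrite -RGenOInfty.measurableE.
suff : <<s @RGenOInfty.G R >> `<=` [set Y | approximable_set (g @^-1` Y)] by apply.
apply: smallest_sub; first split => /=.
- by rewrite preimage_set0.
- by move=> B aB; rewrite setTD preimage_setC -setTD; exact: aC.
- by move=> F aF; rewrite preimage_bigcup; exact: aU.
- by move=> _ [a ->] /=; rewrite preimage_itvoy; exact: superlevel_approximable.
Qed.

Hypothesis all_approximable : forall A, measurable A -> approximable_set A.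

Import HBSimple.

Lemma integrable_L1_approximable (f : T -> R) : measurable_fun setT f ->
  mu.-integrable D (EFin \o f) -> L1_approximable f.
Proof.
move=> mf /(approximation_sfun_integrable mD)[g_ [_ _ g_f]].
apply: (L1_approximable_limit mf _ g_f) => k.
rewrite (_ : (g_ k : T -> R) = (fun x => \sum_(y \in range (g_ k)) (y * \1_(g_ k @^-1` [set y]) x))); last first.
  by apply/funext => x; rewrite fimfunE.
have fin : finite_set (range (g_ k)) by [].
have sums (s : seq R) :
    L1_approximable (fun x => \sum_(y <- s) (y * \1_(g_ k @^-1` [set y]) x)).
  elim: s => [|y s IH].
    by under eq_fun do rewrite big_nil; apply: (L1_approximable_sub (f := cst 0)).
  under eq_fun do rewrite big_cons.
  by apply: L1_approximable_lin => //; exact: all_approximable.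
by under eq_fun do rewrite fsbig_finite//=; exact: sums.
Qed.

End L1_approximation.

Section continuous_dense.
Context {R : realType} {n : nat}.
Local Notation V := 'rV[R]_n.
Local Notation TV := (measurableTypeR R * V)%type.

Let Cspace : set (V -> R) := [set g | continuous g].
Let Ctime : set (R * V -> R) := [set g | continuous g].

Let clin (S : topologicalType) (a : R) (f g : S -> R) :
  continuous f -> continuous g -> continuous (fun x => a * f x + g x).
Proof.
by move=> cf cg x; apply: cvgD; [apply: cvgM; [exact: cvg_cst|exact: cf]|exact: cg].
Qed.

Let cmax (S : topologicalType) (f g : S -> R) :
  continuous f -> continuous g -> continuous (fun x => Num.max (f x) (g x)).
Proof. by move=> cf cg x; apply: continuous_max; [exact: cf|exact: cg]. Qed.

Lemma continuous_dense_L1_rV (D : set V) (f : V -> R) (e : R) :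
  measurable D -> (borel_rV n D < +oo)%E -> measurable_fun setT f ->
  (borel_rV n).-integrable D (EFin \o f) -> 0 < e ->
  exists2 g : V -> R, continuous g &
    (\int[borel_rV n]_(x in D) `|f x - g x|%:E <= e%:E)%E.
Proof.
move=> mD Doo mf intf e0.
have mC (g : V -> R) : Cspace g -> measurable_fun setT g by exact: continuous_measurable_rV.
have C_cst a : Cspace (cst a) by exact: cst_continuous.
suff aA A : measurable A -> approximable_set (borel_rV n) D Cspace A.
  by case: (integrable_L1_approximable mD mC C_cst (@clin V) aA mf intf) => _; apply.
move: A; suff : g_sigma_preimage (fun (i : 'I_n) (x : V) => x ord0 i) `<=`
  approximable_set (borel_rV n) D Cspace by apply.
apply: smallest_sub.
  exact: (sigma_algebra_approximable_set mD Doo mC C_cst (@clin V) (@cmax V)).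
rewrite -bigcup_seq/= => B [i _ [Y mY <-]] /=.
rewrite setTI; apply: (@preimage_approximable_set _ _ R (borel_rV n) D Cspace mD Doo mC
  C_cst (@clin V) (@cmax V) (fun x : V => x ord0 i)) => //.
exact: coord_continuous.
Qed.

(** The product sigma-algebra is generated by preimages under the two projections, and that of
    ['rV[R]_n] by those under the coordinates; all these maps are continuous, so the generators are
    approximable. *)
Lemma continuous_dense_L1_time_rV (m : {measure set TV -> \bar R})
    (D : set TV) (f : R * V -> R) (e : R) :
  measurable D -> (m D < +oo)%E -> measurable_fun [set: TV] f ->
  m.-integrable D (EFin \o f) -> 0 < e ->
  exists2 g : R * V -> R, continuous g &
    (\int[m]_(x in D) `|f x - g x|%:E <= e%:E)%E.
Proof.
move=> mD Doo mf intf e0.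
have mC (g : TV -> R) : Ctime g -> measurable_fun [set: TV] g.
  by move=> cg mT Y mY; exact: (continuous_measurable_time_rV cg).
have C_cst a : Ctime (cst a) by exact: cst_continuous.
have sA := @sigma_algebra_approximable_set _ TV R m D Ctime mD Doo mC C_cst
  (@clin (R * V)%type) (@cmax (R * V)%type).
have pA g Y := @preimage_approximable_set _ TV R m D Ctime mD Doo mC C_cst
  (@clin (R * V)%type) (@cmax (R * V)%type) g Y.
suff aA A : measurable A -> approximable_set m D Ctime A.
  by case: (integrable_L1_approximable mD mC C_cst (@clin (R * V)%type) aA mf intf) => _; apply.
move: A; apply: smallest_sub => // _ [[Y mY <-]|[Y mY <-]]; rewrite setTI.
  by apply: pA => // x; exact: cvg_fst.
have [a0 aC aU] := sA.
suff : g_sigma_preimage (fun (i : 'I_n) (x : V) => x ord0 i) `<=`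
  [set Y | approximable_set m D Ctime (snd @^-1` Y)] by apply.
apply: smallest_sub; first split => /=.
- by rewrite preimage_set0.
- by move=> B aB; rewrite setTD preimage_setC -setTD; exact: aC.
- by move=> F aF; rewrite preimage_bigcup; exact: aU.
rewrite -bigcup_seq/= => B [i _ [Z mZ <-]] /=.
rewrite setTI -comp_preimage; apply: pA => // x.
by apply: (@continuous_comp _ _ _ snd (fun y : V => y ord0 i)); [exact: cvg_snd|exact: coord_continuous].
Qed.

End continuous_dense.

(** * The John-Nirenberg inequality on cubes *)

(** Heine's theorem in a one-sided form: only [x] has to lie in [K], so that [y] may be a translate
    that leaves the compact set. *)
Lemma continuous_compact_uniform (R : realType) (T : pseudoMetricType R) (f : T -> R)
    (K : set T) (e : R) : continuous f -> compact K -> 0 < e ->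
  exists2 d, 0 < d & forall x y, K x -> ball x d y -> `|f x - f y| <= e.
Proof.
move=> cf /compact_near_coveringP cK e0.
pose P (d : R) x := forall y, ball x d y -> `|f x - f y| <= e.
have : \forall d \near 0^'+, K `<=` P d.
  apply: cK => x Kx.
  have /nbhs_ballP[d /= d0 dP] : \forall y \near x, `|f x - f y| < e / 2.
    by have /cvgrPdist_lt := cf x; apply; rewrite divr_gt0.
  have d20 : 0 < d / 2 by rewrite divr_gt0.
  exists (ball x (d / 2), [set d' : R | d' < d / 2]).
    split => /=; first exact: nbhsx_ballx.
    exact: nbhs_right_lt.
  move=> [x' d'] /= [xx' dd'] y x'y.
  have /dP xx'e : ball x d x' by apply: le_ball xx'; lra.
  have /dP xye : ball x d y.
    rewrite (splitr d); apply: ball_triangle xx' _.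
    by apply: le_ball x'y; exact: ltW.
  rewrite (le_trans (ler_distD (f x) _ _))// (splitr e) lerD// ltW//.
  by rewrite distrC.
move=> [r /= r0 rP]; exists (r / 2); first by rewrite divr_gt0.
move=> x y Kx; apply: rP => //=; last by rewrite divr_gt0.
by rewrite sub0r normrN gtr0_norm; lra.
Qed.

Section cube_averages.
Context {R : realType} {n : nat}.
Local Notation V := 'rV[R]_n.
Implicit Types (q : V) (l : R).

Definition cube_avg (g : V -> R) (q : V) (l : R) : R :=
  (l ^+ n)^-1 * \int[borel_rV n]_(x in cube q l) g x.

Lemma half_cube_volume (l : R) : l ^+ n = 2 ^+ n * (l / 2) ^+ n.
Proof. by rewrite -exprMn mulrCA divff ?mulr1. Qed.

Lemma card_subcubes : #|{ffun 'I_n -> bool}|%:R = 2 ^+ n :> R.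
Proof. by rewrite card_ffun card_bool card_ord natrX. Qed.

Lemma subcube_sub (q : V) l e : cube (subcube q l e) (l / 2) `<=` cube q l.
Proof.
move=> x xe; rewrite cube_subcubes -bigcup_seq; exists e => //=.
exact: mem_index_enum.
Qed.

Definition sub_avg (F : {ffun 'I_n -> bool} -> R) : R := (2 ^+ n)^-1 * \sum_e F e.

Lemma sub_avg_cst (a : R) : sub_avg (fun=> a) = a.
Proof.
rewrite /sub_avg sumr_const -[a *+ _]mulr_natr mulrCA card_subcubes.
by rewrite mulVf ?mulr1// expf_neq0.
Qed.

Lemma ler_sub_avg F G : (forall e, F e <= G e) -> sub_avg F <= sub_avg G.
Proof.
by move=> FG; rewrite ler_wpM2l ?invr_ge0 ?exprn_ge0//; exact: ler_sum.
Qed.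

Lemma sub_avg_lin a b F : sub_avg (fun e => a + b * F e) = a + b * sub_avg F.
Proof.
rewrite -[in RHS](sub_avg_cst a) /sub_avg big_split/= mulrDr; congr (_ + _).
by rewrite -mulr_sumr mulrCA.
Qed.

Lemma ler_norm_sub_avg F : `|sub_avg F| <= sub_avg (fun e => `|F e|).
Proof.
rewrite normrM ger0_norm ?invr_ge0 ?exprn_ge0//.
by rewrite ler_wpM2l ?invr_ge0 ?exprn_ge0// ler_norm_sum.
Qed.

Variable g : V -> R.
Hypothesis mg : measurable_fun setT g.
Hypothesis ig : forall (q : V) (l : R), 0 < l -> (borel_rV n).-integrable (cube q l) (EFin \o g).

Lemma cube_avg_subcubes q l : 0 < l ->
  cube_avg g q l = sub_avg (fun e => cube_avg g (subcube q l e) (l / 2)).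
Proof.
move=> l0; have l20 : 0 < l / 2 by rewrite divr_gt0.
rewrite /cube_avg /sub_avg /Rintegral integral_subcubes//.
rewrite -sum_fine; last first.
  by move=> e _; apply: integrable_fin_num; [exact: measurable_cube|exact: ig].
by rewrite -mulr_sumr mulrA -invfM -half_cube_volume.
Qed.

Lemma measurable_dist_cst a (D : set V) : measurable_fun D (fun x => `|g x - a|%:E).
Proof.
apply/measurable_EFinP; apply: measurable_funTS.
by apply: measurableT_comp => //; exact: measurable_funB.
Qed.

Lemma le_cube_avg_dist q l a : 0 < l ->
  ((l ^+ n * `|cube_avg g q l - a|)%:E <=
   \int[borel_rV n]_(x in cube q l) `|g x - a|%:E)%E.
Proof.
move=> l0; have mQ := measurable_cube q l; have iQ := ig q l0.
have vQ : borel_rV n (cube q l) = (l ^+ n)%:E by rewrite borel_rV_cube// ltW.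
have ia : (borel_rV n).-integrable (cube q l) (EFin \o cst a).
  apply: (@measurable_bounded_integrable _ _ _ _ (cst a)) => //.
    by apply: (@le_lt_trans _ _ (l ^+ n)%:E); rewrite ?ltry// -vQ.
  by exists `|a|; split => // N aN x _; rewrite /= ltW.
have -> : l ^+ n * `|cube_avg g q l - a| = `|\int[borel_rV n]_(x in cube q l) (g x - a)|.
  rewrite RintegralB// Rintegral_cst// [X in a * X](_ : _ = l ^+ n); last first.
    by rewrite -[RHS]/(fine (l ^+ n)%:E) -vQ.
  rewrite /cube_avg.
  rewrite -[X in X * _](gtr0_norm (exprn_gt0 n l0)) -normrM mulrBr mulrA.
  by rewrite divff ?mul1r ?gt_eqF ?exprn_gt0// [a * _]mulrC.
have iB : (borel_rV n).-integrable (cube q l) (EFin \o (fun x => g x - a)).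
  by have := integrableB mQ iQ ia; apply: eq_integrable.
rewrite EFin_normr_Rintegral//; apply: (le_trans (le_abse_integral _ _ _)) => //.
exact: measurable_int iB.
Qed.

(** [|g - avg|] splits through [a], and the distance from the average to [a] is at most the mean of
    [|g - a|]. An oscillation bound around any constant thus gives one around the average. *)
Lemma cube_avg_best q l a : 0 < l ->
  (\int[borel_rV n]_(x in cube q l) `|g x - cube_avg g q l|%:E <=
   2%:E * \int[borel_rV n]_(x in cube q l) `|g x - a|%:E)%E.
Proof.
move=> l0; have mQ := measurable_cube q l.
apply: (@le_trans _ _ (\int[borel_rV n]_(x in cube q l)
    (`|g x - a|%:E + (cst `|cube_avg g q l - a|%:E) x)))%E.
  apply: ge0_le_integral => //; first exact: measurable_dist_cst.
    by apply: emeasurable_funD => //; exact: measurable_dist_cst.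
  move=> x _ /=; rewrite -EFinD lee_fin.
  by rewrite (le_trans (ler_distD a _ _))// lerD2l distrC.
rewrite ge0_integralD//; first last.
- by move=> x _; rewrite /= lee_fin.
- exact: measurable_dist_cst.
rewrite integral_cst// [X in (_ + _ * X)%E](_ : _ = (l ^+ n)%:E); last first.
  by rewrite -(borel_rV_cube q (ltW l0)).
rewrite -EFinM.
by rewrite mule_natl mule2n leeD2l// mulrC le_cube_avg_dist.
Qed.

(** The mean over [cube q l] of [h] composed with the conditional expectation of [g] on the dyadic
    subcubes of depth [j]. *)
Fixpoint tree_avg (j : nat) (h : R -> R) (q : V) (l : R) : R :=
  if j is i.+1 then sub_avg (fun e => tree_avg i h (subcube q l e) (l / 2))
  else h (cube_avg g q l).

Lemma ler_tree_avg j h k q l : (forall u, h u <= k u) ->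
  tree_avg j h q l <= tree_avg j k q l.
Proof.
move=> hk; elim: j q l => [|j IH] q l /=; first exact: hk.
by apply: ler_sub_avg => e; exact: IH.
Qed.

Lemma tree_avgZ j b h q l : tree_avg j (fun u => b * h u) q l = b * tree_avg j h q l.
Proof.
elim: j q l => [//|j IH] q l /=.
rewrite -[RHS]add0r -sub_avg_lin; congr sub_avg; apply/funext => e.
by rewrite IH add0r.
Qed.

(** Jensen's inequality: the averages at depth [j] have [cube_avg g q l] as their mean, and the
    absolute value is convex. *)
Lemma dist_cube_avg_le_tree_avg j a q l : 0 < l ->
  `|cube_avg g q l - a| <= tree_avg j (fun u => `|u - a|) q l.
Proof.
elim: j q l => [//|j IH] q l l0 /=; have l20 : 0 < l / 2 by rewrite divr_gt0.
rewrite cube_avg_subcubes//.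
have -> : forall F, sub_avg F - a = sub_avg (fun e => F e - a).
  move=> F; rewrite addrC -[sub_avg F]mul1r -sub_avg_lin; congr sub_avg.
  by apply/funext => e; rewrite mul1r addrC.
by apply: le_trans (ler_norm_sub_avg _) _; apply: ler_sub_avg => e; exact: IH.
Qed.

Lemma tree_avg_dist_le j a q l : 0 < l ->
  ((l ^+ n * tree_avg j (fun u => `|u - a|)%R q l)%:E <=
   \int[borel_rV n]_(x in cube q l) `|g x - a|%:E)%E.
Proof.
elim: j q l => [|j IH] q l l0 /=; first exact: le_cube_avg_dist.
have l20 : 0 < l / 2 by rewrite divr_gt0.
rewrite (integral_subcubes _ _ (f := fun x => `|g x - a|)); last first.
  by apply: measurableT_comp => //; exact: measurable_funB.
rewrite half_cube_volume /sub_avg mulrACA divff ?mul1r ?expf_neq0// mulr_sumr -sumEFin.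
by apply: lee_sum => e _; exact: IH.
Qed.

End cube_averages.

(* chosen so that [expR (c * (lam + jump)) = 3 / 2] for the constants [lam] and
   [jump] below *)
Definition john_nirenberg_const {R : realType} (n : nat) (M : R) : R :=
  ln (3 / 2) / (4 * M + 2 ^+ n * (2 * M)).

Section john_nirenberg.
Context {R : realType} {n : nat}.
Local Notation V := 'rV[R]_n.
Implicit Types (q : V) (l : R).
Variables (M : R) (g : V -> R).
Hypothesis M0 : 0 < M.
Hypothesis mg : measurable_fun setT g.
Hypothesis gM : forall (q : V) (l : R), 0 < l -> exists a,
  (\int[borel_rV n]_(x in cube q l) `|g x - a|%:E <= (M * l ^+ n)%:E)%E.

Lemma cube_integrable q l : 0 < l -> (borel_rV n).-integrable (cube q l) (EFin \o g).
Proof.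
move=> l0; have mQ := measurable_cube q l; have [a ga] := gM q l0.
have vQ : (borel_rV n (cube q l) < +oo)%E by rewrite borel_rV_cube ?ltry// ltW.
have ia : (borel_rV n).-integrable (cube q l) (EFin \o cst a).
  apply: (@measurable_bounded_integrable _ _ _ _ (cst a)) => //.
  by exists `|a|; split => // N aN x _; rewrite /= ltW.
have iB : (borel_rV n).-integrable (cube q l) (EFin \o (fun x => g x - a)).
  apply/integrableP; split.
    by apply/measurable_EFinP; apply: measurable_funTS; exact: measurable_funB.
  by rewrite (le_lt_trans ga)// ltry.
have := integrableD mQ iB ia; apply: eq_integrable => // x _ /=.
by rewrite -EFinD subrK.
Qed.

Let ig := cube_integrable.

Let osc_avg q l : 0 < l ->
  (\int[borel_rV n]_(x in cube q l) `|g x - cube_avg g q l|%:E <= (2 * M * l ^+ n)%:E)%E.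
Proof.
move=> l0; have [a ga] := gM q l0.
apply: le_trans (cube_avg_best mg ig q a l0) _.
by rewrite -mulrA EFinM lee_wpmul2l.
Qed.

(** [jump] bounds the change of the average from a cube to a child, whose volume is smaller by the
    factor [2^n]. [lam] is twice the bound [2 M] on the mean oscillation, so that Markov's
    inequality leaves at most half of the cube beyond it. *)
Let jump : R := 2 ^+ n * (2 * M).
Let lam : R := 4 * M.
Let c : R := john_nirenberg_const n M.

Let jump_gt0 : 0 < jump. Proof. by rewrite /jump !mulr_gt0 ?exprn_gt0. Qed.
Let lam_gt0 : 0 < lam. Proof. by rewrite /lam mulr_gt0. Qed.

Lemma john_nirenberg_const_gt0 : 0 < john_nirenberg_const n M.
Proof.
by rewrite /john_nirenberg_const divr_gt0 -/jump ?addr_gt0 ?ln_gt0//; lra.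
Qed.

Let expR_c_jump : expR (c * (lam + jump)) = 3 / 2.
Proof.
rewrite /c /john_nirenberg_const divfK; last by rewrite gt_eqF// addr_gt0.
by rewrite lnK// posrE; lra.
Qed.

Let expR_c_lam : expR (c * lam) <= 3 / 2.
Proof. by rewrite -expR_c_jump ler_expR ler_wpM2l ?(ltW john_nirenberg_const_gt0)// lerDl ltW. Qed.

Let subcube_jump q l e : 0 < l ->
  `|cube_avg g (subcube q l e) (l / 2) - cube_avg g q l| <= jump.
Proof.
move=> l0; have l20 : 0 < l / 2 by rewrite divr_gt0.
have : (((l / 2) ^+ n * `|cube_avg g (subcube q l e) (l / 2) - cube_avg g q l|)%:E
    <= (2 * M * l ^+ n)%:E)%E.
  apply: le_trans (le_cube_avg_dist ig _ _ l20) _.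
  apply: le_trans (osc_avg q l0).
  apply: ge0_subset_integral => //; try exact: measurable_cube.
    exact: measurable_dist_cst.
  exact: subcube_sub.
rewrite lee_fin [X in _ <= _ * X]half_cube_volume [leRHS](_ : _ = (l / 2) ^+ n * jump).
  by rewrite ler_pM2l// exprn_gt0.
by rewrite /jump; ring.
Qed.

(* the proportion of the depth-[j] subcubes having an ancestor, at or below
   [cube q l], on which the average of [g] is at distance more than [lam]
   from [a] *)
Fixpoint stopped (j : nat) (a : R) (q : V) (l : R) : R :=
  if lam < `|cube_avg g q l - a| then 1 else
  if j is i.+1 then sub_avg (fun e => stopped i a (subcube q l e) (l / 2)) else 0.

(** Markov's inequality with stopping, as in Doob's maximal inequality: at a stopped cube the
    distance of the average to [a] exceeds [lam], and convexity carries this lower bound down to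
    depth [j]. *)
Let stopped_le_tree_avg j a q l : 0 < l ->
  lam * stopped j a q l <= tree_avg g j (fun u => `|u - a|) q l.
Proof.
elim: j q l => [|j IH] q l l0 /=; have l20 : 0 < l / 2 by rewrite divr_gt0.
  by case: ifPn => [|_]; rewrite ?mulr0// mulr1; exact: ltW.
case: ifPn => [lt|_].
  by rewrite mulr1 (le_trans (ltW lt))// (dist_cube_avg_le_tree_avg mg ig j.+1).
rewrite -[leLHS]add0r -sub_avg_lin; apply: ler_sub_avg => e.
by rewrite add0r IH.
Qed.

Let E (a u : R) : R := expR (c * `|u - a|).

Let E_shift a b : forall u, E a u <= E a b * E b u.
Proof.
move=> u; rewrite /E -expRD -mulrDr ler_expR ler_wpM2l ?(ltW john_nirenberg_const_gt0)//.
by rewrite [leRHS]addrC ler_distD.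
Qed.

(* Before stopping, the average is within [lam] of [a], hence within
   [lam + jump] at a stopped cube, from which the bound 6 restarts. *)
Let tree_avg_exp_stopped j a :
  (forall i q l, (i <= j)%N -> 0 < l -> tree_avg g i (E (cube_avg g q l)) q l <= 6) ->
  forall i q l, (i <= j)%N -> 0 < l -> `|cube_avg g q l - a| <= lam + jump ->
  tree_avg g i (E a) q l <= 3 / 2 + 9 * stopped i a q l.
Proof.
move=> H; elim => [|i IH] q l ij l0 gla.
  rewrite /=; case: ifPn => [_|]; last first.
    rewrite -leNgt mulr0 addr0 => gl; apply: le_trans expR_c_lam.
    by rewrite ler_expR ler_wpM2l// ltW// john_nirenberg_const_gt0.
  rewrite mulr1 (@le_trans _ _ (3 / 2))//; last by lra.
  by rewrite -expR_c_jump ler_expR ler_wpM2l// ltW// john_nirenberg_const_gt0.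
have l20 : 0 < l / 2 by rewrite divr_gt0.
have [lt|] := ltP lam `|cube_avg g q l - a|.
  have -> : stopped i.+1 a q l = 1 by rewrite /= lt.
  (* With [b] the average on the stopped cube, [E a u] is at most [E a b] times [E b u]. The first
     factor is at most [3/2] and the second has tree average at most 6; their product 9 is the
     coefficient of [stopped]. *)
  apply: (@le_trans _ _ (E a (cube_avg g q l) * 6)); last first.
    have : E a (cube_avg g q l) <= 3 / 2.
      by rewrite -expR_c_jump ler_expR ler_wpM2l// ltW// john_nirenberg_const_gt0.
    by lra.
  apply: le_trans (ler_tree_avg _ _ _ _ (E_shift a (cube_avg g q l))) _.
  by rewrite tree_avgZ ler_wpM2l ?expR_ge0// H.
move=> le; have -> : stopped i.+1 a q l =
    sub_avg (fun e => stopped i a (subcube q l e) (l / 2)) by rewrite /= ltNge le.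
rewrite -sub_avg_lin /=; apply: ler_sub_avg => e.
apply: IH => //; first exact: ltnW.
rewrite (le_trans (ler_distD (cube_avg g q l) _ _))// addrC lerD//.
exact: subcube_jump.
Qed.

(** Strong induction on the depth. The root is centred at its own average, hence not stopped, so the
    estimate is made on its children; a stopped cube carries a shallower tree, to which the
    induction hypothesis applies. *)
Let tree_avg_exp j q l : 0 < l -> tree_avg g j (E (cube_avg g q l)) q l <= 6.
Proof.
elim/ltn_ind: j q l => -[|j] H q l l0.
  by rewrite /= /E subrr normr0 mulr0 expR0; lra.
have l20 : 0 < l / 2 by rewrite divr_gt0.
set a := cube_avg g q l.
have st : stopped j.+1 a q l <= 1 / 2.
  have : ((l ^+ n * (lam * stopped j.+1 a q l))%:E <= (2 * M * l ^+ n)%:E)%E.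
    apply: le_trans (osc_avg q l0).
    apply: le_trans (tree_avg_dist_le mg ig j.+1 a q l0).
    by rewrite lee_fin ler_wpM2l ?exprn_ge0 ?(ltW l0)// stopped_le_tree_avg.
  rewrite lee_fin mulrC ler_pM2r ?exprn_gt0// /lam.
  have -> : 4 * M * stopped j.+1 a q l = M * (4 * stopped j.+1 a q l) by ring.
  by rewrite [2 * M]mulrC ler_pM2l// => ?; lra.
have aa : `|a - a| <= lam by rewrite subrr normr0 ltW.
have stE : stopped j.+1 a q l = sub_avg (fun e => stopped j a (subcube q l e) (l / 2)).
  by rewrite /= -/a ltNge aa.
(* The value 6 is the one that reproduces itself: [3/2 + 9/2 = 6], where [9 = 6 * 3/2] and the
   stopped proportion is at most [1/2]. *)
apply: (@le_trans _ _ (3 / 2 + 9 * stopped j.+1 a q l)); last by lra.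
rewrite stE -sub_avg_lin /=; apply: ler_sub_avg => e.
apply: (tree_avg_exp_stopped (j := j)) => //.
  by move=> i q' l' ij l'0; exact: H.
by rewrite (le_trans (subcube_jump q e l0))// lerDr ltW.
Qed.

Local Open Scope ereal_scope.

(** The L^1 distance on [cube q l] between [g] and its conditional expectation on the dyadic
    subcubes of depth [j]. *)
Fixpoint tree_err (j : nat) (q : V) (l : R) : \bar R :=
  if j is i.+1 then \sum_(e : {ffun 'I_n -> bool}) tree_err i (subcube q l e) (l / 2)
  else \int[borel_rV n]_(x in cube q l) `|g x - cube_avg g q l|%:E.

(** On each cube of depth [j] the average of [g] is compared with the value of [phi] at the corner.
    [w] bounds the variation of [phi] at that scale, and the factor 2 is that of [cube_avg_best]. *)
Let tree_err_continuous (phi : V -> R) (w : R) j q l : continuous phi -> (0 < l)%R ->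
  (forall x y, cube q l x -> cube q l y ->
    (forall i, `|x ord0 i - y ord0 i| <= l / 2 ^+ j)%R -> (`|phi x - phi y| <= w)%R) ->
  tree_err j q l <= 2%:E * \int[borel_rV n]_(x in cube q l) `|g x - phi x|%:E +
    (2 * w * l ^+ n)%:E.
Proof.
move=> cphi; have mphi := continuous_measurable_rV cphi.
have md D : measurable_fun D (fun x => `|g x - phi x|%:E).
  apply/measurable_EFinP; apply: measurable_funTS.
  by apply: measurableT_comp => //; exact: measurable_funB.
elim: j q l => [|j IH] q l l0 Hw /=.
  apply: le_trans (cube_avg_best mg ig q (phi q) l0) _.
  have qq : cube q l q by move=> i; rewrite lexx ltrDl.
  have w0 : (0 <= w)%R.
    apply: le_trans (normr_ge0 (phi q - phi q)%R) _; apply: Hw => // i.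
    by rewrite subrr normr0 divr_ge0 ?exprn_ge0// ltW.
  rewrite -mulrA EFinM -ge0_muleDr//; last 2 first.
  - by apply: integral_ge0 => x _; rewrite lee_fin.
  - by rewrite lee_fin mulr_ge0// exprn_ge0// ltW.
  apply: lee_wpmul2l => //.
  apply: (@le_trans _ _ (\int[borel_rV n]_(x in cube q l) (`|g x - phi x|%:E + (cst w%:E) x))).
    apply: ge0_le_integral => //; first exact: measurable_cube.
    - exact: measurable_dist_cst.
    - by apply: emeasurable_funD.
    - move=> x xq /=; rewrite -EFinD lee_fin (le_trans (ler_distD (phi x) _ _))// lerD2l.
      apply: Hw => // i; have /andP[? ?] := xq i; rewrite expr0 divr1 ger0_norm; lra.
  rewrite ge0_integralD//; first last.
  - exact: measurable_cube.
  rewrite integral_cst//; last exact: measurable_cube.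
  by rewrite leeD2l// EFinM -(borel_rV_cube q (ltW l0)).
have l20 : (0 < l / 2)%R by rewrite divr_gt0.
rewrite (integral_subcubes _ _ (f := fun x => `|g x - phi x|%R)); last first.
  by apply: measurableT_comp => //; exact: measurable_funB.
rewrite ge0_sume_distrr; last by move=> e _; exact: integral_ge0.
rewrite half_cube_volume -card_subcubes.
have -> : (2 * w * (#|{ffun 'I_n -> bool}|%:R * (l / 2) ^+ n))%:E =
    \sum_(e : {ffun 'I_n -> bool}) (2 * w * (l / 2) ^+ n)%:E.
  by rewrite sumEFin sumr_const; congr EFin; rewrite -[RHS]mulr_natl mulrCA.
rewrite -big_split/=; apply: lee_sum => e _; apply: IH => // x y xe ye xy.
apply: Hw; [exact: subcube_sub xe|exact: subcube_sub ye|].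
move=> i; apply: le_trans (xy i) _.
by rewrite exprS invfM mulrA.
Qed.

(** L^1 convergence of the conditional expectations, obtained by approximating [g] with a continuous
    function; it takes the place of Lebesgue's differentiation theorem. *)
Let tree_err_small (e : R) q l : (0 < e)%R -> (0 < l)%R -> exists j, tree_err j q l <= e%:E.
Proof.
move=> e0 l0; have mQ := measurable_cube q l.
have vQ : borel_rV n (cube q l) < +oo by rewrite borel_rV_cube ?ltry// ltW.
have e40 : (0 < e / 4)%R by rewrite divr_gt0.
have [phi cphi gphi] := continuous_dense_L1_rV mQ vQ mg (ig q l0) e40.
have ln0 : (0 < l ^+ n)%R by rewrite exprn_gt0.
(* Makes the term [2 w l^n] of the comparison equal to [e / 2]; the approximation of [g] within
   [e / 4], doubled, supplies the other half. *)
pose w : R := (e / 4 / l ^+ n)%R.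
have w0 : (0 < w)%R by rewrite divr_gt0.
pose K : set V := [set x | forall i, (`[q ord0 i, (q ord0 i + l)%R]%classic : set R) (x ord0 i)].
have cK : compact K.
  apply: (@rV_compact R n (fun i => `[q ord0 i, (q ord0 i + l)%R]%classic)) => i.
  exact: segment_compact.
have [d d0 dK] := continuous_compact_uniform cphi cK w0.
have [j jd] : exists j, (l / 2 ^+ j < d)%R.
  exists (Num.bound (l / d)); rewrite ltr_pdivrMr ?exprn_gt0// mulrC -ltr_pdivrMr//.
  apply: (@lt_trans _ _ (Num.bound (l / d))%:R).
    by rewrite archi_boundP// divr_ge0// ltW.
  by rewrite -natrX ltr_nat ltn_expl.
exists j; apply: le_trans (tree_err_continuous (w := w) cphi l0 _) _.
  move=> x y xq yq xy; apply: dK.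
    by move=> i; have /andP[? ?] := xq i; rewrite /= in_itv/=; apply/andP; split => //; exact: ltW.
  split => // i' i; rewrite (ord1 i').
  exact: le_lt_trans (xy i) jd.
have -> : (2 * w * l ^+ n = e / 2)%R by rewrite -mulrA divfK ?gt_eqF//; lra.
apply: (@le_trans _ _ (2%:E * (e / 4)%:E + (e / 2)%:E)).
  by rewrite leeD2r// lee_wpmul2l.
by rewrite -EFinM -EFinD lee_fin; lra.
Qed.

(** On a cube of depth [j], [h (g x)] exceeds [h] of the average by at most [k] times the distance
    from [g x] to the average; these distances add up to [tree_err]. *)
Let integral_lipschitz_le_tree_avg (h : R -> R) (k : R) j q l :
  measurable_fun setT h -> (forall u, 0 <= h u)%R -> (0 <= k)%R ->
  (forall u v, `|h u - h v| <= k * `|u - v|)%R -> (0 < l)%R ->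
  \int[borel_rV n]_(x in cube q l) (h (g x))%:E <=
    (l ^+ n * tree_avg g j h q l)%:E + k%:E * tree_err j q l.
Proof.
move=> mh h0 k0 hk; elim: j q l => [|j IH] q l l0 /=.
  have mQ := measurable_cube q l.
  have mhg : measurable_fun setT (h \o g) by exact: measurableT_comp.
  apply: (@le_trans _ _ (\int[borel_rV n]_(x in cube q l)
      ((cst (h (cube_avg g q l))%:E) x + k%:E * `|g x - cube_avg g q l|%:E))).
    apply: ge0_le_integral => //.
    - by move=> x _; rewrite lee_fin.
    - by apply/measurable_EFinP; exact: measurable_funTS.
    - by apply: emeasurable_funD => //; apply: measurable_funeM; exact: measurable_dist_cst.
    - move=> x _ /=; rewrite -EFinM -EFinD lee_fin -lerBlDl.
      by rewrite (le_trans (ler_norm _)).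
  rewrite ge0_integralD//; first last.
  - by apply: measurable_funeM; exact: measurable_dist_cst.
  - by move=> x _; rewrite -EFinM lee_fin mulr_ge0.
  - by move=> x _; rewrite /= lee_fin.
  rewrite integral_cst// ge0_integralZl//; last exact: measurable_dist_cst.
  rewrite leeD2r// [leRHS](_ : _ = (h (cube_avg g q l))%:E * (l ^+ n)%:E).
    by rewrite -(borel_rV_cube q (ltW l0)).
  by rewrite muleC.
have l20 : (0 < l / 2)%R by rewrite divr_gt0.
rewrite (integral_subcubes _ _ (f := h \o g)); last exact: measurableT_comp.
have err0 i q' l' : 0 <= tree_err i q' l'.
  elim: i q' l' => [|i IHi] q' l' /=; first by apply: integral_ge0 => x _; rewrite lee_fin.
  by apply: sume_ge0 => e _; exact: IHi.
rewrite ge0_sume_distrr//.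
rewrite half_cube_volume /sub_avg mulrACA divff ?mul1r ?expf_neq0// mulr_sumr -sumEFin.
by rewrite -big_split/=; apply: lee_sum => e _; exact: IH.
Qed.

Local Close Scope ereal_scope.

(** [k.1] is the centre and [k.2] a cut in the exponent, without which the exponential would not be
    Lipschitz. Monotone convergence removes the cut. *)
Let truncated (k : R * nat) (u : R) : R := (expR (Num.min (c * `|u - k.1|) k.2%:R))%R.

Let truncated_lipschitz k u v :
  (`|truncated k u - truncated k v| <= expR k.2%:R * c * `|u - v|)%R.
Proof.
have expL (x y : R) : (x <= y -> y <= k.2%:R -> expR y - expR x <= expR k.2%:R * (y - x))%R.
  move=> xy yk.
  (* Factoring out the larger exponential reduces the Lipschitz bound to [1 + z <= expR z] at
     [z = x - y]. *)
  have -> : (expR y - expR x = expR y * (1 - expR (x - y)))%R.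
    by rewrite mulrBr mulr1 -expRD addrCA subrr addr0.
  apply: ler_pM; rewrite ?expR_ge0 ?ler_expR//.
    by rewrite subr_ge0 -expR0 ler_expR subr_le0.
  have := expR_ge1Dx (x - y); lra.
pose m (x : R) := Num.min x k.2%:R.
have minL (x y : R) : (`|m x - m y| <= `|x - y|)%R.
  have := ler_norm (x - y); have := ler_norm (y - x); rewrite (distrC y x).
  have := normr_ge0 (x - y) => ? ? ?.
  by rewrite ler_norml /m /Num.min; apply/andP; case: ltP => ?; case: ltP => ?; split; lra.
have expL2 (x y : R) : (`|expR (m x) - expR (m y)| <= expR k.2%:R * `|x - y|)%R.
  apply: (@le_trans _ _ (expR k.2%:R * `|m x - m y|)%R); last first.
    by rewrite ler_wpM2l ?expR_ge0.
  have mk z : (m z <= k.2%:R)%R by rewrite /m ge_min lexx orbT.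
  have [xy|yx] := leP (m x) (m y).
    rewrite distrC [in leRHS]distrC !ger0_norm ?subr_ge0 ?ler_expR//.
    exact: expL.
  rewrite !ger0_norm ?subr_ge0 ?ler_expR ?(ltW yx)//; apply: expL => //; exact: ltW.
apply: le_trans (expL2 _ _) _; rewrite -mulrA ler_wpM2l ?expR_ge0//.
rewrite -mulrBr normrM gtr0_norm ?john_nirenberg_const_gt0// ler_wpM2l ?(ltW john_nirenberg_const_gt0)//.
apply: le_trans (ler_dist_dist _ _) _.
by rewrite opprB addrA subrK.
Qed.

Local Open Scope ereal_scope.

(** The order of the limits matters: for a fixed cut, a large depth makes the Lipschitz constant
    times [tree_err] as small as desired; only then is the cut sent to infinity. The bound 6 depends
    on neither. *)
Lemma john_nirenberg_cube q l : (0 < l)%R ->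
  \int[borel_rV n]_(x in cube q l) (expR (c * `|g x - cube_avg g q l|))%:E
  <= (6 * l ^+ n)%:E.
Proof.
move=> l0; set a := cube_avg g q l.
have mQ := measurable_cube q l.
have mT k : measurable_fun setT (truncated k).
  apply: (measurableT_comp (f := @expR R)) => //.
  apply: measurable_minr => //; apply: measurable_funM => //.
  by apply: measurableT_comp => //; exact: measurable_funB.
have trunc k : \int[borel_rV n]_(x in cube q l) (truncated (a, k) (g x))%:E <= (6 * l ^+ n)%:E.
  have L0 : (0 < expR k%:R * c)%R by rewrite mulr_gt0 ?expR_gt0 ?john_nirenberg_const_gt0.
  apply/lee_addgt0Pr => e e0.
  have [j je] := tree_err_small q (divr_gt0 e0 L0) l0.
  apply: le_trans (integral_lipschitz_le_tree_avg j q (mT (a, k)) _ _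
    (truncated_lipschitz (a, k)) l0) _.
  - by move=> u; exact: expR_ge0.
  - exact: ltW.
  rewrite leeD//.
    rewrite lee_fin mulrC ler_pM2r ?exprn_gt0//.
    apply: le_trans (tree_avg_exp j q l0); apply: ler_tree_avg => u.
    by rewrite /truncated /E ler_expR ge_min lexx.
  apply: (@le_trans _ _ ((expR k%:R * c)%:E * (e / (expR k%:R * c))%:E)).
    by apply: lee_wpmul2l => //; rewrite lee_fin ltW.
  by rewrite -EFinM mulrC divfK// gt_eqF.
have cv : \int[borel_rV n]_(x in cube q l) (truncated (a, k) (g x))%:E @[k --> \oo] -->
    \int[borel_rV n]_(x in cube q l) (expR (c * `|g x - a|))%:E.
  have -> : \int[borel_rV n]_(x in cube q l) (expR (c * `|g x - a|))%:E =
      \int[borel_rV n]_(x in cube q l) limn (fun k => (truncated (a, k) (g x))%:E).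
    apply: eq_integral => x _; apply/esym/cvg_lim => //.
    apply: cvg_near_cst; exists (Num.bound (c * `|g x - a|)%R) => // k /= ck.
    rewrite /truncated min_l//= ltW//; apply: lt_le_trans (archi_boundP _) _.
      by rewrite mulr_ge0// ltW// john_nirenberg_const_gt0.
    by rewrite ler_nat.
  apply: (@cvg_monotone_convergence _ _ R (borel_rV n) _ mQ (fun k x => (truncated (a, k) (g x))%:E)).
  - move=> k; apply/measurable_EFinP; apply: measurable_funTS.
    exact: measurableT_comp (mT _) mg.
  - by move=> k x _; rewrite lee_fin expR_ge0.
  - move=> x _ k k' kk'; rewrite lee_fin ler_expR.
    by rewrite le_min ge_min lexx/= ge_min ler_nat kk' orbT.
rewrite -(cvg_lim _ cv)//; apply: lime_le; last exact: nearW.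
by apply/cvg_ex; eexists; exact: cv.
Qed.

End john_nirenberg.

(** * Mollification of Borel functions *)

Section restricted_fubini.
Context d1 d2 (Z : measurableType d1) (X : measurableType d2) (R : realType).
Variables (nu : {sigma_finite_measure set Z -> \bar R}).
Variables (mu : {sigma_finite_measure set X -> \bar R}).
Variable B : set X.
Hypothesis mB : measurable B.
Local Open Scope ereal_scope.

Let indicB (h : Z * X -> \bar R) := fun p => h p * (\1_B p.2)%:E.

Let measurable_indicB h : measurable_fun setT h -> measurable_fun setT (indicB h).
Proof.
move=> mh; apply: emeasurable_funM => //; apply/measurable_EFinP.
exact: (measurableT_comp (measurable_indic mB)).
Qed.

Let integral_indicB h z : \int[mu]_(x in B) h (z, x) = \int[mu]_x indicB h (z, x).
Proof. by rewrite integral_mkcond epatch_indic. Qed.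

Lemma fubini_tonelli_in (h : Z * X -> \bar R) :
  measurable_fun setT h -> (forall p, 0 <= h p) ->
  \int[nu]_z \int[mu]_(x in B) h (z, x) = \int[mu]_(x in B) \int[nu]_z h (z, x).
Proof.
move=> mh h0; under eq_integral do rewrite integral_indicB.
have mi := measurable_indicB mh.
have i0 p : 0 <= indicB h p by rewrite mule_ge0// lee_fin.
rewrite (fubini_tonelli (m1 := nu) _ mi i0)// [RHS]integral_mkcond epatch_indic.
apply: eq_integral => x _; rewrite /indicB /= ge0_integralZr//.
exact: (measurableT_comp mh (measurable_pair2 x)).
Qed.

Lemma measurable_integral_in (h : Z * X -> \bar R) :
  measurable_fun setT h -> (forall p, 0 <= h p) ->
  measurable_fun setT (fun z => \int[mu]_(x in B) h (z, x)).
Proof.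
move=> mh h0; under eq_fun do rewrite integral_indicB.
apply: (measurable_fun_fubini_tonelli_F _ (measurable_indicB mh)).
by move=> p; rewrite mule_ge0// lee_fin.
Qed.

Lemma measurable_Rintegral_in (h : Z * X -> R) : measurable_fun setT h ->
  measurable_fun setT (fun z => (\int[mu]_(x in B) h (z, x))%R).
Proof.
move=> mh; rewrite /Rintegral; apply: (measurableT_comp (fine_measurable measurableT)).
under eq_fun do rewrite integralE.
have mE : measurable_fun setT (EFin \o h) by exact/measurable_EFinP.
apply: emeasurable_funB.
- rewrite (_ : (fun _ => _) = fun z => \int[mu]_(x in B) (EFin \o h)^\+ (z, x)).
    by apply: measurable_integral_in => //; exact: measurable_funepos.
  by apply/funext => z; apply: eq_integral => x _; rewrite !funeposE.
- rewrite (_ : (fun _ => _) = fun z => \int[mu]_(x in B) (EFin \o h)^\- (z, x)).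
    by apply: measurable_integral_in => //; exact: measurable_funeneg.
  by apply/funext => z; apply: eq_integral => x _; rewrite !funenegE.
Qed.

Lemma fubini_in (h : Z * X -> R) : measurable_fun setT h ->
  \int[nu]_z \int[mu]_(x in B) `|h (z, x)|%:E < +oo ->
  \int[nu]_z \int[mu]_(x in B) (h (z, x))%:E = \int[mu]_(x in B) \int[nu]_z (h (z, x))%:E.
Proof.
move=> mh hoo; have mE : measurable_fun setT (EFin \o h) by exact/measurable_EFinP.
under eq_integral do rewrite (integral_indicB (EFin \o h)).
have ih : (nu \x mu).-integrable setT (indicB (EFin \o h)).
  apply/integrable12ltyP; first exact: measurable_indicB.
  rewrite (eq_integral (fun z => \int[mu]_(x in B) `|h (z, x)|%:E))// => z _.
  rewrite [RHS]integral_mkcond epatch_indic; apply: eq_integral => x _.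
  by rewrite /indicB abseM; congr (_ * _); rewrite gee0_abs// lee_fin.
rewrite (Fubini ih) [RHS]integral_mkcond epatch_indic.
apply: eq_integral => x _; case: (boolP (x \in B)) => xB.
  transitivity (\int[nu]_z (h (z, x))%:E); last by rewrite /= indicE xB mule1.
  by apply: eq_integral => z _; rewrite /indicB indicE xB mule1.
transitivity (\int[nu]_z cst 0 z); last by rewrite /= indicE (negbTE xB) mule0 integral0.
by apply: eq_integral => z _; rewrite /indicB indicE (negbTE xB) mule0.
Qed.

End restricted_fubini.

Section mixture.
Context d1 d2 (Z : measurableType d1) (X : measurableType d2) (R : realType).
Variables (nu : {sigma_finite_measure set Z -> \bar R}).
Variables (mu : {sigma_finite_measure set X -> \bar R}).
Variables (k : Z -> R) (F : Z * X -> R) (B : set X).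
Hypotheses (mk : measurable_fun setT k) (k0 : forall z, 0 <= k z).
Hypothesis ik : (\int[nu]_z (k z)%:E = 1)%E.
Hypothesis mF : measurable_fun setT F.
Hypothesis mB : measurable B.

(** [k] is a probability density. The same notion serves for a time slice of the mollification,
    where [F (z, x)] is a translate of [f], and for the mollification error, where it is a translate
    minus [f]. *)
Definition mixture (x : X) : R := \int[nu]_z (k z * F (z, x)).

Local Open Scope ereal_scope.

Let mk1 : measurable_fun setT (fun p : Z * X => k p.1).
Proof. exact: measurableT_comp mk measurable_fst. Qed.

Let mkF : measurable_fun setT (fun p : Z * X => k p.1 * F p)%R.
Proof. exact: measurable_funM. Qed.

Let mkabsF (G : Z * X -> R) : measurable_fun setT G ->
  measurable_fun setT (fun p : Z * X => (k p.1 * `|G p|)%:E).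
Proof.
by move=> mG; apply/measurable_EFinP; apply: measurable_funM => //; exact: measurableT_comp.
Qed.

(** The slices are bounded only where [k] is nonzero: for the mollification these are the small
    shifts, for which the translates are controlled. *)
Let integral_weight_le (G : Z * X -> R) (C : \bar R) : 0 <= C -> measurable_fun setT G ->
  (forall z, k z != 0%R -> \int[mu]_(x in B) `|G (z, x)|%:E <= C) ->
  \int[nu]_z \int[mu]_(x in B) (k z * `|G (z, x)|)%:E <= C.
Proof.
move=> C0 mG GC.
have absG0 p : 0 <= (k p.1 * `|G p|)%:E by rewrite lee_fin mulr_ge0.
apply: (@le_trans _ _ (\int[nu]_z (C * (k z)%:E))).
  apply: ge0_le_integral => //.
  - by move=> z _; apply: integral_ge0 => x _; exact: (absG0 (z, x)).
  - exact: (measurable_integral_in mu mB (mkabsF mG) absG0).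
  - by apply: measurable_funeM; exact/measurable_EFinP.
  - move=> z _; under eq_integral do rewrite EFinM.
    have mGz : measurable_fun B (fun x => `|G (z, x)|%:E).
      apply/measurable_EFinP; apply: measurable_funTS; apply: measurableT_comp => //.
      exact: (measurableT_comp mG (measurable_pair1 z)).
    rewrite ge0_integralZl//; last by rewrite lee_fin.
    have [->|kz] := eqVneq (k z) 0%R; first by rewrite mul0e mule0.
    by rewrite muleC lee_wpmul2r ?lee_fin// GC.
rewrite ge0_integralZl//; last 2 first.
- exact/measurable_EFinP.
- by move=> z _; rewrite lee_fin.
by rewrite ik mule1.
Qed.

(** The real integral is the [fine] part of the extended one and becomes 0 when that is infinite, so
    the bound persists in this case. *)
Let abse_Rintegral_le (h : Z -> R) : measurable_fun setT h ->
  `|\int[nu]_z h z|%R%:E <= \int[nu]_z `|h z|%:E.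
Proof.
move=> mh; apply: (@le_trans _ _ `|\int[nu]_z (h z)%:E|).
  by rewrite /Rintegral; case: (\int[nu]_z (h z)%:E) => [r| |] //=; rewrite normr0 leey.
by apply: le_abse_integral => //; exact/measurable_EFinP.
Qed.

Let mFx x : measurable_fun setT (fun z => F (z, x)).
Proof. exact: (measurableT_comp mF (measurable_pair2 x)). Qed.

Let mFz z : measurable_fun setT (fun x => F (z, x)).
Proof. exact: (measurableT_comp mF (measurable_pair1 z)). Qed.

Let mswap : measurable_fun setT (fun p : X * Z => (p.2, p.1)).
Proof. by apply/measurable_fun_pair => /=; [exact: measurable_snd|exact: measurable_fst]. Qed.

Lemma measurable_mixture : measurable_fun setT mixture.
Proof.
have mh : measurable_fun setT (fun p : X * Z => k p.2 * F (p.2, p.1))%R.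
  exact: (measurableT_comp mkF mswap).
by have := measurable_Rintegral_in nu measurableT mh.
Qed.

Lemma mixture_L1_le (C : \bar R) : 0 <= C ->
  (forall z, k z != 0%R -> \int[mu]_(x in B) `|F (z, x)|%:E <= C) ->
  \int[mu]_(x in B) `|mixture x|%:E <= C.
Proof.
move=> C0 FC; apply: le_trans (integral_weight_le C0 mF FC).
have h0 p : 0 <= (k p.1 * `|F p|)%:E by rewrite lee_fin mulr_ge0.
rewrite (fubini_tonelli_in nu mu mB (mkabsF mF) h0).
apply: ge0_le_integral => //.
- by apply/measurable_EFinP; apply: measurable_funTS; apply: measurableT_comp => //; exact: measurable_mixture.
- apply: measurable_funTS.
  have mh := measurableT_comp (mkabsF mF) mswap.
  by have := measurable_integral_in nu measurableT mh (fun p => h0 (p.2, p.1)).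
- move=> x _; have mkFx : measurable_fun setT (fun z => k z * F (z, x))%R by exact: measurable_funM.
  apply: le_trans (abse_Rintegral_le mkFx) _.
  by under eq_integral do rewrite normrM ger0_norm//.
Qed.

(** Fubini's theorem identifies the mean of the mixture with the mixture of the means; it remains to
    bound in L^1 the mixture of the centred slices. [C] serves for absolute convergence, so that [K]
    survives without loss. *)
Lemma mixture_oscillation_le (C K : R) : (0 <= C)%R -> (0 <= K)%R ->
  (forall x, B x -> nu.-integrable setT (fun z => (k z * F (z, x))%:E)) ->
  (forall z, k z != 0%R -> \int[mu]_(x in B) `|F (z, x)|%:E <= C%:E) ->
  (forall z, k z != 0%R -> \int[mu]_(x in B)
     `|F (z, x) - (fine (mu B))^-1 * \int[mu]_(x in B) F (z, x)|%:E <= K%:E) ->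
  \int[mu]_(x in B)
    `|mixture x - (fine (mu B))^-1 * \int[mu]_(x in B) mixture x|%:E <= K%:E.
Proof.
move=> C0 K0 ikF FC FK.
set v := (fine (mu B))^-1%R.
pose RF z := (\int[mu]_(x in B) F (z, x))%R.
have mRF : measurable_fun setT RF by exact: measurable_Rintegral_in.
have FiB z : k z != 0%R -> mu.-integrable B (EFin \o (fun x => F (z, x))).
  move=> kz; apply/integrableP; split; first by apply/measurable_EFinP; exact: measurable_funTS.
  by rewrite (le_lt_trans (FC z kz))// ltry.
have ikR : nu.-integrable setT (EFin \o (fun z => k z * RF z)%R).
  apply/integrableP; split; first by apply/measurable_EFinP; exact: measurable_funM.
  apply: (@le_lt_trans _ _ (\int[nu]_z (C%:E * (k z)%:E))).
    apply: ge0_le_integral => //.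
    - apply: measurableT_comp => //; apply/measurable_EFinP; exact: measurable_funM.
    - by apply: measurable_funeM; exact/measurable_EFinP.
    - move=> z _; rewrite -EFinM lee_fin normrM ger0_norm// mulrC.
      have [->|kz] := eqVneq (k z) 0%R; first by rewrite !mulr0.
      rewrite ler_wpM2r//.
      apply: le_trans (le_normr_Rintegral mB (FiB z kz)) _.
      rewrite -lee_fin; apply: le_trans (FC z kz).
      by rewrite /Rintegral fineK// ge0_fin_numE ?integral_ge0// (le_lt_trans (FC z kz))// ltry.
  rewrite ge0_integralZl//; last 2 first.
  - exact/measurable_EFinP.
  - by move=> z _; rewrite lee_fin.
  by rewrite ik mule1 ltry.
have ikm : nu.-integrable setT (EFin \o (fun z => k z * (v * RF z))%R).
  have := integrableZl measurableT v ikR; apply: eq_integrable => // z _ /=.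
  by rewrite -EFinM mulrCA.
have mixE : (v * \int[mu]_(x in B) mixture x)%R = (\int[nu]_z (k z * (v * RF z)))%R.
  have kF_lty : \int[nu]_z \int[mu]_(x in B) `|k z * F (z, x)|%:E < +oo.
    under eq_integral do under eq_integral do rewrite normrM ger0_norm//.
    by rewrite (le_lt_trans (integral_weight_le _ mF FC))// ?lee_fin// ltry.
  have E := fubini_in (nu := nu) (mu := mu) mB mkF kF_lty.
  under [RHS]eq_Rintegral do rewrite mulrCA.
  rewrite RintegralZl//; congr (_ * fine _)%R.
  transitivity (\int[mu]_(x in B) \int[nu]_z (k z * F (z, x))%:E).
    apply: eq_integral => x; rewrite inE => Bx.
    by rewrite fineK//; apply: integrable_fin_num => //; exact: ikF.
  rewrite -E; apply: eq_integral => z _.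
  have [kz|kz] := eqVneq (k z) 0%R.
    by rewrite kz mul0r; under eq_integral do rewrite /= mul0r; rewrite integral0.
  rewrite EFinM fineK; last by apply: integrable_fin_num => //; exact: FiB.
  by rewrite -integralZl//; exact: FiB.
rewrite mixE.
pose G p := (F p - v * RF p.1)%R.
have mG : measurable_fun setT G.
  by apply: measurable_funB => //; apply: measurable_funM => //; exact: measurableT_comp.
have h0 p : 0 <= (k p.1 * `|G p|)%:E by rewrite lee_fin mulr_ge0.
apply: le_trans (integral_weight_le (C := K%:E) _ mG FK); last by rewrite lee_fin.
rewrite (fubini_tonelli_in nu mu mB (mkabsF mG) h0).
apply: ge0_le_integral => //.
- apply/measurable_EFinP; apply: measurable_funTS; apply: measurableT_comp => //.
  by apply: measurable_funB => //; exact: measurable_mixture.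
- apply: measurable_funTS.
  have mh := measurableT_comp (mkabsF mG) mswap.
  by have := measurable_integral_in nu measurableT mh (fun p => h0 (p.2, p.1)).
- move=> x Bx; rewrite -RintegralB//; last exact: ikF.
  have mkG : measurable_fun setT (fun z => k z * F (z, x) - k z * (v * RF z))%R.
    by apply: measurable_funB; apply: measurable_funM => //; exact: measurable_funM.
  apply: le_trans (abse_Rintegral_le mkG) _.
  by under eq_integral do rewrite -mulrBr normrM ger0_norm//.
Qed.

End mixture.

(** * Mollification on space-time *)

Section time_space.
Context {R : realType} {n : nat}.
Local Notation V := 'rV[R]_n.
Local Notation TV := (measurableTypeR R * V)%type.

Lemma measurable_fun_time_space d (T : measurableType d) (a : T -> R) (b : T -> V) :
  measurable_fun setT a -> measurable_fun setT b ->
  measurable_fun setT (fun p => (a p, b p) : TV).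
Proof. by move=> ma mb; apply/measurable_fun_pair => //= mT Y mY; exact: ma. Qed.

Lemma measurable_time : measurable_fun [set: TV] (fst : TV -> R).
Proof. by move=> mT Y mY; exact: measurable_fst. Qed.

Lemma measurable_rV_sub d (T : measurableType d) (a b : T -> V) :
  measurable_fun setT a -> measurable_fun setT b ->
  measurable_fun setT (fun p => a p - b p).
Proof.
move=> ma mb; apply: measurable_fun_coordP => i; under eq_fun do rewrite !mxE.
by apply: measurable_funB; apply: (measurableT_comp (measurable_coord i)).
Qed.

Lemma integral_eball_translate (c y : V) (r : R) (g : V -> \bar R) :
  measurable_fun setT g ->
  (\int[borel_rV n]_(x in eball c r) g (x - y)%R = \int[borel_rV n]_(x in eball (c - y) r) g x)%E.
Proof.
move=> mg.
have -> : eball c r = (fun x => x - y) @^-1` eball (c - y) r.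
  by apply/seteqP; split => x; rewrite /eball /= opprB addrA subrK.
have msub : measurable_fun setT (fun x : V => x - y) by exact: measurable_rV_sub.
apply: (@integral_measure_preserving _ _ V V R (borel_rV n) (borel_rV n) _ msub).
- move=> A mA.
  have mA' : measurable ((fun x : V => x - y) @^-1` A).
    by rewrite -[X in measurable X]setTI; exact: msub.
  have mI : measurable_fun setT (fun x : V => (\1_A x : R)%:E).
    by apply/measurable_EFinP; exact: measurable_indic.
  have := ge0_integral_rV_translate y mI (fun x => _) => E.
  transitivity (\int[borel_rV n]_x (\1_((fun x : V => x - y) @^-1` A) x)%:E)%E.
    by rewrite integral_indic// setIT.
  transitivity (\int[borel_rV n]_x (\1_A x)%:E)%E; last by rewrite integral_indic// setIT.
  by apply: E => x; rewrite lee_fin.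
- exact: measurable_eball.
- exact: measurable_funTS.
Qed.

(** A name for the product, able to carry the sigma-finite structure that Fubini's theorem over
    space-time and the completion lemmas ask for. *)
Definition time_space_measure := (@lebesgue_measure R \x borel_rV n)%E.

HB.instance Definition _ := Measure.on time_space_measure.

Let time_space_sigma_finite : sigma_finite setT time_space_measure.
Proof.
have /sigma_finiteP[F [TF ndF Foo]] := sigma_finiteT (@lebesgue_measure R).
have /sigma_finiteP[G [TG ndG Goo]] := sigma_finiteT (borel_rV (R := R) n).
exists (fun k => F k `*` G k).
  apply/esym/seteqP; split=> // -[t x] _.
  have [i _ Fi] : (\bigcup_i F i) t by rewrite -TF.
  have [j _ Gj] : (\bigcup_j G j) x by rewrite -TG.
  exists (maxn i j) => //; split => /=.
    by move: Fi; exact/subsetPset/ndF/leq_maxl.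
  by move: Gj; exact/subsetPset/ndG/leq_maxr.
move=> k; have [mF Fk] := Foo k; have [mG Gk] := Goo k; split; first exact: measurableX.
rewrite [ltLHS](_ : _ = (@lebesgue_measure R \x borel_rV n)%E (F k `*` G k))//.
by rewrite product_measure1E// lte_mul_pinfty// ge0_fin_numE.
Qed.

HB.instance Definition _ := Measure_isSigmaFinite.Build _ _ _ time_space_measure
  time_space_sigma_finite.

Section mollification.
Variables (psi : V -> R) (theta : R -> R) (eps A : R).
Hypotheses (mpsi : measurable_fun setT psi) (mtheta : measurable_fun setT theta).
Hypotheses (psi0 : forall y, 0 <= psi y) (theta0 : forall s, 0 <= theta s).
Hypothesis psiA : forall y, psi y <= A.
Hypothesis psi_supp : forall y, psi y != 0 -> eball 0 eps y.
Hypothesis theta_supp : forall s, theta s != 0 -> `[- eps, eps]%classic s.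
Hypothesis ipsi : (\int[borel_rV n]_y (psi y)%:E = 1)%E.
Hypothesis itheta : (\int[lebesgue_measure]_s (theta s)%:E = 1)%E.
Hypothesis eps0 : 0 < eps.

Variables (f : TV -> R) (M : R).
Hypothesis M0 : 0 <= M.
Hypothesis mf : measurable_fun setT f.
Hypothesis f_L1 : forall r, exists2 C, 0 <= C &
  forall t, (\int[borel_rV n]_(x in eball 0 r) `|f (t, x)|%:E <= C%:E)%E.

Local Notation nu := time_space_measure.

Definition kernel (z : TV) : R := theta z.1 * psi z.2.

Definition mollified (w : TV) : R :=
  \int[nu]_z (kernel z * f (w.1 - z.1, w.2 - z.2)).

Let mtheta' : measurable_fun [set: measurableTypeR R] theta.
Proof. by move=> mT Y mY; exact: mtheta. Qed.

Let mEtheta : measurable_fun [set: measurableTypeR R] (fun s => (theta s)%:E).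
Proof. by apply/measurable_EFinP; exact: mtheta'. Qed.

Lemma measurable_kernel : measurable_fun setT kernel.
Proof.
apply: measurable_funM.
  exact: (measurableT_comp mtheta' measurable_fst).
exact: (measurableT_comp mpsi measurable_snd).
Qed.

Lemma kernel_ge0 z : 0 <= kernel z. Proof. exact: mulr_ge0. Qed.

Lemma integral_kernel : (\int[nu]_z (kernel z)%:E = 1)%E.
Proof.
rewrite (fubini_tonelli1 (fun z => (kernel z)%:E)); last 2 first.
- by apply/measurable_EFinP; exact: measurable_kernel.
- by move=> z; rewrite lee_fin kernel_ge0.
rewrite -itheta; apply: eq_integral => s _; rewrite /fubini_F.
transitivity (\int[borel_rV n]_y ((theta s)%:E * (psi y)%:E))%E.
  by apply: eq_integral => y _; rewrite -EFinM.
rewrite ge0_integralZl//.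
- by rewrite ipsi mule1.
- exact/measurable_EFinP.
- by move=> y _; rewrite lee_fin.
- by rewrite lee_fin.
Qed.

Let measurable_shifted :
  measurable_fun setT (fun p : TV * TV => f ((p.2.1 : R) - p.1.1, p.2.2 - p.1.2)).
Proof.
apply: (measurableT_comp mf); apply: measurable_fun_time_space.
  apply: measurable_funB; apply: (measurableT_comp measurable_time).
    exact: measurable_snd.
  exact: measurable_fst.
by apply: measurable_rV_sub; apply: (measurableT_comp measurable_snd);
  [exact: measurable_snd|exact: measurable_fst].
Qed.

Lemma measurable_mollified : measurable_fun setT mollified.
Proof. exact: (measurable_mixture nu measurable_kernel measurable_shifted). Qed.

Let mFt t : measurable_fun setT (fun p : TV * V => f (t - p.1.1, p.2 - p.1.2)).
Proof.
apply: (measurableT_comp mf); apply: measurable_fun_time_space.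
  apply: measurable_funB => //.
  by apply: (measurableT_comp measurable_time); exact: measurable_fst.
apply: measurable_rV_sub; first exact: measurable_snd.
exact: (measurableT_comp measurable_snd measurable_fst).
Qed.

Let mollifiedE t x : mollified (t, x) =
  mixture nu kernel (fun p : TV * V => f (t - p.1.1, p.2 - p.1.2)) x.
Proof. by []. Qed.

Let mfz t : measurable_fun setT (fun x => f (t, x)).
Proof. exact: (measurableT_comp mf (measurable_pair1 t)). Qed.

Let supp_kernel z : kernel z != 0 -> `[- eps, eps]%classic z.1 /\ eball 0 eps z.2.
Proof.
by rewrite /kernel mulf_eq0 negb_or => /andP[/theta_supp ? /psi_supp].
Qed.

(** Coordinates are bounded one by one and recombined by [enorm_lt], whence the factor [n.+1]. It is
    harmless, since the radius enters only through local L^1 bounds of [f]. *)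
Let eball_sub (c y : V) (r e : R) : 0 < r -> enorm y <= e ->
  eball (c - y) r `<=` eball 0 (n.+1%:R * (r + e + enorm c)).
Proof.
move=> r0 ye x xcy; rewrite /eball /= subr0; apply: enorm_lt.
  by rewrite ltr_wpDr ?sqrtr_ge0// ltr_wpDr// (le_trans _ ye)// sqrtr_ge0.
move=> i; have := le_lt_trans (ler_coord_enorm (x - (c - y)) i) xcy.
have := le_trans (ler_coord_enorm y i) ye; have := ler_coord_enorm c i; rewrite !mxE.
rewrite !ler_norml ltr_norml => /andP[? ?] /andP[? ?] /andP[? ?].
by apply/andP; split; lra.
Qed.

Let mabsf t : measurable_fun setT (fun x => `|f (t, x)|%:E).
Proof.
by apply/measurable_EFinP; apply: measurableT_comp => //; exact: mfz.
Qed.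

Let integral_translated_le (c y : V) (r e C : R) t : 0 < r -> enorm y <= e ->
  (\int[borel_rV n]_(x in eball 0 (n.+1%:R * (r + e + enorm c))) `|f (t, x)|%:E <= C%:E)%E ->
  (\int[borel_rV n]_(x in eball c r) `|f (t, x - y)|%:E <= C%:E)%E.
Proof.
move=> r0 ye fC; rewrite (integral_eball_translate c y r (mabsf t)).
apply: le_trans fC; apply: ge0_subset_integral => //; try exact: measurable_eball.
  exact: measurable_funTS.
exact: eball_sub.
Qed.

(** The ball for [f] depends on [e] instead of [eps], so that one constant serves for all small
    [eps]. *)
Lemma mollified_L1_le (r e C : R) : 0 < r -> eps <= e ->
  (forall t, (\int[borel_rV n]_(x in eball 0 (n.+1%:R * (r + e))) `|f (t, x)|%:E <= C%:E)%E) ->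
  forall t, (\int[borel_rV n]_(x in eball 0 r) `|mollified (t, x)|%:E <= C%:E)%E.
Proof.
move=> r0 ee fC t; have C0 : (0 <= C%:E)%E by apply: le_trans (fC 0); exact: integral_ge0.
have mB := measurable_eball (0 : V) r.
under eq_integral do rewrite mollifiedE.
apply: (mixture_L1_le measurable_kernel kernel_ge0 integral_kernel (mFt t) mB C0) => z /supp_kernel[_ zB] /=.
apply: (integral_translated_le (e := e)) => //.
  by move: zB; rewrite /eball /= subr0 => /ltW /le_trans; apply.
by rewrite (_ : enorm 0 = 0) ?addr0// /enorm big1 ?sqrtr0// => i _; rewrite mxE expr0n.
Qed.

(** [psi] is bounded by [A] and supported in a ball, so the local L^1 bounds of [f] control this
    integral uniformly in time. The mollification therefore converges absolutely at every point, not
    merely almost everywhere. *)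
Let inner_integral_lty (x : V) : exists2 C, 0 <= C & forall t,
  (\int[borel_rV n]_y `|psi y * f (t, x - y)|%:E <= C%:E)%E.
Proof.
have [C C0 fC] := f_L1 (n.+1%:R * (eps + eps + enorm x)).
have A0 : 0 <= A by apply: le_trans (psiA 0).
exists (A * C); first exact: mulr_ge0.
move=> t; set r := (n.+1%:R * _) in fC.
pose G u := (A%:E * (`|f (t, u)|%:E * (\1_(eball 0 r) u)%:E))%E.
have mI : measurable_fun setT (fun u => (\1_(eball (0 : V) r) u : R)%:E).
  by apply/measurable_EFinP; apply: measurable_indic; exact: measurable_eball.
have mG : measurable_fun setT G.
  by apply: measurable_funeM; exact: emeasurable_funM.
have G0 u : (0 <= G u)%E by rewrite /G !mule_ge0 ?lee_fin.
apply: (@le_trans _ _ (\int[borel_rV n]_y G (x - y)%R)%E).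
  have mxy : measurable_fun setT (fun y : V => x - y) by exact: measurable_rV_sub.
  apply: ge0_le_integral => //.
  - apply/measurable_EFinP; apply: measurableT_comp => //; apply: measurable_funM => //.
    exact: (measurableT_comp (mfz t) mxy).
  - exact: (measurableT_comp mG mxy).
  - move=> y _; have [->|/psi_supp yB] := eqVneq (psi y) 0; first by rewrite mul0r normr0.
    have yr : eball 0 r (x - y).
      apply: (@eball_sub x y eps eps) => //.
        by move: yB; rewrite /eball /= subr0 => /ltW.
      rewrite /eball /= subrr (_ : enorm 0 = 0)// /enorm big1 ?sqrtr0// => i _.
      by rewrite mxE expr0n.
    rewrite /G indicE mem_set// mule1 -EFinM lee_fin normrM ler_wpM2r//.
    by rewrite ger0_norm.
rewrite (ge0_integral_rV_reflect x mG G0) ge0_integralZl//; last exact: emeasurable_funM.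
rewrite EFinM lee_wpmul2l ?lee_fin//.
by apply: le_trans (fC t); rewrite [leRHS]integral_mkcond epatch_indic.
Qed.

Lemma integrable_kernel (w : TV) :
  nu.-integrable setT (fun z => (kernel z * f (w.1 - z.1, w.2 - z.2))%:E).
Proof.
case: w => t x /=; have [C C0 fC] := inner_integral_lty x.
have mkf : measurable_fun setT (fun z : TV => kernel z * f (t - z.1, x - z.2)).
  apply: measurable_funM; first exact: measurable_kernel.
  exact: (measurableT_comp (mFt t) (measurable_pair2 x)).
apply/integrableP; split; first exact/measurable_EFinP.
rewrite (fubini_tonelli1 (fun z => `|(kernel z * f (t - z.1, x - z.2))%:E|%E)); last 2 first.
- by apply: measurableT_comp => //; exact/measurable_EFinP.
- by move=> z; exact: abse_ge0.
apply: (@le_lt_trans _ _ (\int[lebesgue_measure]_s (C%:E * (theta s)%:E))%E); last first.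
  rewrite ge0_integralZl//; last by move=> s _; rewrite lee_fin.
  by rewrite itheta mule1 ltry.
apply: ge0_le_integral => //.
- by move=> s _; exact: integral_ge0.
- apply: (measurable_fun_fubini_tonelli_F (fun z => `|(kernel z * f (t - z.1, x - z.2))%:E|%E)) => //.
  by apply: measurableT_comp => //; exact/measurable_EFinP.
- by apply: measurable_funeM; exact: mEtheta.
- move=> s _; rewrite /fubini_F /= muleC.
  have mg : measurable_fun setT (fun y => `|psi y * f (t - s, x - y)|%:E).
    apply/measurable_EFinP; apply: measurableT_comp => //; apply: measurable_funM => //.
    exact: (measurableT_comp (mfz (t - s)) (measurable_rV_sub (measurable_cst x) (@measurable_id _ _ _))).
  rewrite (eq_integral (fun y => ((theta s)%:E * `|psi y * f (t - s, x - y)|%:E))%E); last first.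
    by move=> y _; rewrite /kernel /= -mulrA normrM (ger0_norm (theta0 s)) EFinM.
  by rewrite ge0_integralZl ?lee_fin// lee_wpmul2l ?lee_fin.
Qed.

Lemma mollified_iterated t x : mollified (t, x) =
  \int[lebesgue_measure]_s \int[borel_rV n]_y (psi y * theta s * f (t - s, x - y)).
Proof.
have mkf : measurable_fun setT (fun z : TV => kernel z * f (t - z.1, x - z.2)).
  apply: measurable_funM; first exact: measurable_kernel.
  exact: (measurableT_comp (mFt t) (measurable_pair2 x)).
have ik := integrable_kernel (t, x).
rewrite /mollified /Rintegral; congr fine.
rewrite -(integral12_prod_meas1 ik); apply: eq_integral => s _; rewrite /fubini_F /=.
rewrite fineK; first by apply: eq_integral => y _; rewrite /kernel /= [theta s * _]mulrC.
have [C C0 fC] := inner_integral_lty x.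
apply: integrable_fin_num => //.
have : (borel_rV n).-integrable setT (fun y => ((theta s)%:E * (psi y * f (t - s, x - y))%:E)%E).
  apply: integrableZl => //; apply/integrableP; split.
    apply/measurable_EFinP; apply: measurable_funM => //.
    exact: (measurableT_comp (mfz (t - s)) (measurable_rV_sub (measurable_cst x) (@measurable_id _ _ _))).
  by apply: le_lt_trans (fC (t - s)) _; rewrite ltry.
by apply: eq_integrable => // y _; rewrite -EFinM mulrA [theta s * _]mulrC.
Qed.

Let integrable_kernel_cst (a : R) : nu.-integrable setT (fun z => (kernel z * a)%:E).
Proof.
have ik : nu.-integrable setT (fun z => (kernel z)%:E).
  apply/integrableP; split; first by apply/measurable_EFinP; exact: measurable_kernel.
  under eq_integral do rewrite gee0_abs ?lee_fin ?kernel_ge0//.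
  by rewrite integral_kernel ltry.
by have := integrableZr measurableT a ik; apply: eq_integrable => // z _.
Qed.

Let Rintegral_kernel_cst (a : R) : \int[nu]_z (kernel z * a) = a.
Proof.
rewrite /Rintegral; under eq_integral do rewrite mulrC EFinM.
rewrite integralZl//; first by rewrite integral_kernel mule1.
by have := integrable_kernel_cst 1; apply: eq_integrable => // z _; rewrite mulr1.
Qed.

(** Since the kernel has mass one, [f w] is its own average against it, and the error is a mixture
    of the differences [f (w - z) - f w] over [z] in the support of the kernel. *)
Lemma mollified_L1_dist_le (K : set TV) (C : R) : measurable K -> 0 <= C ->
  (forall z : TV, `|z.1 : R| <= eps -> enorm z.2 <= eps ->
    (\int[nu]_(w in K) `|f ((w.1 : R) - z.1, w.2 - z.2) - f w|%:E <= C%:E)%E) ->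
  (\int[nu]_(w in K) `|mollified w - f w|%:E <= C%:E)%E.
Proof.
move=> mK C0 fC.
pose F (p : TV * TV) := f ((p.2.1 : R) - p.1.1, p.2.2 - p.1.2) - f p.2.
have mF : measurable_fun setT F.
  by apply: measurable_funB; [exact: measurable_shifted|exact: (measurableT_comp mf measurable_snd)].
have E w : mollified w - f w = mixture nu kernel F w.
  rewrite /mixture /F; under eq_Rintegral do rewrite mulrBr.
  rewrite RintegralB//; last 2 first.
  - exact: (integrable_kernel w).
  - exact: (integrable_kernel_cst (f w)).
  by rewrite -{1}(Rintegral_kernel_cst (f w)).
under eq_integral do rewrite E.
apply: (mixture_L1_le measurable_kernel kernel_ge0 integral_kernel mF mK) => //.
move=> z /supp_kernel[zI zB] /=; apply: fC.
  by move: zI; rewrite /= in_itv/= ler_norml.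
by move: zB; rewrite /eball /= subr0 => /ltW.
Qed.

Hypothesis f_osc : forall t c r, 0 < r ->
  (\int[borel_rV n]_(x in eball c r) `|f (t, x) - (fine (borel_rV n (eball c r)))^-1 *
      \int[borel_rV n]_(x in eball c r) f (t, x)|%:E <=
   (M * fine (borel_rV n (eball c r)))%:E)%E.

Let borel_rV_eball_translate (c y : V) r :
  borel_rV n (eball (c - y) r) = borel_rV n (eball c r).
Proof.
have mc : measurable_fun setT (cst 1%:E : V -> \bar R) by [].
have := integral_eball_translate c y r mc.
by rewrite !integral_cst ?mul1e//; exact: measurable_eball.
Qed.

Lemma mollified_oscillation_le t c r : 0 < r ->
  (\int[borel_rV n]_(x in eball c r) `|mollified (t, x) - (fine (borel_rV n (eball c r)))^-1 *
      \int[borel_rV n]_(x in eball c r) mollified (t, x)|%:E <=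
   (M * fine (borel_rV n (eball c r)))%:E)%E.
Proof.
move=> r0; have mB := measurable_eball c r.
have [C C0 fC] := f_L1 (n.+1%:R * (r + eps + enorm c)).
under eq_integral do rewrite mollifiedE.
apply: (mixture_oscillation_le measurable_kernel kernel_ge0 integral_kernel (mFt t) mB C0).
- by rewrite mulr_ge0// fine_ge0.
- by move=> x _; exact: (integrable_kernel (t, x)).
- move=> z /supp_kernel[_ zB] /=.
  apply: (integral_translated_le (e := eps)) => //.
  by move: zB; rewrite /eball /= subr0 => /ltW.
- move=> z _ /=; set v := (fine _)^-1.
  have mft : measurable_fun setT (fun x => (f (t - z.1, x))%:E).
    by apply/measurable_EFinP; exact: mfz.
  have -> : \int[borel_rV n]_(x in eball c r) f (t - z.1, x - z.2) =
      \int[borel_rV n]_(x in eball (c - z.2) r) f (t - z.1, x).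
    by rewrite /Rintegral (integral_eball_translate c z.2 r mft).
  pose a := v * \int[borel_rV n]_(x in eball (c - z.2) r) f (t - z.1, x).
  have mfa : measurable_fun setT (fun x => `|f (t - z.1, x) - a|%:E).
    apply/measurable_EFinP; apply: measurableT_comp => //.
    by apply: measurable_funB; [exact: mfz|exact: measurable_cst].
  rewrite (integral_eball_translate c z.2 r mfa) /a /v.
  by rewrite -(borel_rV_eball_translate c z.2); exact: f_osc.
Qed.

End mollification.

End time_space.

(** * Convergence in L^p *)

(** Three ranges: for [u <= 1] the power is at most [u]; for [1 < u <= L] it is at most [L^m u];
    beyond [L] the exponential dominates with the small factor [e]. *)
Lemma powR_le_expR (R : realType) (p c e : R) : 1 <= p -> 0 < c -> 0 < e ->
  exists2 N, 0 <= N & forall u, 0 <= u -> u `^ p <= N * u + e * expR (c * u).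
Proof.
move=> p1 c0 e0; pose m := Num.bound p.
have pm : p <= m%:R by rewrite ltW// archi_boundP// (le_trans ler01).
have m0 : (0 < m)%N by rewrite -(ltr_nat R) (lt_le_trans _ pm)// (lt_le_trans ltr01).
(* One term of the exponential series: [(c u)^(m+1) / (m+1)! <= expR (c u)]. *)
pose a := m.+1`!%:R / c ^+ m.+1.
have a0 : 0 < a by rewrite divr_gt0 ?exprn_gt0// ltr0n fact_gt0.
have expa u : 0 <= u -> u ^+ m.+1 <= a * expR (c * u).
  move=> u0; rewrite /a mulrAC ler_pdivlMr ?exprn_gt0// -exprMn mulrC.
  have cu0 : 0 <= c * u by rewrite mulr_ge0// ltW.
  have := expR_ge1Dxn m cu0.
  rewrite -lerBrDl ler_pdivrMr ?ltr0n ?fact_gt0// => /le_trans; apply.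
  by rewrite mulrC ler_pM2l ?ltr0n ?fact_gt0// gerBl.
(* [L e = e + a] is at least [a], so the surplus power of [u > L] in [u^(m+1)] pays for replacing
   [a] by [e]. The summand 1 gives [1 <= L]. *)
pose L := 1 + a / e.
have L1 : 1 <= L by rewrite /L lerDl divr_ge0 ?ltW.
have L0 : 0 < L by exact: lt_le_trans L1.
exists (L ^+ m); first by rewrite exprn_ge0// ltW.
move=> u u0; have [u1|u1] := leP u 1.
  apply: (@le_trans _ _ u).
    have [->|un0] := eqVneq u 0; first by rewrite powR0// gt_eqF// (lt_le_trans ltr01).
    have up : 0 < u by rewrite lt_neqAle eq_sym un0 u0.
    rewrite /powR (negbTE un0) -[leRHS](lnK up) ler_expR.
    by have := ln_le0 u1; nra.
  by rewrite -[leLHS]addr0 lerD ?mulr_ge0 ?expR_ge0 ?(ltW e0)// ler_peMl// exprn_ege1.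
have um : u `^ p <= u ^+ m by rewrite -powR_mulrn// ler_powR// ltW.
apply: le_trans um _; have [uL|Lu] := leP u L.
  rewrite -[leLHS]addr0 lerD ?mulr_ge0 ?expR_ge0 ?(ltW e0)//.
  rewrite -(prednK m0) exprSr ler_wpM2r// (@le_trans _ _ (L ^+ m.-1))//.
    by apply: lerXn2r => //; rewrite nnegrE ltW.
  by rewrite prednK// ler_weXn2l// leq_pred.
rewrite -[leLHS]add0r lerD ?mulr_ge0 ?exprn_ge0 ?(ltW L0)//.
rewrite -(ler_pM2l L0); apply: (@le_trans _ _ (u ^+ m.+1)).
  by rewrite exprS ler_wpM2r ?exprn_ge0// ltW.
apply: le_trans (expa _ u0) _; rewrite mulrA ler_wpM2r ?expR_ge0//.
by rewrite /L mulrDl divfK ?gt_eqF// lerDr mul1r ltW.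
Qed.

(** The cube lies in the ball of radius [n.+1 l] about its corner, and that ball in a cube of side
    [2 n.+1 l]; the factor is the ratio of the volumes of the two cubes. *)
Lemma eball_osc_cube (R : realType) (n : nat) (g : 'rV[R]_n -> R) (M : R) :
  0 <= M -> measurable_fun setT g ->
  (forall c r, 0 < r -> exists a, (\int[borel_rV n]_(x in eball c r) `|g x - a|%:E <=
     (M * fine (borel_rV n (eball c r)))%:E)%E) ->
  forall q l, 0 < l -> exists a, (\int[borel_rV n]_(x in cube q l) `|g x - a|%:E <=
     ((2 * n.+1%:R) ^+ n * M * l ^+ n)%:E)%E.
Proof.
move=> M0 mg gM q l l0; have r0 : 0 < n.+1%:R * l by rewrite mulr_gt0.
have [a ga] := gM q _ r0; exists a.
apply: (@le_trans _ _ (\int[borel_rV n]_(x in eball q (n.+1%:R * l)) `|g x - a|%:E)%E).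
  apply: ge0_subset_integral => //.
  - exact: measurable_cube.
  - exact: measurable_eball.
  - exact: measurable_dist_cst.
  - exact: cube_eball.
apply: le_trans ga _; rewrite lee_fin [leRHS](_ : _ = M * (2 * (n.+1%:R * l)) ^+ n).
  rewrite ler_wpM2l// -lee_fin fineK; last by rewrite ge0_fin_numE// eball_lty.
  rewrite -(borel_rV_cube (\row_i (q ord0 i - n.+1%:R * l))); last by rewrite mulr_ge0// ltW.
  by apply: le_measure; rewrite ?inE; [exact: measurable_eball|exact: measurable_cube|exact: eball_cube].
by rewrite mulrA [in RHS]exprMn; ring.
Qed.

Section box.
Context {R : realType} {n : nat}.
Local Notation V := 'rV[R]_n.
Local Notation TV := (measurableTypeR R * V)%type.
Local Notation nu := (@time_space_measure R n).

Definition centered_cube (N : R) : set V := cube (const_mx (- N)) (2 * N).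

Definition box (N : R) : set TV := `[- N, N]%classic `*` centered_cube N.

Lemma measurable_box N : measurable (box N).
Proof. by apply: measurableX; [exact: measurable_itv|exact: measurable_cube]. Qed.

Lemma box_lty N : (nu (box N) < +oo)%E.
Proof.
have -> : nu (box N) = (@lebesgue_measure R \x borel_rV n)%E (`[- N, N]%classic `*` centered_cube N) by [].
rewrite product_measure1E//; last exact: measurable_cube.
rewrite lte_mul_pinfty//.
- rewrite ge0_fin_numE// [ltLHS](_ : _ = lebesgue_measure (`[- N, N]%classic : set R))//.
  by rewrite lebesgue_measure_itv/=; case: ifP => _; rewrite ?ltry// -EFinB ltry.
- have [N0|N0] := leP 0 N; first by rewrite borel_rV_cube ?ltry// mulr_ge0.
  apply: (@le_lt_trans _ _ (borel_rV n (cube (const_mx (- N) : V) 0))).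
    apply: le_measure; rewrite ?inE; try exact: measurable_cube.
    by move=> x xN i; have /andP[? ?] := xN i; apply/andP; split => //; lra.
  by rewrite borel_rV_cube// ltry.
Qed.

Lemma box_integral_le N C (h : TV -> \bar R) : 0 <= N -> (0 <= C)%R ->
  measurable_fun setT h -> (forall w, 0 <= h w)%E ->
  (forall t, \int[borel_rV n]_(x in centered_cube N) h (t, x) <= C%:E)%E ->
  (\int[nu]_(w in box N) h w <= (2 * N * C)%:E)%E.
Proof.
move=> N0 C0 mh h0 hC.
pose I (s : measurableTypeR R) : \bar R := (\1_(`[- N, N]%classic : set R) s)%:E.
pose J (x : V) : \bar R := (\1_(centered_cube N) x)%:E.
have mI : measurable_fun setT I.
  by apply/measurable_EFinP; apply: measurable_indic; exact: measurable_itv.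
have mJ : measurable_fun setT J.
  by apply/measurable_EFinP; apply: measurable_indic; exact: measurable_cube.
have I0 s : (0 <= I s)%E by rewrite lee_fin.
have J0 s : (0 <= J s)%E by rewrite lee_fin.
have mIhJ : measurable_fun setT (fun w : TV => I w.1 * (h w * J w.2))%E.
  apply: emeasurable_funM; first exact: (measurableT_comp mI measurable_fst).
  by apply: emeasurable_funM => //; exact: (measurableT_comp mJ measurable_snd).
have IhJ0 w : (0 <= I w.1 * (h w * J w.2))%E by rewrite !mule_ge0.
rewrite integral_mkcond epatch_indic.
rewrite (eq_integral (fun w : TV => I w.1 * (h w * J w.2))%E); last first.
  move=> [t x] _ /=; rewrite /I /J !indicE in_setX muleCA; congr (_ * _)%E.
  by case: (t \in _); case: (x \in _); rewrite /= ?mule0 ?mule1 ?mul0e.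
rewrite (fubini_tonelli1 _ mIhJ IhJ0).
apply: (@le_trans _ _ (\int[lebesgue_measure]_t (C%:E * I t))%E).
  apply: ge0_le_integral => //.
  - by move=> t _; exact: integral_ge0.
  - exact: (measurable_fun_fubini_tonelli_F _ mIhJ IhJ0).
  - exact: measurable_funeM.
  - move=> t _; rewrite /fubini_F /= muleC.
    have mht : measurable_fun setT (fun x => h (t, x) * J x)%E.
      by apply: emeasurable_funM => //; exact: (measurableT_comp mh (measurable_pair1 t)).
    have hJ0 x : (0 <= h (t, x) * J x)%E by rewrite mule_ge0.
    rewrite (ge0_integralZl (borel_rV n) measurableT mht (fun x _ => hJ0 x) (I0 t)).
    rewrite lee_wpmul2l//; apply: le_trans (hC t).
    by rewrite [leRHS]integral_mkcond epatch_indic.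
rewrite (ge0_integralZl _ measurableT mI (fun s _ => I0 s)) ?lee_fin//.
rewrite integral_indic//.
rewrite setIT [X in (_ * X)%E](_ : _ = lebesgue_measure (`[- N, N]%classic : set R))//.
rewrite lebesgue_measure_itv/= -EFinB.
case: ifP => _; last by rewrite mule0 lee_fin mulr_ge0// mulr_ge0.
by rewrite -EFinM lee_fin opprK mulrC ler_wpM2r//; lra.
Qed.

(** On each time slice John-Nirenberg controls only [u] minus its average over the cube. The L^1
    bound [C] controls that average by [C / (2 N)^n], which accounts for the extra exponential
    factor. *)
Lemma box_exp_integral_le (M N C : R) (u : TV -> R) : 0 < M -> 0 < N -> 0 <= C ->
  measurable_fun setT u ->
  (forall t q l, 0 < l -> exists a,
    (\int[borel_rV n]_(x in cube q l) `|u (t, x) - a|%:E <= (M * l ^+ n)%:E)%E) ->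
  (forall t, \int[borel_rV n]_(x in centered_cube N) `|u (t, x)|%:E <= C%:E)%E ->
  (\int[nu]_(w in box N) (expR (john_nirenberg_const n M * `|u w|))%:E <=
   (2 * N * (expR (john_nirenberg_const n M * (C / (2 * N) ^+ n)) * (6 * (2 * N) ^+ n)))%:E)%E.
Proof.
move=> M0 N0 C0 mu_ uM uC; set c := john_nirenberg_const n M.
have c0 : 0 < c by exact: john_nirenberg_const_gt0.
have l0 : 0 < 2 * N by rewrite mulr_gt0.
have ln0 : 0 < (2 * N) ^+ n by rewrite exprn_gt0.
apply: box_integral_le.
- exact: ltW.
- by rewrite mulr_ge0 ?expR_ge0// mulr_ge0// ltW.
- apply/measurable_EFinP; apply: measurableT_comp => //; apply: measurable_funM => //.
  exact: measurableT_comp.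
- by move=> w; rewrite lee_fin expR_ge0.
move=> t; pose g x := u (t, x).
have mg : measurable_fun setT g by exact: (measurableT_comp mu_ (measurable_pair1 t)).
have ig := cube_integrable mg (uM t).
set q : V := const_mx (- N); pose avg := cube_avg g q (2 * N).
have avgC : `|avg| <= C / (2 * N) ^+ n.
  rewrite ler_pdivlMr// mulrC -lee_fin; apply: le_trans (uC t).
  have := le_cube_avg_dist ig q 0 l0; rewrite subr0.
  by under eq_integral do rewrite subr0.
have me (v : V -> R) : measurable_fun setT v ->
    measurable_fun setT (fun x => (expR (c * `|v x|))%:E).
  move=> mv; apply/measurable_EFinP; apply: measurableT_comp => //.
  by apply: measurable_funM => //; exact: measurableT_comp.
have mea : measurable_fun setT (fun x => (expR (c * `|g x - avg|))%:E).
  by apply: (me (fun x => g x - avg)); exact: measurable_funB.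
apply: (@le_trans _ _ (\int[borel_rV n]_(x in cube q (2 * N))
    ((expR (c * (C / (2 * N) ^+ n)))%:E * (expR (c * `|g x - avg|))%:E))%E).
  apply: ge0_le_integral => //.
  - exact: measurable_cube.
  - by apply: measurable_funTS; exact: me.
  - by apply: measurable_funeM; exact: measurable_funTS.
  - move=> x xq; rewrite -EFinM lee_fin -expRD ler_expR -mulrDr ler_wpM2l ?(ltW c0)//.
    rewrite -[u _](subrK avg) addrC (le_trans (ler_normD _ _))// lerD2r//.
have e0 (v : R) : (0 <= (expR v)%:E)%E by rewrite lee_fin expR_ge0.
rewrite (ge0_integralZl _ (measurable_cube _ _) (measurable_funTS mea) (fun x _ => e0 _) (e0 _)).
rewrite EFinM lee_wpmul2l//.
by apply: john_nirenberg_cube => //; exact: uM.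
Qed.

End box.

Section translation.
Context {R : realType} {n : nat}.
Local Notation V := 'rV[R]_n.
Local Notation TV := (measurableTypeR R * V)%type.
Local Notation nu := (@time_space_measure R n).

Lemma ge0_integral_time_space_translate (z : TV) (h : TV -> \bar R) :
  measurable_fun setT h -> (forall w, 0 <= h w)%E ->
  (\int[nu]_w h ((w.1 : R) - z.1, w.2 - z.2)%R = \int[nu]_w h w)%E.
Proof.
case: z => s y mh h0 /=.
have mtr : measurable_fun setT (fun w : TV => ((w.1 : R) - s, w.2 - y) : TV).
  apply: measurable_fun_time_space; first exact: measurable_funB measurable_time _.
  by apply: measurable_rV_sub => //; exact: measurable_snd.
have mhtr := measurableT_comp mh mtr.
rewrite (fubini_tonelli1 (fun w : TV => h ((w.1 : R) - s, w.2 - y)) mhtr (fun=> h0 _)).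
rewrite (fubini_tonelli1 _ mh h0).
have mF : measurable_fun setT (fubini_F (borel_rV n) h).
  apply/measurable_fun_measurableTypeR; exact: (measurable_fun_fubini_tonelli_F _ mh h0).
have F0 t : (0 <= fubini_F (borel_rV n) h t)%E by exact: integral_ge0.
rewrite -(ge0_integral_lebesgue_affine (- s) (oner_neq0 R) mF F0) normr1 mul1e.
apply: eq_integral => t _; rewrite /fubini_F /= mul1r.
apply: (ge0_integral_rV_translate y (f := fun x => h (t - s, x))) => //.
exact: (measurableT_comp mh (measurable_pair1 (t - s))).
Qed.

(** A continuous [g] close to [f] in L^1 leaves three errors of size [e / 3]: the approximation, its
    translate, and the uniform continuity of [g]. The larger box contains the translates of the
    smaller one. *)
Lemma translation_continuous_L1 (f : TV -> R) (N e : R) :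
  measurable_fun setT f -> 0 < N -> 0 < e ->
  nu.-integrable (box (N + 1)) (EFin \o f) ->
  exists2 d, 0 < d & forall z : TV, `|z.1 : R| <= d -> enorm z.2 <= d ->
    (\int[nu]_(w in box N) `|f ((w.1 : R) - z.1, w.2 - z.2) - f w|%:E <= e%:E)%E.
Proof.
move=> mf N0 e0 intf; have e30 : 0 < e / 3 by rewrite divr_gt0.
have [g cg fg] := continuous_dense_L1_time_rV (measurable_box _) (box_lty _) mf intf e30.
have mg : measurable_fun [set: TV] g.
  by move=> mT Y mY; exact: (continuous_measurable_time_rV cg).
have mB := @measurable_box R n N.
have boxfin : nu (box N) \is a fin_num by rewrite ge0_fin_numE// box_lty.
pose v := fine (nu (box N)).
have v0 : 0 <= v by rewrite fine_ge0.
(* The uniform error [w0] times the volume [v] stays below [e / 3]; the summand 1 avoids a division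
   by zero. *)
pose w0 := e / 3 / (v + 1).
have v1 : 0 < v + 1 by lra.
have w0_gt0 : 0 < w0 by rewrite divr_gt0.
pose K : set (R * V) := `[- N, N]%classic `*`
  [set x : V | forall i, (`[- N, N]%classic : set R) (x ord0 i)].
have cK : compact K.
  apply: compact_setX; first exact: segment_compact.
  by apply: (@rV_compact R n (fun=> `[- N, N]%classic)) => i; exact: segment_compact.
have boxK : box N `<=` K.
  move=> [t x] [/= tN xN]; split => //= i; have := xN i; rewrite mxE => /andP[? ?].
  by rewrite in_itv/=; apply/andP; split; lra.
have [d d0 gd] := continuous_compact_uniform cg cK w0_gt0.
(* [d / 2] turns non-strict bounds into membership in the open ball of radius [d]; [1 / 2] keeps the
   translates of [box N] inside [box (N + 1)]. *)
pose d1 := Num.min (d / 2) (1 / 2).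
have d10 : 0 < d1 by rewrite lt_min !divr_gt0.
exists d1 => // z; rewrite !le_min => /andP[z1d z1h] /andP[z2d z2h].
have z2i i : `|z.2 ord0 i| <= enorm z.2 by exact: ler_coord_enorm.
have mtr : measurable_fun setT (fun w : TV => ((w.1 : R) - z.1, w.2 - z.2) : TV).
  apply: measurable_fun_time_space; first exact: measurable_funB measurable_time _.
  by apply: measurable_rV_sub => //; exact: measurable_snd.
have mftr := measurableT_comp mf mtr; have mgtr := measurableT_comp mg mtr.
have mdist (a b : TV -> R) : measurable_fun setT a -> measurable_fun setT b ->
    measurable_fun setT (fun w => `|a w - b w|%:E).
  by move=> ma mb; apply/measurable_EFinP; apply: measurableT_comp => //; exact: measurable_funB.
pose tr (w : TV) : TV := ((w.1 : R) - z.1, w.2 - z.2).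
have m1 : measurable_fun setT (fun w => `|f (tr w) - g (tr w)|%:E) by exact: mdist.
have m2 : measurable_fun setT (fun w => `|g (tr w) - g w|%:E) by exact: mdist.
have m3 : measurable_fun setT (fun w => `|g w - f w|%:E) by exact: mdist.
apply: (@le_trans _ _ (\int[nu]_(w in box N)
   (`|f (tr w) - g (tr w)|%:E + (`|g (tr w) - g w|%:E + `|g w - f w|%:E)))%E).
  apply: ge0_le_integral => //.
  - by apply: measurable_funTS; exact: mdist.
  - apply: measurable_funTS; apply: emeasurable_funD => //; exact: emeasurable_funD.
  - move=> w _; rewrite -!EFinD lee_fin (le_trans (ler_distD (g (tr w)) _ _))//.
    by rewrite lerD2l ler_distD.
have m23 := emeasurable_funD m2 m3.
have mS (a : TV -> \bar R) : measurable_fun setT a -> measurable_fun (box N) a.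
  exact: measurable_funTS.
rewrite (ge0_integralD nu mB _ (mS _ m1) _ (mS _ m23)) ?(ge0_integralD nu mB _ (mS _ m2) _ (mS _ m3))//;
  try by (move=> w _; rewrite ?adde_ge0).
have -> : e%:E = ((e / 3)%:E + ((e / 3)%:E + (e / 3)%:E))%E.
  by rewrite -!EFinD; congr EFin; lra.
have mB1 := @measurable_box R n (N + 1).
apply: leeD; [|apply: leeD].
- apply: le_trans fg.
  pose h (w : TV) := (`|f w - g w|%:E * (\1_(box (N + 1)) w)%:E)%E.
  have mh : measurable_fun setT h.
    by apply: emeasurable_funM; [exact: mdist|apply/measurable_EFinP; exact: measurable_indic].
  have h0 w : (0 <= h w)%E by rewrite mule_ge0 ?lee_fin.
  rewrite [leRHS]integral_mkcond epatch_indic -[leRHS](ge0_integral_time_space_translate z mh h0).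
  apply: (@le_trans _ _ (\int[nu]_(w in box N) h (tr w))%E); last first.
    by apply: ge0_subset_integral => //; exact: (measurableT_comp mh mtr).
  apply: ge0_le_integral => //.
  + exact: measurable_funTS.
  + by apply: measurable_funTS; exact: (measurableT_comp mh mtr).
  + move=> [t x] [/= tN xN]; rewrite /h indicE mem_set ?mule1//.
    split => /= [|i].
      by move: tN z1h; rewrite !in_itv/= ler_norml => /andP[? ?] /andP[? ?]; apply/andP; split; lra.
    have := xN i; have := le_trans (z2i i) z2h; rewrite !mxE ler_norml => /andP[? ?] /andP[? ?].
    by apply/andP; split; lra.
- apply: (@le_trans _ _ (\int[nu]_(w in box N) (cst w0%:E w))%E).
    apply: ge0_le_integral => //; first exact: measurable_funTS.
    move=> w /boxK wK; rewrite lee_fin distrC; apply: gd => //.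
    split => /=.
      rewrite /ball/= (_ : _ - _ = z.1 :> R); last by rewrite opprB addrC subrK.
      by rewrite (le_lt_trans z1d)//; lra.
    split => // i' i; rewrite (ord1 i') /ball/= !mxE (_ : _ - _ = z.2 ord0 i); last first.
      by rewrite opprB addrC subrK.
    by rewrite (le_lt_trans (z2i i))// (le_lt_trans z2d)//; lra.
  rewrite integral_cst// [X in (_ * X)%E](_ : _ = v%:E); last by rewrite fineK.
  rewrite -EFinM lee_fin /w0 mulrAC ler_pdivrMr// ler_pM2l//; lra.
- apply: (@le_trans _ _ (\int[nu]_(w in box (N + 1)) `|g w - f w|%:E)%E).
    apply: ge0_subset_integral => //; first exact: measurable_funTS.
    move=> [t x] [/= tN xN]; split => /= [|i].
      by move: tN; rewrite !in_itv/= => /andP[? ?]; apply/andP; split; lra.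
    by have := xN i; rewrite !mxE => /andP[? ?]; apply/andP; split; lra.
  by under eq_integral do rewrite distrC.
Qed.

End translation.

Section Lp_estimates.
Context {R : realType} {n : nat}.
Local Notation V := 'rV[R]_n.
Local Notation TV := (measurableTypeR R * V)%type.
Local Notation nu := (@time_space_measure R n).

(** The constant [a] is left free instead of being the mean, so that a difference of functions is
    handled by the difference of their constants. *)
Definition bounded_oscillation (M : R) (u : TV -> R) := forall t c r, 0 < r ->
  exists a, (\int[borel_rV n]_(x in eball c r) `|u (t, x) - a|%:E <=
    (M * fine (borel_rV n (eball c r)))%:E)%E.

Lemma bounded_oscillation_sub M1 M2 (u1 u2 : TV -> R) :
  measurable_fun setT u1 -> measurable_fun setT u2 ->
  bounded_oscillation M1 u1 -> bounded_oscillation M2 u2 ->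
  bounded_oscillation (M1 + M2) (fun w => u1 w - u2 w).
Proof.
move=> mu1 mu2 u1M u2M t c r r0.
have [a1 ua1] := u1M t c r r0; have [a2 ua2] := u2M t c r r0; exists (a1 - a2).
have mB := measurable_eball c r.
have m1 (u : TV -> R) a : measurable_fun setT u ->
    measurable_fun (eball c r) (fun x => `|u (t, x) - a|%:E).
  move=> mu; apply: measurable_funTS; apply: measurable_dist_cst.
  exact: (measurableT_comp mu (measurable_pair1 t)).
rewrite mulrDl EFinD; apply: le_trans (leeD ua1 ua2).
rewrite -(ge0_integralD (borel_rV n) mB _ (m1 _ a1 mu1) _ (m1 _ a2 mu2)) => [|x _//|x _//].
apply: ge0_le_integral => //.
- by apply: (m1 (fun w => u1 w - u2 w)); exact: measurable_funB.
- by apply: emeasurable_funD; exact: m1.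
- move=> x _; rewrite -EFinD lee_fin.
  have -> : u1 (t, x) - u2 (t, x) - (a1 - a2) = (u1 (t, x) - a1) - (u2 (t, x) - a2) by ring.
  exact: ler_normB.
Qed.

(* [Q] does not depend on [u]: smallness in L^1 gives smallness in L^p. *)
Lemma powR_integral_le (p M N C e : R) : 1 <= p -> 0 < M -> 0 < N -> 0 <= C -> 0 < e ->
  exists2 Q, 0 <= Q & forall u : TV -> R, measurable_fun setT u ->
    bounded_oscillation M u ->
    (forall t, \int[borel_rV n]_(x in centered_cube N) `|u (t, x)|%:E <= C%:E)%E ->
    (\int[nu]_(w in box N) (`|u w| `^ p)%:E <=
     Q%:E * \int[nu]_(w in box N) `|u w|%:E + e%:E)%E.
Proof.
move=> p1 M0 N0 C0 e0; pose M' := (2 * n.+1%:R) ^+ n * M.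
have M'0 : 0 < M' by rewrite mulr_gt0// exprn_gt0// mulr_gt0.
pose c := john_nirenberg_const n M'.
have c0 : 0 < c by exact: john_nirenberg_const_gt0.
pose E := 2 * N * (expR (c * (C / (2 * N) ^+ n)) * (6 * (2 * N) ^+ n)).
have E0 : 0 <= E.
  by rewrite !mulr_ge0 ?expR_ge0 ?exprn_ge0 ?mulr_ge0// ltW.
have e'0 : 0 < e / (E + 1) by rewrite divr_gt0//; lra.
have [Q Q0 Qp] := powR_le_expR p1 c0 e'0; exists Q => // u mu uM uC.
have mB := @measurable_box R n N.
have mabs : measurable_fun setT (fun w => `|u w|) by exact: measurableT_comp.
have mexp : measurable_fun setT (fun w => (expR (c * `|u w|))%:E).
  apply/measurable_EFinP; apply: measurableT_comp => //; exact: measurable_funM.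
have mEabs : measurable_fun setT (fun w => `|u w|%:E) by exact/measurable_EFinP.
have ex0 (x : R) : (0 <= (expR x)%:E)%E by rewrite lee_fin expR_ge0.
have mS (h : TV -> \bar R) : measurable_fun setT h -> measurable_fun (box N) h.
  exact: measurable_funTS.
have mQ : measurable_fun (box N) (fun w => Q%:E * `|u w|%:E)%E.
  by apply: measurable_funeM; exact: mS.
have me : measurable_fun (box N) (fun w => (e / (E + 1))%:E * (expR (c * `|u w|))%:E)%E.
  by apply: measurable_funeM; exact: mS.
apply: (@le_trans _ _ (\int[nu]_(w in box N)
    (Q%:E * `|u w|%:E + (e / (E + 1))%:E * (expR (c * `|u w|))%:E))%E).
  apply: ge0_le_integral => //.
  - apply: mS; apply/measurable_EFinP.
    exact: (measurableT_comp (measurable_powR p) mabs).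
  - exact: emeasurable_funD.
  - by move=> w _; rewrite -!EFinM -EFinD lee_fin Qp.
rewrite (ge0_integralD nu mB _ mQ _ me) => [|w _|w _]; last 2 first.
- by rewrite mule_ge0.
- by rewrite mule_ge0// lee_fin ltW.
rewrite (ge0_integralZl nu mB (mS _ mEabs) (fun w _ => normr_ge0 (u w))); last by rewrite lee_fin.
rewrite leeD2l// (ge0_integralZl nu mB (mS _ mexp) (fun w _ => ex0 _)); last first.
  by rewrite lee_fin ltW.
apply: (@le_trans _ _ ((e / (E + 1))%:E * E%:E)%E).
  apply: lee_wpmul2l; first by rewrite lee_fin ltW.
  apply: box_exp_integral_le => // t q l l0.
  apply: (@eball_osc_cube R n (fun x => u (t, x)) M) => //; first exact: ltW.
    exact: (measurableT_comp mu (measurable_pair1 t)).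
  by move=> x r r0; exact: uM.
rewrite -EFinM lee_fin mulrAC ler_pdivrMr; last by lra.
by rewrite ler_pM2l//; lra.
Qed.

Lemma powR_integral_lty (p M N C : R) (u : TV -> R) :
  1 <= p -> 0 < M -> 0 < N -> 0 <= C -> measurable_fun setT u ->
  bounded_oscillation M u ->
  (forall t, \int[borel_rV n]_(x in centered_cube N) `|u (t, x)|%:E <= C%:E)%E ->
  (\int[nu]_(w in box N) (`|u w| `^ p)%:E < +oo)%E.
Proof.
move=> p1 M0 N0 C0 mu uM uC.
have [Q Q0 /(_ u mu uM uC)] := powR_integral_le p1 M0 N0 C0 ltr01.
move/le_lt_trans; apply; apply: lte_add_pinfty; last by rewrite ltry.
apply: (@le_lt_trans _ _ (Q%:E * (2 * N * C)%:E)%E); last by rewrite -EFinM ltry.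
rewrite lee_wpmul2l//; apply: box_integral_le => //; first exact: ltW.
by apply/measurable_EFinP; exact: measurableT_comp.
Qed.

Lemma centered_cube_eball N : 0 < N -> centered_cube N `<=` eball (0 : V) (n.+1%:R * N).
Proof.
move=> N0 x xN; rewrite /eball /= subr0; apply: enorm_lt => // i.
by have := xN i; rewrite mxE ler_norml => /andP[? ?]; apply/andP; split; lra.
Qed.

(** [d] is chosen before the kernels: the error has oscillation at most [M + M] and slices at most
    [C + C] in L^1, and its smallness in L^1 depends only on the mass and the support of the
    kernel. *)
Lemma mollified_Lp_cvg (f : TV -> R) (p M N e : R) :
  1 <= p -> 0 < M -> 0 < N -> 0 < e -> measurable_fun setT f ->
  (forall r, exists2 C, 0 <= C &
    forall t, (\int[borel_rV n]_(x in eball 0 r) `|f (t, x)|%:E <= C%:E)%E) ->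
  bounded_oscillation M f ->
  exists2 d : R, 0 < d & forall (psi : V -> R) (theta : R -> R) (eps A : R),
    measurable_fun setT psi -> measurable_fun setT theta ->
    (forall y : V, 0 <= psi y) -> (forall s, 0 <= theta s) ->
    (forall y, psi y <= A) ->
    (forall y, psi y != 0 -> eball 0 eps y) ->
    (forall s, theta s != 0 -> `[- eps, eps]%classic s) ->
    (\int[borel_rV n]_y (psi y)%:E = 1)%E ->
    (\int[lebesgue_measure]_s (theta s)%:E = 1)%E ->
    0 < eps -> eps <= d ->
    bounded_oscillation M (mollified psi theta f) ->
    (\int[nu]_(w in box N) (`|mollified psi theta f w - f w| `^ p)%:E <= e%:E)%E.
Proof.
move=> p1 M0 N0 e0 mf fL fM.
(* One radius for all uses: it covers the slices of [box (N + 1)], and the translates by at most 1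
   that enter the mollification on the ball of radius [n.+1 N]. *)
have [C C0 fC] := fL (n.+1%:R * (n.+1%:R * (N + 1) + 1)).
have mabsf t : measurable_fun setT (fun x => `|f (t, x)|%:E).
  apply/measurable_EFinP; apply: measurableT_comp => //.
  exact: (measurableT_comp mf (measurable_pair1 t)).
have fr t r : r <= n.+1%:R * (n.+1%:R * (N + 1) + 1) ->
    (\int[borel_rV n]_(x in eball 0 r) `|f (t, x)|%:E <= C%:E)%E.
  move=> rr; apply: le_trans (fC t); apply: ge0_subset_integral => //; try exact: measurable_eball.
    exact: measurable_funTS.
  by move=> x; rewrite /eball /= => /lt_le_trans; apply.
have n1 : 1 <= n.+1%:R :> R by rewrite ler1n.
have N1 : 0 < n.+1%:R * N by rewrite mulr_gt0.
have CC0 : 0 <= C + C by rewrite addr_ge0.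
have MM0 : 0 < M + M by rewrite addr_gt0.
have e20 : 0 < e / 2 by rewrite divr_gt0.
have [Q Q0 HQ] := powR_integral_le p1 MM0 N0 CC0 e20.
have e30 : 0 < e / 2 / (Q + 1) by rewrite divr_gt0//; lra.
have intf : nu.-integrable (box (N + 1)) (EFin \o f).
  apply/integrableP; split; first by apply: measurable_funTS; exact/measurable_EFinP.
  apply: (@le_lt_trans _ _ (2 * (N + 1) * C)%:E); last by rewrite ltry.
  apply: box_integral_le => //; first by lra.
    by apply/measurable_EFinP; exact: measurableT_comp.
  move=> t; apply: le_trans (fr t (n.+1%:R * (N + 1)) _); last by nra.
  apply: ge0_subset_integral => //.
  - exact: measurable_cube.
  - exact: measurable_eball.
  - apply: measurable_funTS; exact: mabsf.
  - by apply: centered_cube_eball; lra.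
have [d d0 fd] := translation_continuous_L1 mf N0 e30 intf.
exists (Num.min d 1); first by rewrite lt_min d0 ltr01.
move=> psi theta eps A mpsi mtheta psi0 theta0 psiA psis thetas ipsi itheta eps0.
rewrite le_min => /andP[epsd eps1] mollM.
have mm : measurable_fun setT (mollified psi theta f) by exact: measurable_mollified.
have mollC t : (\int[borel_rV n]_(x in eball 0 (n.+1%:R * N)) `|mollified psi theta f (t, x)|%:E <= C%:E)%E.
  apply: (mollified_L1_le mpsi mtheta psi0 theta0 psis thetas ipsi itheta mf N1 eps1) => {}t.
  by apply: fr; rewrite ler_wpM2l//; nra.
have hC t : (\int[borel_rV n]_(x in centered_cube N) `|mollified psi theta f (t, x) - f (t, x)|%:E <= (C + C)%:E)%E.
  have mcube := measurable_cube (const_mx (- N) : V) (2 * N).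
  have mmt : measurable_fun setT (fun x => `|mollified psi theta f (t, x)|%:E).
    apply/measurable_EFinP; apply: measurableT_comp => //.
    exact: (measurableT_comp mm (measurable_pair1 t)).
  apply: (@le_trans _ _ (\int[borel_rV n]_(x in eball 0 (n.+1%:R * N))
     (`|mollified psi theta f (t, x)|%:E + `|f (t, x)|%:E))%E); last first.
    rewrite (ge0_integralD (borel_rV n) (measurable_eball _ _) _ (measurable_funTS mmt) _
      (measurable_funTS (mabsf t))) => [|x _//|x _//].
    by rewrite EFinD leeD//; apply: fr; nra.
  have mh : measurable_fun setT (fun x => `|mollified psi theta f (t, x) - f (t, x)|%:E).
    apply/measurable_EFinP; apply: measurableT_comp => //.
    apply: measurable_funB; first exact: (measurableT_comp mm (measurable_pair1 t)).
    exact: (measurableT_comp mf (measurable_pair1 t)).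
  apply: (@le_trans _ _ (\int[borel_rV n]_(x in eball 0 (n.+1%:R * N))
     `|mollified psi theta f (t, x) - f (t, x)|%:E)%E).
    apply: ge0_subset_integral => //; first exact: measurable_eball.
      exact: measurable_funTS.
    exact: centered_cube_eball.
  apply: ge0_le_integral => //.
  - exact: measurable_eball.
  - exact: measurable_funTS.
  - by apply: measurable_funTS; exact: emeasurable_funD.
  - by move=> x _; rewrite -EFinD lee_fin ler_normB.
have := HQ (fun w => mollified psi theta f w - f w) (measurable_funB mm mf)
  (bounded_oscillation_sub mm mf mollM fM) hC.
move/le_trans; apply; rewrite [leRHS](_ : _ = (e / 2)%:E + (e / 2)%:E)%E; last first.
  by rewrite -EFinD; congr EFin; lra.
rewrite leeD2r//; apply: (@le_trans _ _ (Q%:E * (e / 2 / (Q + 1))%:E)%E).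
  rewrite lee_wpmul2l//.
  apply: (mollified_L1_dist_le mpsi mtheta psi0 theta0 psiA psis thetas ipsi itheta eps0 mf fL) => //.
  - exact: measurable_box.
  - exact: ltW.
  - by move=> z z1 z2; apply: fd; [exact: le_trans epsd|exact: le_trans epsd].
rewrite -EFinM lee_fin mulrCA; rewrite -[leRHS]mulr1 ler_pM2l// ler_pdivrMr; lra.
Qed.

End Lp_estimates.

(** * From Borel to Lebesgue measurable functions *)

Section complete_measure_preserving.
Context d1 d2 (T1 : measurableType d1) (T2 : measurableType d2) (R : realType).
Variables (m1 : {measure set T1 -> \bar R}) (m2 : {measure set T2 -> \bar R}).
Variable phi : T1 -> T2.
Hypothesis mphi : measurable_fun [set: T1] phi.
Hypothesis phiE : forall A, measurable A -> m1 (phi @^-1` A) = m2 A.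
Hypothesis m1c : measure_is_complete m1.

Lemma negligible_measure_preserving N : m2.-negligible N -> m1.-negligible (phi @^-1` N).
Proof.
move=> [A [mA A0 NA]]; exists (phi @^-1` A); split.
- by rewrite -[X in measurable X]setTI; exact: mphi.
- by rewrite phiE.
- by move=> x /NA.
Qed.

Lemma ae_eq_measure_preserving (D : set T2) (f : T2 -> \bar R) (g : T1 -> \bar R) :
  m1.-negligible [set x | g x != f (phi x)] ->
  ae_eq m1 (phi @^-1` D) (f \o phi) g.
Proof. by apply: negligibleS => x /= /not_implyP[_ /eqP]; rewrite eq_sym. Qed.

(** Applied with [phi] the identity from a completed sigma-algebra to the Borel one: completeness
    makes a function measurable as soon as it agrees almost everywhere with a Borel one. *)
Lemma complete_measurable_fun (D : set T2) (f : T2 -> \bar R) (g : T1 -> \bar R) :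
  measurable D -> measurable_fun D f ->
  m1.-negligible [set x | g x != f (phi x)] ->
  measurable_fun (phi @^-1` D) g.
Proof.
move=> mD mf /(ae_eq_measure_preserving D) /(ae_measurable_fun m1c); apply.
apply: (measurable_comp mD) => //; first by move=> _ [x Dx <-].
exact: measurable_funTS.
Qed.

Lemma complete_integral (D : set T2) (f : T2 -> \bar R) (g : T1 -> \bar R) :
  measurable D -> measurable_fun D f ->
  m1.-negligible [set x | g x != f (phi x)] ->
  (\int[m1]_(x in phi @^-1` D) g x = \int[m2]_(y in D) f y)%E.
Proof.
move=> mD mf gf; rewrite -(integral_measure_preserving mphi phiE mD mf).
apply: ae_eq_integral.
- by rewrite -[X in measurable X]setTI; exact: mphi.
- exact: complete_measurable_fun gf.
- apply: (measurable_comp mD) => //; first by move=> _ [x Dx <-].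
  exact: measurable_funTS.
- apply: ae_eq_sym; exact: (ae_eq_measure_preserving D gf).
Qed.

End complete_measure_preserving.

Section completed_integral_ae.
Context d (T : measurableType d) (R : realType).
Variable mu : {sigma_finite_measure set T -> \bar R}.
Local Notation cmu := (@completed_measure_extension _ _ R mu).
Local Notation cT := (caratheodory_type (mu^*)%mu).

Let measurable_completion_id : measurable_fun [set: cT] (idfun : cT -> T).
Proof. by move=> _ Y mY; rewrite setTI; exact: completed_measurable. Qed.

Lemma negligible_completed N : mu.-negligible N -> cmu.-negligible N.
Proof. exact: (negligible_measure_preserving measurable_completion_id (@completedE _ _ _ mu)). Qed.

Lemma completed_measurable_fun_ae (D : set T) (f g : T -> R) :
  measurable D -> measurable_fun D f -> mu.-negligible [set x | g x != f x] ->
  measurable_fun (D : set cT) g.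
Proof.
move=> mD mf gf; apply/measurable_EFinP.
apply: (@complete_measurable_fun _ _ cT T R cmu idfun measurable_completion_id
  (@completed_complete _ _ _ mu) D (EFin \o f) (EFin \o g) mD) => //.
  exact/measurable_EFinP.
exact: negligible_completed.
Qed.

Lemma completed_integral_ae (D : set T) (f g : T -> \bar R) :
  measurable D -> measurable_fun D f -> mu.-negligible [set x | g x != f x] ->
  (\int[cmu]_(x in D) g x = \int[mu]_(x in D) f x)%E.
Proof.
move=> mD mf gf.
apply: (@complete_integral _ _ cT T R cmu mu idfun measurable_completion_id
  (@completedE _ _ _ mu) (@completed_complete _ _ _ mu) D f g mD mf).
exact: negligible_completed.
Qed.

End completed_integral_ae.

Section completed_lebesgue.
Context {R : realType}.
Local Notation cR := (caratheodory_type ((wlength (R := R) idfun)^*)%mu).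

Let measurable_completion_id :
  measurable_fun [set: cR] (idfun : cR -> measurableTypeR R).
Proof. by move=> _ Y mY; rewrite setTI; exact: sub_caratheodory. Qed.

Lemma completed_lebesgue_integral_ae (D : set R) (f g : R -> \bar R) :
  measurable D -> measurable_fun D f ->
  (@lebesgue_measure R).-negligible [set x | g x != f x] ->
  (\int[completed_lebesgue_measure]_(x in D) g x = \int[lebesgue_measure]_(x in D) f x)%E.
Proof.
move=> mD mf gf.
apply: (@complete_integral _ _ cR (measurableTypeR R) R completed_lebesgue_measure
  lebesgue_measure idfun measurable_completion_id (fun _ _ => erefl)
  completed_lebesgue_measure_is_complete D f g mD).
  exact/measurable_fun_measurableTypeR.
exact: (@negligible_measure_preserving _ _ cR (measurableTypeR R) R completed_lebesgue_measure
  lebesgue_measure idfun measurable_completion_id (fun _ _ => erefl) _ gf).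
Qed.

End completed_lebesgue.

Section uniform_L1.
Context {R : realType} {n : nat}.
Local Notation V := 'rV[R]_n.
Local Notation TV := (measurableTypeR R * V)%type.

(** The zero mean over the unit ball pins down the constant [a] of a larger ball: [a] times the unit
    volume is minus the integral of [u - a] over the unit ball, hence is bounded by the oscillation,
    uniformly in time. *)
Lemma oscillation_uniform_L1 (M : R) (u : TV -> R) :
  0 <= M -> measurable_fun setT u -> bounded_oscillation M u ->
  (forall t, \int[borel_rV n]_(x in eball 0 1) u (t, x) = 0) ->
  forall r, exists2 C, 0 <= C &
    forall t, (\int[borel_rV n]_(x in eball 0 r) `|u (t, x)|%:E <= C%:E)%E.
Proof.
move=> M0 mu uM u0 r; pose rho := Num.max r 1.
have rho0 : 0 < rho by rewrite lt_max ltr01 orbT.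
pose v := fine (borel_rV n (eball 0 rho)); pose v1 := fine (borel_rV n (eball (0 : V) 1)).
have v0 : 0 <= v by rewrite fine_ge0.
have v10 : 0 < v1 by rewrite fine_gt0// eball_gt0//= eball_lty.
have B1rho : eball (0 : V) 1 `<=` eball 0 rho.
  by move=> x; rewrite /eball /= => /lt_le_trans; apply; rewrite le_max lexx orbT.
have Brrho : eball (0 : V) r `<=` eball 0 rho.
  by move=> x; rewrite /eball /= => /lt_le_trans; apply; rewrite le_max lexx.
have mE c s := @measurable_eball R n c s.
exists (M * v + M * v / v1 * v).
  by rewrite addr_ge0 ?mulr_ge0 ?invr_ge0// ltW.
move=> t; have [a ua] := uM t 0 rho rho0; rewrite -/v in ua.
have mut : measurable_fun setT (fun x => u (t, x)) by exact: (measurableT_comp mu (measurable_pair1 t)).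
have mua : measurable_fun setT (fun x => `|u (t, x) - a|%:E) by exact: measurable_dist_cst.
have ua1 : (\int[borel_rV n]_(x in eball 0 1) `|u (t, x) - a|%:E <= (M * v)%:E)%E.
  apply: le_trans ua; apply: ge0_subset_integral => //; exact: measurable_funTS.
have iua : (borel_rV n).-integrable (eball 0 1) (fun x => (u (t, x) - a)%:E).
  apply/integrableP; split; first by apply/measurable_EFinP; apply: measurable_funTS; exact: measurable_funB.
  by apply: le_lt_trans ua1 _; rewrite ltry.
have icst b : (borel_rV n).-integrable (eball (0 : V) 1) (fun=> b%:E).
  apply/integrableP; split; first exact: measurable_cst.
  rewrite integral_cst// [X in (_ * X)%E](_ : _ = v1%:E); last first.
    by rewrite fineK// ge0_fin_numE// eball_lty.
  by rewrite -EFinM ltry.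
have av1 : a * v1 = - \int[borel_rV n]_(x in eball 0 1) (u (t, x) - a).
  have -> : a * v1 = \int[borel_rV n]_(x in eball (0 : V) 1) a by rewrite Rintegral_cst.
  apply/eqP; rewrite -addr_eq0 addrC -(RintegralD (mE _ _) iua (icst a)).
  apply/eqP; rewrite -[RHS](u0 t).
  by apply: eq_Rintegral => x _; rewrite subrK.
have aM : `|a| <= M * v / v1.
  rewrite ler_pdivlMr// -[X in `|a| * X](gtr0_norm v10) -normrM av1 normrN.
  apply: le_trans (le_normr_Rintegral _ iua) _ => //.
  by rewrite -lee_fin fineK//; rewrite ge0_fin_numE ?(le_lt_trans ua1) ?ltry// integral_ge0.
apply: (@le_trans _ _ (\int[borel_rV n]_(x in eball 0 rho) `|u (t, x)|%:E)%E).
  apply: ge0_subset_integral => //; apply: measurable_funTS.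
  by apply/measurable_EFinP; exact: measurableT_comp.
apply: (@le_trans _ _ (\int[borel_rV n]_(x in eball 0 rho) (`|u (t, x) - a|%:E + `|a|%:E))%E).
  apply: ge0_le_integral => //.
  - by apply: measurable_funTS; apply/measurable_EFinP; exact: measurableT_comp.
  - by apply: measurable_funTS; exact: emeasurable_funD.
  - by move=> x _; rewrite -EFinD lee_fin -[in leLHS](subrK a (u (t, x))) ler_normD.
rewrite (ge0_integralD (borel_rV n) (mE _ _) _ (measurable_funTS mua)) => [|x _//|x _//|//].
rewrite EFinD leeD//.
rewrite integral_cst//.
rewrite [X in (_ * X)%E](_ : _ = v%:E); last by rewrite fineK// ge0_fin_numE// eball_lty.
by rewrite -EFinM lee_fin ler_wpM2r.
Qed.

End uniform_L1.

Section representative.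
Context {R : realType} {n : nat}.
Local Notation V := 'rV[R]_n.
Local Notation TV := (measurableTypeR R * V)%type.
Local Notation nu := (@time_space_measure R n).

(* The second clause holds for every [t]: changing [F] on the null set of bad
   times keeps oscillation bounds valid at all times. *)
Lemma section_representative (F : R * V -> R) : lmeasurable_fun_time setT F ->
  exists f : TV -> R, [/\ measurable_fun setT f,
    nu.-negligible [set w | F w != f w],
    forall t, (forall x, f (t, x) = 0) \/
      (borel_rV n).-negligible [set x | F (t, x) != f (t, x)] &
    (@lebesgue_measure R).-negligible
      [set t | ~ (borel_rV n).-negligible [set x | F (t, x) != f (t, x)]] ].
Proof.
move=> mF.
have [f0 [mf0 [A [mA A0 FA]]]] := @completed_representative _ TV R nu F mF.
have msec := measurable_fun_xsection (borel_rV n) mA.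
have sec0 t : (0 <= borel_rV n (xsection A t))%E by [].
(* The bad times. The product measure of the null set [A] is the integral of the measures of its
   sections, so [E] is null. *)
pose E : set (measurableTypeR R) := [set t | borel_rV n (xsection A t) != 0%E].
have mE : measurable E.
  have := emeasurable_neq measurableT msec 0%E; rewrite setTI; apply.
have E0 : lebesgue_measure E = 0%E.
  have := A0; rewrite [X in X = _ -> _](_ : _ = \int[lebesgue_measure]_t (borel_rV n (xsection A t)))%E//.
  under eq_integral do rewrite -[borel_rV n _]gee0_abs//.
  move/(ae_eq_integral_abs lebesgue_measure measurableT msec).
  move/negligibleS => /(_ E) H; apply/negligibleP => //; apply: H => t /=.
  by move=> /eqP tE /(_ I).
have mEV : measurable (E `*` [set: V]) by exact: measurableX.
have EV0 : nu (E `*` [set: V]) = 0%E.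
  have -> : nu (E `*` setT) = (@lebesgue_measure R \x borel_rV n)%E (E `*` setT) by [].
  by rewrite product_measure1E// [X in (X * _)%E](_ : _ = 0%E) ?mul0e.
pose f (w : TV) := if w \in E `*` [set: V] then 0 else f0 w.
have fE t x : t \in E -> f (t, x) = 0 by move=> tE; rewrite /f in_setX tE /= mem_set.
have fN t x : t \notin E -> f (t, x) = f0 (t, x).
  by move=> tE; rewrite /f in_setX (negbTE tE).
have sec t : t \notin E -> (borel_rV n).-negligible [set x | F (t, x) != f (t, x)].
  move=> tE; exists (xsection A t); split; first exact: measurable_xsection.
    by apply/eqP; apply: contraNT tE => h; rewrite inE.
  by move=> x /=; rewrite (fN _ _ tE) => h; rewrite /xsection/= mem_set//; exact: FA.
exists f; split.
- apply: measurable_fun_ifT => //.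
  by move=> mT Y mY; apply: (measurable_fun_bool true) => //; rewrite setTI preimage_mem_true.
- exists (A `|` E `*` [set: V]); split; first exact: measurableU.
    by apply: null_set_setU.
  move=> [t x] /= h; have [tE|tE] := boolP (t \in E); first by right; split => //; exact: set_mem.
  by left; apply: FA => /=; rewrite fN in h.
- by move=> t; have [tE|tE] := boolP (t \in E); [left => x; exact: fE|right; exact: sec].
- exists E; split => // t /= h; apply: contrapT => tE; apply: h; apply: sec.
  by apply/negP; rewrite inE.
Qed.

End representative.

Lemma Rintegral_supp d (T : measurableType d) (R : realType)
    (mu : {measure set T -> \bar R}) (D : set T) (g : T -> R) :
  (forall x, ~ D x -> g x = 0) ->
  \int[mu]_(x in D) g x = \int[mu]_x g x.
Proof.
move=> g0; rewrite /Rintegral integral_mkcond; congr fine; apply: eq_integral => x _.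
by rewrite patchE; case: ifPn => // /negP; rewrite inE => /g0 ->.
Qed.

(** * Rescaled smooth kernels and the mollification of [b] *)

Section kernels.
Context {R : realType} {n : nat}.
Local Notation V := 'rV[R]_n.

Lemma Cinfty0_continuous (W : normedModType R) (D : set W) (g : W -> R) :
  Cinfty0 D g -> continuous g.
Proof. by case=> /(_ 0%N). Qed.

Lemma Cinfty0_supp (W : normedModType R) (D : set W) (g : W -> R) x :
  Cinfty0 D g -> g x != 0 -> D x.
Proof. by case=> _ _ gD gx; apply: gD; exact: subset_closure. Qed.

Lemma Cinfty0_bounded (W : normedModType R) (D : set W) (g : W -> R) :
  Cinfty0 D g -> exists A, forall x, g x <= A.
Proof.
move=> gD; have cg := Cinfty0_continuous gD; case: gD => _ cs _.
have /compact_bounded[A [_ Ag]] : compact (g @` supp g).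
  by apply: continuous_compact => //; exact: continuous_subspaceT.
have A1 : A < Num.max A 0 + 1 by rewrite ltr_pwDr// le_max lexx.
exists (Num.max A 0 + 1) => x; have [->|gx0] := eqVneq (g x) 0.
  by rewrite addr_ge0// le_max lexx orbT.
apply: le_trans (ler_norm _) (Ag _ A1 _ _); exists x => //; exact: subset_closure.
Qed.

Lemma enormZ (a : R) (x : V) : enorm (a *: x) = `|a| * enorm x.
Proof.
rewrite /enorm -sqrtr_sqr -sqrtrM ?sqr_ge0//; congr Num.sqrt.
by rewrite mulr_sumr; apply: eq_bigr => i _; rewrite mxE exprMn.
Qed.

Section space_kernel.
Variables (Phi : V -> R) (eps : R).
Hypothesis eps0 : 0 < eps.
Hypothesis Phi_Cinfty0 : Cinfty0 (eball 0 1) Phi.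
Hypothesis Phi_ge0 : forall x, 0 <= Phi x.
Hypothesis int_Phi : \int[leb_rV]_(x in eball 0 1) Phi x = 1.

Definition space_kernel (y : V) := (eps ^+ n)^-1 * Phi (eps^-1 *: y).

Let mPhi : measurable_fun setT Phi.
Proof. by apply: continuous_measurable_rV; exact: Cinfty0_continuous Phi_Cinfty0. Qed.

Let mscaled : measurable_fun setT (fun y : V => Phi (eps^-1 *: y)).
Proof.
under eq_fun do rewrite -[_ *: _]addr0.
exact: (measurableT_comp mPhi (measurable_rV_affine eps^-1 0)).
Qed.

Lemma measurable_space_kernel : measurable_fun setT space_kernel.
Proof. exact: measurable_funM. Qed.

Lemma space_kernel_ge0 y : 0 <= space_kernel y.
Proof. by rewrite mulr_ge0// invr_ge0 exprn_ge0// ltW. Qed.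

Lemma space_kernel_bounded : exists A, forall y, space_kernel y <= A.
Proof.
have [A PhiA] := Cinfty0_bounded Phi_Cinfty0; exists ((eps ^+ n)^-1 * A) => y.
by rewrite ler_wpM2l// invr_ge0 exprn_ge0// ltW.
Qed.

Lemma space_kernel_supp y : space_kernel y != 0 -> eball 0 eps y.
Proof.
rewrite mulf_eq0 negb_or => /andP[_ /(Cinfty0_supp Phi_Cinfty0)].
rewrite /eball /= !subr0 enormZ gtr0_norm ?invr_gt0//.
by rewrite ltr_pdivrMl// mulr1.
Qed.

Lemma integral_space_kernel : (\int[borel_rV n]_y (space_kernel y)%:E = 1)%E.
Proof.
have mEPhi : measurable_fun setT (fun x => (Phi x)%:E) by exact/measurable_EFinP.
have iPhi : (\int[borel_rV n]_x (Phi x)%:E = 1)%E.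
  have : \int[leb_rV]_x Phi x = 1.
    rewrite -int_Phi; apply/esym; apply: Rintegral_supp => x xB.
    by apply: contra_notP xB => /eqP; exact: Cinfty0_supp.
  rewrite /Rintegral completed_integral//.
  (* A real integral equal to 1 rules out infinite values, which [fine] would send to 0. *)
  by case: integral => [r /= ->|/esym/eqP|/esym/eqP] //=; rewrite oner_eq0.
under eq_integral do rewrite EFinM.
have a0 : eps^-1 != 0 by rewrite gt_eqF// invr_gt0.
have e0 : (0 <= ((eps ^+ n)^-1)%:E)%E by rewrite lee_fin invr_ge0 exprn_ge0// ltW.
have ms : measurable_fun setT (fun y : V => (Phi (eps^-1 *: y))%:E) by exact/measurable_EFinP.
rewrite (ge0_integralZl (borel_rV n) measurableT ms (fun y _ => Phi_ge0 _) e0).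
under eq_integral do rewrite -[_ *: _]addr0.
rewrite -iPhi -(ge0_integral_rV_affine 0 a0 mEPhi (fun x => Phi_ge0 x)).
by rewrite gtr0_norm ?invr_gt0// exprVn.
Qed.

End space_kernel.

Section time_kernel.
Variables (eta : R -> R) (eps : R).
Hypothesis eps0 : 0 < eps.
Hypothesis eta_Cinfty0 : @Cinfty0 R R `[-1, 1]%classic eta.
Hypothesis eta_ge0 : forall s, 0 <= eta s.
Hypothesis int_eta :
  \int[completed_lebesgue_measure]_(s in `[-1, 1]%classic) eta s = 1.

Definition time_kernel (s : R) := eps^-1 * eta (s / eps).

Let meta : measurable_fun setT eta.
Proof. by apply: continuous_measurable_fun; exact: Cinfty0_continuous eta_Cinfty0. Qed.

Let mscaled : measurable_fun setT (fun s : R => eta (s / eps)).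
Proof. by apply: measurableT_comp => //; exact: measurable_funM. Qed.

Lemma measurable_time_kernel : measurable_fun setT time_kernel.
Proof. exact: measurable_funM. Qed.

Lemma time_kernel_ge0 s : 0 <= time_kernel s.
Proof. by rewrite mulr_ge0// invr_ge0 ltW. Qed.

Lemma time_kernel_supp s : time_kernel s != 0 -> `[- eps, eps]%classic s.
Proof.
rewrite mulf_eq0 negb_or => /andP[_ /(Cinfty0_supp eta_Cinfty0)].
rewrite /= !in_itv/= ler_pdivlMr// ler_pdivrMr// mul1r mulN1r.
exact.
Qed.

Lemma integral_time_kernel : (\int[lebesgue_measure]_s (time_kernel s)%:E = 1)%E.
Proof.
have mEeta : measurable_fun setT (fun s => (eta s)%:E) by exact/measurable_EFinP.
have ieta : (\int[lebesgue_measure]_s (eta s)%:E = 1)%E.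
  have : \int[completed_lebesgue_measure]_s eta s = 1.
    rewrite -int_eta; apply/esym; apply: Rintegral_supp => s sB.
    by apply: contra_notP sB => /eqP; exact: Cinfty0_supp.
  rewrite /Rintegral (completed_lebesgue_integral_ae (f := fun s => (eta s)%:E))//; last first.
    rewrite (_ : [set x | _] = set0); first exact: negligible_set0.
    by apply/seteqP; split => // s /=; rewrite eqxx.
  by case: integral => [r /= ->|/esym/eqP|/esym/eqP] //=; rewrite oner_eq0.
under eq_integral do rewrite EFinM.
have a0 : eps^-1 != 0 by rewrite gt_eqF// invr_gt0.
have e0 : (0 <= (eps^-1)%:E)%E by rewrite lee_fin invr_ge0 ltW.
have ms : measurable_fun [set: measurableTypeR R] (fun s : R => (eta (s / eps))%:E).
  by apply/measurable_fun_measurableTypeR/measurable_EFinP.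
rewrite (ge0_integralZl lebesgue_measure measurableT ms (fun s _ => eta_ge0 _) e0).
rewrite -ieta -(ge0_integral_lebesgue_affine 0 a0 mEeta (fun x => eta_ge0 x)).
rewrite gtr0_norm ?invr_gt0//; congr (_ * _)%E.
by apply: eq_integral => s _; rewrite addr0 mulrC.
Qed.

End time_kernel.
End kernels.

Section reflection.
Context {R : realType} {n : nat}.
Local Notation V := 'rV[R]_n.

Lemma measurable_rV_reflect (x : V) : measurable_fun setT (fun y : V => x - y).
Proof. exact: measurable_rV_sub. Qed.

Lemma borel_rV_reflect (x : V) (A : set V) : measurable A ->
  borel_rV n ((fun y => x - y) @^-1` A) = borel_rV n A.
Proof.
move=> mA.
have mA' : measurable ((fun y : V => x - y) @^-1` A).
  by rewrite -[X in measurable X]setTI; exact: measurable_rV_reflect.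
have mI : measurable_fun setT (fun y : V => (\1_A y : R)%:E).
  by apply/measurable_EFinP; exact: measurable_indic.
have I0 (y : V) : (0 <= (\1_A y : R)%:E)%E by rewrite lee_fin.
have iA (B : set V) : measurable B -> (\int[borel_rV n]_y (\1_B y : R)%:E = borel_rV n B)%E.
  by move=> mB; rewrite integral_indic// setIT.
by rewrite -iA// -[RHS]iA// -(ge0_integral_rV_reflect x mI I0).
Qed.

Lemma lebesgue_measure_reflect (t : R) (A : set (measurableTypeR R)) : measurable A ->
  lebesgue_measure ((fun s : R => t - s) @^-1` A : set (measurableTypeR R)) = lebesgue_measure A.
Proof.
move=> mA; have a0 : (-1 : R) != 0 by rewrite oppr_eq0 oner_eq0.
have := lebesgue_measure_affine t a0 mA; rewrite normrN1 mul1e => <-; congr lebesgue_measure.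
by apply/seteqP; split => s /=; rewrite mulN1r addrC.
Qed.

End reflection.

Section mollify.
Context {R : realType} {n : nat}.
Local Notation V := 'rV[R]_n.
Local Notation TV := (measurableTypeR R * V)%type.
Variables (Phi : V -> R) (eta : R -> R) (eps : R) (b : R -> V -> R).
Hypothesis eps0 : 0 < eps.
Hypothesis Phi_Cinfty0 : Cinfty0 (eball 0 1) Phi.
Hypothesis eta_Cinfty0 : @Cinfty0 R R `[-1, 1]%classic eta.
Hypothesis Phi_ge0 : forall x, 0 <= Phi x.
Hypothesis eta_ge0 : forall s, 0 <= eta s.
Hypothesis int_Phi : \int[leb_rV]_(x in eball 0 1) Phi x = 1.
Hypothesis int_eta :
  \int[completed_lebesgue_measure]_(s in `[-1, 1]%classic) eta s = 1.
Variable f : TV -> R.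
Hypothesis mf : measurable_fun setT f.
Hypothesis f_L1 : forall r, exists2 C, 0 <= C &
  forall t, (\int[borel_rV n]_(x in eball 0 r) `|f (t, x)|%:E <= C%:E)%E.

Definition zero_extension (w : R * V) : R := if 0 <= w.1 then b w.1 w.2 else 0.

Hypothesis f_section : (@lebesgue_measure R).-negligible
  [set t | ~ (borel_rV n).-negligible [set x | zero_extension (t, x) != f (t, x)]].

(** The reflection of time about [t] preserves null sets, so for almost every [s] the slices of [f]
    and of the extended [b] at [t - s] agree almost everywhere; the reflection of space about [x]
    then equates the inner integrals. Hence equality at every point. *)
Lemma mollify_mollified t x : mollify Phi eta b eps t x =
  mollified (space_kernel Phi eps) (time_kernel eta eps) f (t, x).
Proof.
set psi := space_kernel Phi eps; set theta := time_kernel eta eps.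
have mpsi : measurable_fun setT psi by exact: measurable_space_kernel Phi_Cinfty0.
have mtheta : measurable_fun setT theta by exact: measurable_time_kernel eta_Cinfty0.
have psi0 := space_kernel_ge0 eps0 Phi_ge0.
have theta0 := time_kernel_ge0 eps0 eta_ge0.
have [A psiA] := space_kernel_bounded eps0 Phi_Cinfty0.
have psis := space_kernel_supp eps0 Phi_Cinfty0.
have thetas := time_kernel_supp eps0 eta_Cinfty0.
have itheta := integral_time_kernel eps0 eta_Cinfty0 eta_ge0 int_eta.
rewrite (mollified_iterated mpsi mtheta psi0 theta0 psiA psis itheta eps0 mf f_L1).
pose h (p : measurableTypeR R * V) := psi p.2 * theta p.1 * f ((t - (p.1 : R)) : measurableTypeR R, x - p.2).
have mtheta' : measurable_fun [set: measurableTypeR R] theta.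
  exact/measurable_fun_measurableTypeR.
have mh : measurable_fun setT h.
  apply: measurable_funM.
    apply: measurable_funM; first exact: (measurableT_comp mpsi measurable_snd).
    exact: (measurableT_comp mtheta' measurable_fst).
  apply: (measurableT_comp mf); apply: measurable_fun_time_space.
    exact: measurable_funB measurable_time.
  exact: (measurableT_comp (measurable_rV_reflect x) measurable_snd).
have mE : measurable (eball (0 : V) eps) by exact: measurable_eball.
transitivity (\int[lebesgue_measure]_(s in `[- eps, eps]%classic)
    \int[borel_rV n]_y h (s, y)); last first.
  apply: Rintegral_supp => s sN.
  have ts : theta s = 0 by apply: contra_notP sN => /eqP; exact: thetas.
  rewrite /Rintegral (eq_integral (cst 0%E)) ?integral0// => y _.
  by rewrite /h /= ts mulr0 mul0r.
rewrite /mollify /Rintegral; congr fine.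
apply: completed_lebesgue_integral_ae => //.
  apply: measurable_funTS; apply/measurable_fun_measurableTypeR; apply/measurable_EFinP.
  exact: (measurable_Rintegral_in (borel_rV n) measurableT mh).
have mtr : measurable_fun [set: measurableTypeR R] (fun s => (t - s) : measurableTypeR R).
  by move=> mT Y mY; exact: (measurable_funB (measurable_cst t) (@measurable_id _ R setT)).
have := @negligible_measure_preserving _ _ (measurableTypeR R) (measurableTypeR R) R
  lebesgue_measure lebesgue_measure _ mtr (lebesgue_measure_reflect t) _ f_section.
apply: negligibleS.
move=> s /= /eqP; apply: contra_not => fs; congr EFin; congr fine.
transitivity (\int[borel_rV n]_(y in eball 0 eps) (h (s, y))%:E)%E; last first.
  rewrite integral_mkcond; apply: eq_integral => y _.
  rewrite patchE; case: ifPn => // /negP; rewrite inE => yN; rewrite /h /=.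
  have -> : psi y = 0 by apply: contra_notP yN => /eqP; exact: psis.
  by rewrite !mul0r.
apply: completed_integral_ae => //.
  apply: measurable_funTS; apply/measurable_EFinP.
  exact: (measurableT_comp mh (measurable_pair1 s)).
apply: (negligibleS _ (negligible_measure_preserving (measurable_rV_reflect x)
  (borel_rV_reflect x) fs)).
move=> y /=; apply: contra_neq => fsy; congr EFin.
by rewrite /h /= -fsy.
Qed.

End mollify.

(** * BMO and L^p norms through Borel representatives *)

Section BMO_borel.
Context {R : realType} {n : nat}.
Local Notation V := 'rV[R]_n.
Local Notation TV := (measurableTypeR R * V)%type.
Implicit Types (g h : V -> R) (c : V) (r M : R).

Lemma mean_borel g h c r : measurable_fun setT h ->
  (borel_rV n).-negligible [set x | g x != h x] ->
  mean (eball c r) g = (fine (borel_rV n (eball c r)))^-1 *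
    \int[borel_rV n]_(x in eball c r) h x.
Proof.
move=> mh gh; have mE := measurable_eball c r.
rewrite /mean (_ : leb_rV (eball c r) = borel_rV n (eball c r)); last exact: completedE.
congr (_ * fine _); apply: completed_integral_ae => //.
by apply: measurable_funTS; exact/measurable_EFinP.
Qed.

Lemma oscillation_borel g h c r : measurable_fun setT h ->
  (borel_rV n).-negligible [set x | g x != h x] ->
  oscillation (eball c r) g = ((fine (borel_rV n (eball c r)))^-1%:E *
    \int[borel_rV n]_(x in eball c r)
      `|h x - (fine (borel_rV n (eball c r)))^-1 * \int[borel_rV n]_(y in eball c r) h y|%:E)%E.
Proof.
move=> mh gh; have mE := measurable_eball c r.
rewrite /oscillation (mean_borel c r mh gh).
rewrite (_ : leb_rV (eball c r) = borel_rV n (eball c r)); last exact: completedE.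
congr (_ * _)%E; apply: completed_integral_ae => //.
  by apply: measurable_funTS; exact: measurable_dist_cst.
by apply: negligibleS gh => x /=; apply: contra_neq => ->.
Qed.

Lemma oscillation_borel_le g h c r M : 0 < r -> measurable_fun setT h ->
  (borel_rV n).-negligible [set x | g x != h x] ->
  (oscillation (eball c r) g <= M%:E)%E <->
  (\int[borel_rV n]_(x in eball c r)
    `|h x - (fine (borel_rV n (eball c r)))^-1 * \int[borel_rV n]_(y in eball c r) h y|%:E <=
    (M * fine (borel_rV n (eball c r)))%:E)%E.
Proof.
move=> r0 mh gh; rewrite (oscillation_borel c r mh gh) muleC.
have v0 : 0 < fine (borel_rV n (eball c r)) by rewrite fine_gt0// eball_gt0//= eball_lty.
by rewrite lee_pdivrMr// EFinM.
Qed.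

Lemma oscillation_ge0 g c r : (0 <= oscillation (eball c r) g)%E.
Proof.
rewrite /oscillation mule_ge0 ?integral_ge0//.
by rewrite lee_fin invr_ge0 fine_ge0.
Qed.

Lemma oscillation_cst0 c r : oscillation (eball c r) (fun=> 0) = 0%E.
Proof.
rewrite (@oscillation_borel _ (cst 0) c r)//; last first.
  rewrite (_ : [set x | _] = set0); first exact: negligible_set0.
  by apply/seteqP; split => // x /=; rewrite eqxx.
rewrite Rintegral_cst; last exact: measurable_eball.
rewrite mul0r mulr0 (eq_integral (cst 0%E)); first by rewrite integral0 mule0.
by move=> x _; rewrite subrr normr0.
Qed.

Lemma mean_cst0 c r : mean (eball c r) (fun=> 0) = 0.
Proof.
rewrite /mean /Rintegral (eq_integral (cst 0%E)) ?integral0 ?mulr0// => x _.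
Qed.

Lemma oscillation_le_Linfty (b : R -> V -> R) t c r : 0 <= t -> 0 < r ->
  (oscillation (eball c r) (b t) <= Linfty_BMO_norm b)%E.
Proof.
move=> t0 r0; apply: (@le_trans _ _ (BMO_norm (b t))); apply: ereal_sup_ubound.
  by exists (c, r).
by exists t => //=; rewrite in_itv/= t0.
Qed.

Lemma Linfty_BMO_norm_ge0 (b : R -> V -> R) : (0 <= Linfty_BMO_norm b)%E.
Proof.
apply: le_trans (oscillation_le_Linfty b 0 (lexx 0) ltr01); exact: oscillation_ge0.
Qed.

Lemma Linfty_BMO_norm_le (b : R -> V -> R) M :
  (forall t c r, 0 < r -> (oscillation (eball c r) (b t) <= M%:E)%E) ->
  (Linfty_BMO_norm b <= M%:E)%E.
Proof.
move=> bM; apply: ge_ereal_sup => _ [t _ <-].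
by apply: ge_ereal_sup => _ [[c r] /= r0 <-]; exact: bM.
Qed.

Lemma compact_sub_eball (K : set V) : compact K -> exists r, K `<=` eball 0 r.
Proof.
move=> /compact_bounded[A [_ KA]]; have A1 : A < Num.max A 0 + 1.
  by rewrite ltr_pwDr// le_max lexx.
have m0 : 0 < Num.max A 0 + 1 by rewrite ltr_pwDr// le_max lexx orbT.
exists (n.+1%:R * (Num.max A 0 + 1)) => x Kx; rewrite /eball /= subr0.
apply: enorm_lt => // i; apply: le_trans (KA _ A1 _ Kx).
by rewrite [leRHS]/Num.norm /= mx_normrE; apply: (le_bigmax _ (fun ij => `|x ij.1 ij.2|) (ord0, i)).
Qed.

End BMO_borel.

Section Lp_borel.
Context {R : realType} {n : nat}.
Local Notation V := 'rV[R]_n.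
Local Notation TV := (measurableTypeR R * V)%type.
Local Notation nu := (@time_space_measure R n).

Lemma Lnorm_powR_borel (p : R) (K : set (R * V)) (g : R * V -> R) (u : TV -> R) :
  p != 0 -> compact K -> measurable_fun setT u -> nu.-negligible [set w | g w != u w] ->
  ('N[leb_time_rV]_p%:E[EFin \o (g \_ K)] `^ p = \int[nu]_(w in K) (`|u w| `^ p)%:E)%E.
Proof.
move=> p0 cK mu gu; rewrite poweR_Lnorm//.
have mK : measurable (K : set TV) by exact: compact_measurable_time_rV.
have mup : measurable_fun [set: TV] (fun w => (`|u w| `^ p)%:E).
  apply/measurable_EFinP; apply: (measurableT_comp (measurable_powR p)).
  exact: measurableT_comp.
rewrite [RHS]integral_mkcond.
apply: (@completed_integral_ae _ TV R nu setT) => //.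
  by apply/(measurable_restrictT _ mK); exact: measurable_funTS.
apply: negligibleS gu => w /=; apply: contra_neq => gw; rewrite !patchE.
case: ifPn => [_|_].
  by rewrite gw.
by rewrite [LHS](_ : _ = (`|0 : R| `^ p)%:E)// normr0 powR0.
Qed.

Lemma compact_sub_box (K : set (R * V)) : compact K -> exists2 N, 0 < N & K `<=` box N.
Proof.
move=> cK.
have [r1 K1] : exists r, forall z, K z -> `|z.1| <= r.
  have /compact_bounded[A [_ KA]] : compact ((@fst R V) @` K).
    by apply: continuous_compact => //; apply: continuous_subspaceT => z; exact: cvg_fst.
  exists (Num.max A 0 + 1) => z Kz; apply: KA; last by exists z.
  by rewrite ltr_pwDr// le_max lexx.
have [r2 K2] : exists r, (@snd R V) @` K `<=` eball 0 r.
  apply: compact_sub_eball.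
  by apply: continuous_compact => //; apply: continuous_subspaceT => z; exact: cvg_snd.
pose N := Num.max 1 (Num.max r1 r2); exists N; first by rewrite lt_max ltr01.
move=> [t x] Ktx; split => /=.
  have : t <= `|t| by exact: ler_norm.
  rewrite in_itv/= -ler_norml (le_trans (K1 _ Ktx))//.
  by rewrite !le_max lexx orbT.
have : eball 0 r2 x by apply: K2; exists (t, x).
rewrite /eball /= subr0 => xr i; rewrite mxE.
have := le_lt_trans (ler_coord_enorm x i) (lt_le_trans xr (_ : r2 <= N)).
rewrite !le_max lexx !orbT ltr_norml => /(_ isT) /andP[? ?].
by apply/andP; split; lra.
Qed.

Lemma eq_restrict (K : set (R * V)) (g h : R * V -> R) :
  (forall w, K w -> g w = h w) -> g \_ K = h \_ K.
Proof.
move=> gh; apply/funext => w; rewrite !patchE; case: ifPn => //.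
by rewrite inE => /gh.
Qed.

Lemma eq_Lp_on (p : R) (K : set (R * V)) (g h : R * V -> R) :
  (forall w, K w -> g w = h w) -> Lp_on p K g -> Lp_on p K h.
Proof.
move=> gh [mg goo]; split; last by rewrite -(eq_restrict gh).
by apply: eq_measurable_fun mg => w; rewrite inE => /gh.
Qed.

Lemma Lp_on_borel (p : R) (K : set (R * V)) N (g : R * V -> R) (u : TV -> R) :
  p != 0 -> compact K -> K `<=` box N -> measurable_fun setT u ->
  nu.-negligible [set w | g w != u w] ->
  (\int[nu]_(w in box N) (`|u w| `^ p)%:E < +oo)%E -> Lp_on p K g.
Proof.
move=> p0 cK KN mu gu uoo.
have mK : measurable (K : set TV) by exact: compact_measurable_time_rV.
have mup : measurable_fun [set: TV] (fun w => (`|u w| `^ p)%:E).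
  apply/measurable_EFinP; apply: (measurableT_comp (measurable_powR p)).
  exact: measurableT_comp.
split.
  apply: (@completed_measurable_fun_ae _ TV R nu K u g mK) => //.
  exact: measurable_funTS.
apply: (lty_poweRy p0); rewrite (Lnorm_powR_borel p0 cK mu gu).
apply: le_lt_trans uoo; apply: ge0_subset_integral => //.
- exact: measurable_box.
- exact: measurable_funTS.
Qed.

Lemma poweR_le (x : \bar R) (p e : R) : 0 < p -> 0 < e -> (0 <= x)%E ->
  (x `^ p <= (e `^ p)%:E)%E -> (x <= e%:E)%E.
Proof.
move=> p0 e0 x0 xp; rewrite leNgt; apply/negP => ex.
have p_neq0 : p != 0 by rewrite gt_eqF.
have xoo : (x < +oo)%E by apply: (lty_poweRy p_neq0); rewrite (le_lt_trans xp)// ltry.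
move: x0 xp ex; case: x xoo => [r| |]//= _.
rewrite !lee_fin lte_fin => r0; rewrite leNgt => /negP rp er; apply: rp.
by apply: gt0_ltr_powR => //; rewrite nnegrE// ltW.
Qed.

End Lp_borel.

Section BMO_representative.
Context {R : realType} {n : nat}.
Local Notation V := 'rV[R]_n.
Local Notation TV := (measurableTypeR R * V)%type.
Local Notation nu := (@time_space_measure R n).

Lemma measurable_half_space : measurable (@half_space R n : set TV).
Proof.
rewrite [X in measurable X](_ : _ = fst @^-1` `[0, +oo[%classic).
  by rewrite -[X in measurable X]setTI; apply: measurable_time => //; exact: measurable_itv.
by apply/seteqP; split => z; rewrite /half_space /= in_itv/= andbT.
Qed.

Lemma lmeasurable_zero_extension (b : R -> V -> R) :
  lmeasurable_fun_time half_space (fun z => b z.1 z.2) ->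
  lmeasurable_fun_time setT (zero_extension b).
Proof.
move=> mb; have mH := @completed_measurable _ TV R nu _ measurable_half_space.
have /(measurable_restrictT _ mH) := mb.
rewrite /lmeasurable_fun_time [X in measurable_fun _ X -> _](_ : _ = zero_extension b)//.
apply/funext => z; rewrite /zero_extension patchE; case: ifPn.
  by rewrite inE => ->.
by move=> /negP; rewrite inE => /negP/negbTE ->.
Qed.

Variable b : R -> V -> R.
Hypothesis b_BMO : Linfty_BMO b.
Hypothesis b_mean0 : forall t, 0 <= t -> mean (eball 0 1) (b t) = 0.

Let M := fine (Linfty_BMO_norm b).

Lemma Linfty_BMO_normE : Linfty_BMO_norm b = M%:E.
Proof. by case: b_BMO => _ _ boo; rewrite fineK// ge0_fin_numE// Linfty_BMO_norm_ge0. Qed.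

Lemma BMO_representative : exists f : TV -> R,
  [/\ measurable_fun setT f /\ nu.-negligible [set w | zero_extension b w != f w],
    forall t c r, 0 < r ->
      (\int[borel_rV n]_(x in eball c r) `|f (t, x) - (fine (borel_rV n (eball c r)))^-1 *
        \int[borel_rV n]_(x in eball c r) f (t, x)|%:E <=
       (M * fine (borel_rV n (eball c r)))%:E)%E,
    forall t, \int[borel_rV n]_(x in eball 0 1) f (t, x) = 0 &
    (@lebesgue_measure R).-negligible
      [set t | ~ (borel_rV n).-negligible [set x | zero_extension b (t, x) != f (t, x)]] ].
Proof.
have [mb _ _] := b_BMO.
have [f [mf bf f_sec bf_time]] := section_representative (lmeasurable_zero_extension mb).
have M0 : 0 <= M by rewrite fine_ge0// Linfty_BMO_norm_ge0.
have mft t : measurable_fun setT (fun x => f (t, x)) by exact: (measurableT_comp mf (measurable_pair1 t)).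
(* Each slice of [f] receives a function to which the hypotheses apply: [b t] at nonnegative times
   where the slice represents it, and the zero function at bad or negative times. *)
have sec t : exists g, [/\ (borel_rV n).-negligible [set x | g x != f (t, x)],
    forall c r, 0 < r -> (oscillation (eball c r) g <= M%:E)%E & mean (eball 0 1) g = 0].
  have neg0 (g h : V -> R) : g =1 h -> (borel_rV n).-negligible [set x | g x != h x].
    move=> gh; rewrite (_ : [set x | _] = set0); first exact: negligible_set0.
    by apply/seteqP; split => // x /=; rewrite gh eqxx.
  have [f0|fneg] := f_sec t.
    exists (fun=> 0); split; last exact: mean_cst0.
    - by apply: neg0 => x; rewrite f0.
    - by move=> c r _; rewrite oscillation_cst0 lee_fin.
  have [t0|t0] := leP 0 t.
    exists (b t); split; last exact: b_mean0.
    - by apply: negligibleS fneg => x /=; rewrite /zero_extension /= t0.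
    - by move=> c r r0; rewrite -Linfty_BMO_normE; exact: oscillation_le_Linfty.
  exists (fun=> 0); split; last exact: mean_cst0.
  - by apply: negligibleS fneg => x /=; rewrite /zero_extension /= leNgt t0.
  - by move=> c r _; rewrite oscillation_cst0 lee_fin.
exists f; split => //.
- move=> t c r r0; have [g [gf gM _]] := sec t.
  by apply/(oscillation_borel_le c M r0 (mft t) gf); exact: gM.
- move=> t; have [g [gf _ g0]] := sec t.
  move: g0; rewrite (mean_borel 0 1 (mft t) gf) => /eqP; rewrite mulf_eq0 invr_eq0.
  by rewrite gt_eqF ?fine_gt0 ?eball_gt0//= ?eball_lty// => /eqP.
Qed.

End BMO_representative.

(** * From Borel bounds back to the spaces of the statement, and the conclusion *)

Section mollify_BMO.
Context {R : realType} {n : nat}.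
Local Notation V := 'rV[R]_n.
Local Notation TV := (measurableTypeR R * V)%type.
Local Notation nu := (@time_space_measure R n).

(** Centred at the mean, unlike [bounded_oscillation]: this is the form in which the constant passes
    to the mollification unchanged. *)
Definition mean_oscillation_le (M : R) (u : TV -> R) := forall t c r, 0 < r ->
  (\int[borel_rV n]_(x in eball c r) `|u (t, x) - (fine (borel_rV n (eball c r)))^-1 *
    \int[borel_rV n]_(x in eball c r) u (t, x)|%:E <=
   (M * fine (borel_rV n (eball c r)))%:E)%E.

Definition locally_uniformly_L1 (u : TV -> R) := forall r, exists2 C, 0 <= C &
  forall t, (\int[borel_rV n]_(x in eball 0 r) `|u (t, x)|%:E <= C%:E)%E.

Lemma mean_oscillation_bounded (M M' : R) (u : TV -> R) : M <= M' ->
  mean_oscillation_le M u -> bounded_oscillation M' u.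
Proof.
move=> MM' uM t c r r0; eexists; apply: le_trans (uM t c r r0) _.
by rewrite lee_fin ler_wpM2r// fine_ge0.
Qed.

Lemma centered_cube_L1 (u : TV -> R) N : measurable_fun setT u ->
  locally_uniformly_L1 u -> 0 < N -> exists2 C, 0 <= C &
  forall t, (\int[borel_rV n]_(x in centered_cube N) `|u (t, x)|%:E <= C%:E)%E.
Proof.
move=> mu uL N0; have [C C0 uC] := uL (n.+1%:R * N); exists C => // t.
apply: le_trans (uC t); apply: ge0_subset_integral => //.
- exact: measurable_cube.
- exact: measurable_eball.
- apply: measurable_funTS; apply/measurable_EFinP; apply: measurableT_comp => //.
  exact: (measurableT_comp mu (measurable_pair1 t)).
- exact: centered_cube_eball.
Qed.

Lemma Linfty_BMO_borel (u : TV -> R) (b : R -> V -> R) (M : R) :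
  measurable_fun setT u -> (forall t x, b t x = u (t, x)) ->
  locally_uniformly_L1 u -> mean_oscillation_le M u ->
  Linfty_BMO b /\ (Linfty_BMO_norm b <= M%:E)%E.
Proof.
move=> mu bu uL uM.
have mut t : measurable_fun setT (fun x => u (t, x)) by exact: (measurableT_comp mu (measurable_pair1 t)).
have bM : (Linfty_BMO_norm b <= M%:E)%E.
  apply: Linfty_BMO_norm_le => t c r r0; rewrite (_ : b t = fun x => u (t, x)); last exact/funext.
  apply/(oscillation_borel_le c M r0 (mut t)); last exact: uM.
  rewrite (_ : [set x | _] = set0); first exact: negligible_set0.
  by apply/seteqP; split => // x /=; rewrite eqxx.
split => //; split.
- rewrite (_ : (fun z => _) = u); last by apply/funext => -[t x]; exact: bu.
  apply: (@completed_measurable_fun _ TV R nu _ _ half_space u); last exact: measurable_half_space.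
  exact: measurable_funTS.
- move=> t t0; rewrite (_ : b t = fun x => u (t, x)); last exact/funext.
  split; first exact: completed_measurable_fun.
  move=> K cK; have [r Kr] := compact_sub_eball cK; have [C _ uC] := uL r.
  have mabs : measurable_fun setT (fun x => `|u (t, x)|%:E).
    by apply/measurable_EFinP; exact: measurableT_comp.
  have mK := compact_measurable_rV cK.
  rewrite completed_integral//; last exact: measurable_funTS.
  apply: (@le_lt_trans _ _ C%:E); last by rewrite ltry.
  apply: le_trans (uC t); apply: ge0_subset_integral => //.
  + exact: measurable_eball.
  + exact: measurable_funTS.
- by apply: le_lt_trans bM _; rewrite ltry.
Qed.

End mollify_BMO.

Unset Implicit Arguments.

Theorem proposition3p3 (R : realType) (n : nat) (n_gt0 : (0 < n)%N)
    (Phi : 'rV[R]_n -> R) (eta : R -> R) (b : R -> 'rV[R]_n -> R)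
    (Phi_Cinfty0 : Cinfty0 (eball 0 1) Phi)
    (eta_Cinfty0 : @Cinfty0 R R `[-1, 1]%classic eta)
    (Phi_ge0 : forall x, 0 <= Phi x)
    (eta_ge0 : forall s, 0 <= eta s)
    (int_Phi : \int[leb_rV]_(x in eball 0 1) Phi x = 1)
    (int_eta :
      \int[completed_lebesgue_measure]_(s in `[-1, 1]%classic) eta s = 1)
    (b_BMO : Linfty_BMO b)
    (b_mean0 : forall t, 0 <= t -> mean (eball 0 1) (b t) = 0) :
  (forall p, 1 <= p -> cvg_Lploc p (mollify Phi eta b) b) /\
  (forall eps, 0 < eps ->
    Linfty_BMO (mollify Phi eta b eps) /\
    (Linfty_BMO_norm (mollify Phi eta b eps) <= Linfty_BMO_norm b)%E).
Proof.
pose M := fine (Linfty_BMO_norm b).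
have M0 : 0 <= M by rewrite fine_ge0// Linfty_BMO_norm_ge0.
have [f [[mf bf] fM f0 fs]] := BMO_representative b_BMO b_mean0.
have fB : bounded_oscillation M f by exact: mean_oscillation_bounded fM.
have fL : locally_uniformly_L1 f by exact: oscillation_uniform_L1 M0 mf fB f0.
pose u eps := mollified (space_kernel Phi eps) (time_kernel eta eps) f.
have uE eps t x : 0 < eps -> mollify Phi eta b eps t x = u eps (t, x).
  by move=> eps0; exact: mollify_mollified.
have mpsi eps := measurable_space_kernel eps Phi_Cinfty0.
have mtheta eps := measurable_time_kernel eps eta_Cinfty0.
have psi0 eps (eps0 : 0 < eps) := space_kernel_ge0 eps0 Phi_ge0.
have theta0 eps (eps0 : 0 < eps) := time_kernel_ge0 eps0 eta_ge0.
have psis eps (eps0 : 0 < eps) := space_kernel_supp eps0 Phi_Cinfty0.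
have thetas eps (eps0 : 0 < eps) := time_kernel_supp eps0 eta_Cinfty0.
have ipsi eps (eps0 : 0 < eps) := integral_space_kernel eps0 Phi_Cinfty0 Phi_ge0 int_Phi.
have itheta eps (eps0 : 0 < eps) := integral_time_kernel eps0 eta_Cinfty0 eta_ge0 int_eta.
have mu eps : measurable_fun setT (u eps).
  exact: (measurable_mollified (mpsi eps) (mtheta eps) mf).
have uM eps : 0 < eps -> mean_oscillation_le M (u eps).
  move=> eps0 t c r r0; have [A psiA] := space_kernel_bounded eps0 Phi_Cinfty0.
  exact: (mollified_oscillation_le (mpsi eps) (mtheta eps) (psi0 _ eps0) (theta0 _ eps0) psiA
    (psis _ eps0) (thetas _ eps0) (ipsi _ eps0) (itheta _ eps0) eps0 M0 mf fL fM).
have uL eps : 0 < eps -> locally_uniformly_L1 (u eps).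
  (* The L^1 estimate asks for a positive radius, while [r] is arbitrary. *)
  move=> eps0 r; have r0 : 0 < Num.max r 1 by rewrite lt_max ltr01 orbT.
  have [C C0 fC] := fL (n.+1%:R * (Num.max r 1 + eps)); exists C => // t.
  have := mollified_L1_le (mpsi eps) (mtheta eps) (psi0 _ eps0) (theta0 _ eps0)
    (psis _ eps0) (thetas _ eps0) (ipsi _ eps0) (itheta _ eps0) mf r0 (lexx eps) fC t.
  apply: le_trans; apply: ge0_subset_integral => //; try exact: measurable_eball.
    apply: measurable_funTS; apply/measurable_EFinP; apply: measurableT_comp => //.
    exact: (measurableT_comp (mu eps) (measurable_pair1 t)).
  by move=> x; rewrite /eball /= => /lt_le_trans; apply; rewrite le_max lexx.
split=> [p p1 K cK KH|eps eps0]; last first.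
  rewrite (Linfty_BMO_normE b_BMO); apply: (Linfty_BMO_borel (mu eps)) => //.
  - by move=> t x; exact: uE.
  - exact: uL.
  - exact: uM.
have p0 : 0 < p by exact: lt_le_trans p1.
have p_neq0 : p != 0 by rewrite gt_eqF.
have [N N0 KN] := compact_sub_box cK.
(* The exponential estimate needs a positive oscillation bound, whereas [M] may vanish; the L^p part
   therefore works with [M + 1]. *)
have M1 : 0 < M + 1 by rewrite ltr_wpDl.
have MM1 : M <= M + 1 by rewrite lerDl.
have fB1 := mean_oscillation_bounded MM1 fM.
have bK w : K w -> zero_extension b w = b w.1 w.2.
  by move=> /KH; rewrite /zero_extension /half_space /= => ->.
have LpK (g : R * 'rV[R]_n -> R) h : measurable_fun setT h -> locally_uniformly_L1 h ->
    mean_oscillation_le M h ->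
    (@time_space_measure R n).-negligible [set w | g w != h w] -> Lp_on p K g.
  move=> mh hL hM gh; apply: (Lp_on_borel p_neq0 cK KN mh gh).
  have [C C0 hC] := centered_cube_L1 mh hL N0.
  exact: (powR_integral_lty p1 M1 N0 C0 mh (mean_oscillation_bounded MM1 hM) hC).
split.
- exact: (eq_Lp_on bK (LpK _ _ mf fL fM bf)).
- move=> eps eps0; rewrite (_ : (fun z => _) = u eps); last first.
    by apply/funext => -[t x]; exact: uE.
  apply: (LpK _ (u eps)) => //; [exact: uL|exact: uM|].
  rewrite (_ : [set x | _] = set0); first exact: negligible_set0.
  by apply/seteqP; split => // x /=; rewrite eqxx.
apply: ge0_cvge0; first by apply: nearW => eps; exact: Lnorm_ge0.
(* Norms are compared through their p-th powers, so the target for the integral is the p-th power of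
   [e]. *)
move=> e e0; have ep0 : 0 < e `^ p by exact: powR_gt0.
have [d d0 fd] := mollified_Lp_cvg p1 M1 N0 ep0 mf fL fB1.
near=> eps.
have eps0 : 0 < eps by near: eps; exact: nbhs_right_gt.
have epsd : eps <= d by near: eps; exact: nbhs_right_le.
apply: (poweR_le p0 e0); first exact: Lnorm_ge0.
(* On [K] times are nonnegative, so [b] may be replaced by its extension, of which [f] is a
   representative. *)
rewrite (_ : _ \_ K = (fun z => u eps z - zero_extension b z) \_ K); last first.
  apply: eq_restrict => -[t x] Kz; rewrite bK//; congr (_ - _); exact: uE.
have mh : measurable_fun setT (fun w => u eps w - f w) by exact: measurable_funB.
rewrite (Lnorm_powR_borel p_neq0 cK mh); last first.
  by apply: negligibleS bf => w /=; apply: contra_neq => ->.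
have [A psiA] := space_kernel_bounded eps0 Phi_Cinfty0.
apply: le_trans (fd _ _ _ A (mpsi eps) (mtheta eps) (psi0 _ eps0) (theta0 _ eps0) psiA
  (psis _ eps0) (thetas _ eps0) (ipsi _ eps0) (itheta _ eps0) eps0 epsd
  (mean_oscillation_bounded MM1 (uM _ eps0))).
apply: ge0_subset_integral => //.
- exact: compact_measurable_time_rV.
- exact: measurable_box.
- apply: measurable_funTS; apply/measurable_EFinP.
  by apply: (measurableT_comp (measurable_powR p)); exact: measurableT_comp.
Unshelve. all: by end_near. Qed.
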